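(* Let $L$ be a nondegenerate homogeneous linear pencil in $g$ variables, let $\tilde L$ be a minimal dimensional defining pencil for $\mathcal B_L$, and let $L'$ be an arbitrary homogeneous linear pencil with $\mathbb C^{\ell'\times\ell}$ coefficients. If $f:\mathcal B_L\to\mathcal B_{L'}$ is a pencil ball to pencil ball map with $f(0)=0$, then there exist $m,m'\in\mathbb N_0$, unitaries $U\in\mathbb C^{\ell'\times\ell'}$ and $V\in\mathbb C^{\ell\times\ell}$, and a contraction-valued analytic $\tilde f:\mathcal B_L\to\mathcal M_{m',m}$ such that $$(L'\circ f)(x)=U\begin{pmatrix}\tilde L(x)&0\\0&\tilde f(x)\end{pmatrix}V^*.$$
   Context: Pencils. A $d'\times d$ homogeneous linear pencil in $g$ variables is $L(x)=\sum_{j=1}^g A_jx_j$ with $A_j\in\mathbb C^{d'\times d}$. For $X=(X_1,\dots,X_g)\in(\mathbb C^{n\times n})^g$ put $L(X)=\sum_j A_j\otimes X_j$; $\|\cdot\|$ is the operator norm. $L$ is nondegenerate if for all $n$ and all $X\in(\mathbb C^{n\times n})^g$, $L(X)=0$ implies $X=0$. The pencil ball is $\mathcal B_L=(\mathcal B_L(n))_{n\in\mathbb N}$ with $\mathcal B_L(n)=\{X\in(\mathbb C^{n\times n})^g:\|L(X)\|<1\}$, and its boundary is $\partial\mathcal B_L=(\partial\mathcal B_L(n))_{n}$ with $\partial\mathcal B_L(n)=\{X:\|L(X)\|=1\}$. A nondegenerate $p'\times p$ homogeneous linear pencil $\tilde L$ is a minimal dimensional defining pencil for a ball if every nondegenerate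 $d'\times d$ homogeneous linear pencil $L$ with $\mathcal B_L=\mathcal B_{\tilde L}$ satisfies $p'p\le d'd$; it is a minimal dimensional defining pencil for $\mathcal B_L$ if moreover $\mathcal B_{\tilde L}=\mathcal B_L$. Analytic maps. $\mathcal M_{\ell',\ell}=((\mathbb C^{n\times n})^{\ell'\times\ell})_{n\in\mathbb N}$. Let $\langle x\rangle$ be the set of words in the noncommuting variables $x_1,\dots,x_g$ (including the empty word). A formal power series $f=\sum_{m\ge0}\sum_{|w|=m}f_ww$ with $f_w\in\mathbb C^{\ell'\times\ell}$ is evaluated at $X\in(\mathbb C^{n\times n})^g$ by $f(X)=\sum_{m=0}^\infty\sum_{|w|=m}f_w\otimes w(X)$ (summed in this order), where $w(X)=X_{j_1}\cdots X_{j_k}$ for $w=x_{j_1}\cdots x_{j_k}$. It is analytic on $\mathcal B_L$, written $f:\mathcal B_L\to\mathcal M_{\ell',\ell}$, if the series converges for all $n$ and all $X\in\mathcal B_L(n)$; it is contraction-valued if $\|f(X)\|\le1$ for all $X\in\mathcal B_L$. Maps between pencil balls. Let $L'$ be a homogeneous linear pencil in $g'$ variables. An analytic map $f:\mathcal B_L\to\mathcal B_{L'}$ is a tuple $f=(f_1,\dots,f_{g'})$ of formal power series with scalar coefficients, analytic on $\mathcal B_L$, with $f(X)\in\mathcal B_{L'}(n)$ for all $n$ and $X\in\mathcal B_L(n)$; $(L'\circ f)(X)=L'(f(X))$. It is a pencil ball to pencil ball map if $f(\partial\mathcal B_L)\subseteq\partial\mathcal B_{L'}$, meaning in terms of boundary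 values: for every $n$ and $X\in\partial\mathcal B_L(n)$, the boundary values $(L'\circ f)(\exp(it)X)$ of the bounded analytic function $z\mapsto (L'\circ f)(zX)$ on the unit disc (which exist for a.e. $t$ by Fatou's theorem) have norm $1$ for a.e. $t$. Blocks of size $0$ are allowed: if $m=0$ and/or $m'=0$ the corresponding block columns and/or rows are absent. *)

(* Defs.v *)
From mathcomp Require Import all_boot all_order all_algebra spectral.
From mathcomp Require Import all_classical all_reals all_analysis.
From mathcomp Require Import complex.
(* The notation [A ^t k] of [mxtens] would break the conjugate transpose
   [A ^t*] of [spectral], hence only the names are imported. *)
From mathcomp Require Import -(notations) mxtens.

Set Implicit Arguments.
Unset Strict Implicit.
Unset Printing Implicit Defensive.

Import Order.TTheory GRing.Theory Num.Theory.
Import numFieldNormedType.Exports.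

Local Open Scope classical_set_scope.
Local Open Scope ring_scope.

(* Kronecker product: block (i, j) of [A *t B] is [A i j *: B]. *)
Notation "A *t B" := (tensmx A B)
  (at level 40, left associativity, format "A  *t  B") : ring_scope.

(* The complex field, seen as an abstract [numClosedFieldType]: this is the form
   under which it and its matrices receive their usual topology. *)
Definition Cplx (R : realType) : numClosedFieldType := R[i].

Definition expi (R : realType) (t : R) : Cplx R := (cos t +i* sin t)%C.

Definition eucl_norm (R : realType) (n : nat) (v : 'cV[Cplx R]_n) : R :=
  Num.sqrt (\sum_i Normc.normc (v i 0) ^+ 2).

Definition opnorm (R : realType) (m n : nat) (A : 'M[Cplx R]_(m, n)) : R :=
  sup [set eucl_norm (A *m v) | v in [set v | eucl_norm v <= 1]].

Definition mxtuple (R : realType) (g n : nat) : Type := 'I_g -> 'M[Cplx R]_n.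

Definition pencil (R : realType) (g d' d : nat) : Type :=
  'I_g -> 'M[Cplx R]_(d', d).

Definition pencil_eval (R : realType) (g d' d n : nat)
    (L : pencil R g d' d) (X : mxtuple R g n) : 'M[Cplx R]_(d' * n, d * n) :=
  \sum_(j < g) L j *t X j.

Definition nondegenerate_pencil (R : realType) (g d' d : nat)
    (L : pencil R g d' d) : Prop :=
  forall (n : nat) (X : mxtuple R g n),
    pencil_eval L X = 0 -> forall j, X j = 0.

Definition pencil_ball (R : realType) (g d' d : nat)
    (L : pencil R g d' d) (n : nat) : set (mxtuple R g n) :=
  [set X | opnorm (pencil_eval L X) < 1].
Arguments pencil_ball {R g d' d} L n.

Definition pencil_sphere (R : realType) (g d' d : nat)
    (L : pencil R g d' d) (n : nat) : set (mxtuple R g n) :=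
  [set X | opnorm (pencil_eval L X) = 1].
Arguments pencil_sphere {R g d' d} L n.

Definition same_ball (R : realType) (g d1' d1 d2' d2 : nat)
    (L1 : pencil R g d1' d1) (L2 : pencil R g d2' d2) : Prop :=
  forall n, pencil_ball L1 n = pencil_ball L2 n.

Definition minimal_defining_pencil (R : realType) (g p' p : nat)
    (Lt : pencil R g p' p) : Prop :=
  nondegenerate_pencil Lt /\
  forall (d' d : nat) (L : pencil R g d' d),
    nondegenerate_pencil L -> same_ball L Lt -> (p' * p <= d' * d)%N.

Definition minimal_defining_pencil_for (R : realType) (g d' d p' p : nat)
    (L : pencil R g d' d) (Lt : pencil R g p' p) : Prop :=
  minimal_defining_pencil Lt /\ same_ball Lt L.

(* Formal power series in noncommuting variables, given by the coefficient of
   each word. *)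
Definition nc_series (R : realType) (g l' l : nat) : Type :=
  seq 'I_g -> 'M[Cplx R]_(l', l).

Definition nc_scalar_series (R : realType) (g : nat) : Type :=
  seq 'I_g -> Cplx R.

Definition word_eval (R : realType) (g n : nat)
    (X : mxtuple R g n) (w : seq 'I_g) : 'M[Cplx R]_n :=
  \prod_(j <- w) X j.

Definition nc_term (R : realType) (g l' l n : nat) (f : nc_series R g l' l)
    (X : mxtuple R g n) (m : nat) : 'M[Cplx R]_(l' * n, l * n) :=
  \sum_(w : m.-tuple 'I_g) f w *t word_eval X w.

(* Not an instance of [nc_term]: 1 * n is not convertible to n. *)
Definition nc_scalar_term (R : realType) (g n : nat) (f : nc_scalar_series R g)
    (X : mxtuple R g n) (m : nat) : 'M[Cplx R]_n :=
  \sum_(w : m.-tuple 'I_g) f w *: word_eval X w.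

(* Only meaningful where the series converges. *)
Definition nc_eval (R : realType) (g l' l n : nat) (f : nc_series R g l' l)
    (X : mxtuple R g n) : 'M[Cplx R]_(l' * n, l * n) :=
  limn (series (nc_term f X)).

Definition nc_scalar_eval (R : realType) (g n : nat) (f : nc_scalar_series R g)
    (X : mxtuple R g n) : 'M[Cplx R]_n :=
  limn (series (nc_scalar_term f X)).

Definition analytic_on (R : realType) (g d' d l' l : nat)
    (L : pencil R g d' d) (f : nc_series R g l' l) : Prop :=
  forall (n : nat) (X : mxtuple R g n),
    pencil_ball L n X -> cvgn (series (nc_term f X)).

Definition scalar_analytic_on (R : realType) (g d' d : nat)
    (L : pencil R g d' d) (f : nc_scalar_series R g) : Prop :=
  forall (n : nat) (X : mxtuple R g n),
    pencil_ball L n X -> cvgn (series (nc_scalar_term f X)).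

Definition contraction_valued (R : realType) (g d' d l' l : nat)
    (L : pencil R g d' d) (f : nc_series R g l' l) : Prop :=
  forall (n : nat) (X : mxtuple R g n),
    pencil_ball L n X -> opnorm (nc_eval f X) <= 1.

Definition nc_map (R : realType) (g g' : nat) : Type :=
  'I_g' -> nc_scalar_series R g.

Definition map_eval (R : realType) (g g' n : nat) (f : nc_map R g g')
    (X : mxtuple R g n) : mxtuple R g' n :=
  fun i => nc_scalar_eval (f i) X.

Definition comp_eval (R : realType) (g g' l' l n : nat)
    (L' : pencil R g' l' l) (f : nc_map R g g') (X : mxtuple R g n) :
    'M[Cplx R]_(l' * n, l * n) :=
  pencil_eval L' (map_eval f X).

Definition analytic_ball_map (R : realType) (g d' d g' l' l : nat)
    (L : pencil R g d' d) (L' : pencil R g' l' l) (f : nc_map R g g') : Prop :=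
  (forall i, scalar_analytic_on L (f i)) /\
  forall (n : nat) (X : mxtuple R g n),
    pencil_ball L n X -> pencil_ball L' n (map_eval f X).

(* [B] is the radial limit at exp(it) of a matrix-valued function on the unit
   disc; for bounded analytic functions it exists for a.e. t. *)
Definition boundary_value (R : realType) (m n : nat)
    (F : Cplx R -> 'M[Cplx R]_(m, n)) (t : R) (B : 'M[Cplx R]_(m, n)) : Prop :=
  F (r%:C%C * expi t) @[r --> (1 : R)^'-] --> B.

Definition maps_boundary_to_boundary (R : realType) (g d' d g' l' l : nat)
    (L : pencil R g d' d) (L' : pencil R g' l' l) (f : nc_map R g g') : Prop :=
  forall (n : nat) (X : mxtuple R g n), pencil_sphere L n X ->
    {ae @lebesgue_measure R, forall t : R,
      exists2 B, boundary_value (fun z => comp_eval L' f (fun j => z *: X j)) t B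
               & opnorm B = 1}.

Definition ball_to_ball_map (R : realType) (g d' d g' l' l : nat)
    (L : pencil R g d' d) (L' : pencil R g' l' l) (f : nc_map R g g') : Prop :=
  analytic_ball_map L L' f /\ maps_boundary_to_boundary L L' f.

Definition vanishes_at_zero (R : realType) (g g' : nat)
    (f : nc_map R g g') : Prop :=
  forall (n : nat) (i : 'I_g'), map_eval f (fun=> 0 : 'M[Cplx R]_n) i = 0.

(* The action of a scalar matrix on the values at n x n matrices. *)
Definition ampl (R : realType) (m k : nat) (A : 'M[Cplx R]_(m, k)) (n : nat) :
    'M[Cplx R]_(m * n, k * n) :=
  A *t (1%:M : 'M[Cplx R]_n).

Lemma ampl_dim (a b c n : nat) : (a + b = c)%N -> (a * n + b * n = c * n)%N.
Proof. by move=> <-; rewrite mulnDl. Qed.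

(* The Kronecker product splits row and column blocks of the left factor
   contiguously, so the cast only changes the form of the dimensions. *)
Definition diag_block (R : realType) (a' b' c' a b c n : nat)
    (E' : (a' + b' = c')%N) (E : (a + b = c)%N)
    (A : 'M[Cplx R]_(a' * n, a * n)) (B : 'M[Cplx R]_(b' * n, b * n)) :
    'M[Cplx R]_(c' * n, c * n) :=
  castmx (ampl_dim n E', ampl_dim n E) (block_mx A 0 0 B).

(* Main.v *)
(* On a block nilpotent tuple [[0, X], [0, 0]] the map [L' o f] reduces to its
   linear part [M], and the boundary values there are [exp(it) M]; hence
   [|M(X)| = |L(X)|] for all X, i.e. [M] and [Lt] define the same ball.

   Inclusion of balls gives Kraus factorizations
   [M_j = sum_i A_i^* Lt_j B_i] and [Lt_j = sum_i X_i^* M_j Y_i] with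
   [sum_i A_i^* A_i = 1], etc. (a positive functional is extended from an
   operator system to all matrices and represented by a positive semidefinite
   matrix). Minimality of [Lt] makes the composite factorization of [Lt]
   through itself trivial, so that every [(X_i, Y_i)] intertwines [Lt] and [M];
   a partially isometric intertwiner of maximal rank is then isometric, again
   by minimality, and exhibits [Lt] as a direct summand of [M].

   Finally, evaluating [L' o f] on longer nilpotent paths shows that
   [(M_j; delta h_uj)] is dominated by [Lt] for every nonempty word [u], [h]
   being the coefficients of [L' o f]; minimality forces the columns of the
   higher coefficients [h_uj] belonging to the summand [Lt] to vanish, and
   symmetrically for the rows. *)
Require Import Defs.
From mathcomp Require Import all_boot all_order all_algebra spectral.
From mathcomp Require Import all_classical all_reals all_analysis.
From mathcomp Require Import complex.
From mathcomp Require Import -(notations) mxtens.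
From mathcomp Require Import ring lra.

Set Implicit Arguments.
Unset Strict Implicit.
Unset Printing Implicit Defensive.

Import Order.TTheory GRing.Theory Num.Theory.
Import numFieldNormedType.Exports.

Local Open Scope classical_set_scope.
Local Open Scope ring_scope.
Local Open Scope sesquilinear_scope.

(** * Frobenius inner product *)

(** Minimality bounds only a product of two sizes, so a contradiction must come from a pencil with
    the same ball, one size smaller and the other no larger. Compressing to the orthogonal of a
    vector gives such sizes, but a compression may enlarge the ball. A factorization
    [K_j = sum_i E_i^* K_j F_i] repairs this: it can be iterated, and the error of the compression
    is averaged out as soon as it is bounded by the defect of an intertwining relation. No
    C*-envelope or boundary representation is used.

    Contractivity of [T] is handled as [2 Re <u, T y> <= |u|^2 + |y|^2] for all [u] and [y], a form
    that adds up along Kraus sums. Most of the matrix part works over an abstract closed field,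
    where the Archimedean property replaces limits. The factor [delta] comes from scalar steps of a
    path, which must be small to stay in the ball. *)

Section FrobeniusProduct.
Context (C : numClosedFieldType).

Lemma dagM a b c (A : 'M[C]_(a, b)) (B : 'M[C]_(b, c)) :
  (A *m B)^t* = B^t* *m A^t*.
Proof. by rewrite trmx_mul map_mxM. Qed.

Lemma dagD a b (A B : 'M[C]_(a, b)) : (A + B)^t* = A^t* + B^t*.
Proof. by rewrite linearD map_mxD. Qed.

Lemma dagB a b (A B : 'M[C]_(a, b)) : (A - B)^t* = A^t* - B^t*.
Proof. by rewrite linearB map_mxB. Qed.

Lemma dagZ a b (k : C) (A : 'M[C]_(a, b)) : (k *: A)^t* = k^* *: A^t*.
Proof. by rewrite linearZ map_mxZ. Qed.

Lemma dag0 a b : (0 : 'M[C]_(a, b))^t* = 0.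
Proof. by rewrite trmx0 map_mx0. Qed.

Lemma dag1 a : (1%:M : 'M[C]_a)^t* = 1%:M.
Proof. by rewrite trmx1 map_mx1. Qed.

Lemma dag_sum (I : Type) (r : seq I) (P : pred I) a b (F : I -> 'M[C]_(a, b)) :
  (\sum_(i <- r | P i) F i)^t* = \sum_(i <- r | P i) (F i)^t*.
Proof.
by elim/big_rec2: _ => [|i A B _ <-]; rewrite ?dag0 // dagD.
Qed.

Definition hip a b (u z : 'M[C]_(a, b)) : C := \tr (u^t* *m z).

Definition nsq a b (u : 'M[C]_(a, b)) : C := hip u u.

Lemma hipDr a b (u z w : 'M[C]_(a, b)) : hip u (z + w) = hip u z + hip u w.
Proof. by rewrite /hip mulmxDr mxtraceD. Qed.

Lemma hipDl a b (u z w : 'M[C]_(a, b)) : hip (z + w) u = hip z u + hip w u.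
Proof. by rewrite /hip dagD mulmxDl mxtraceD. Qed.

Lemma hipZr a b k (u z : 'M[C]_(a, b)) : hip u (k *: z) = k * hip u z.
Proof. by rewrite /hip -scalemxAr mxtraceZ. Qed.

Lemma hipZl a b k (u z : 'M[C]_(a, b)) : hip (k *: u) z = k^* * hip u z.
Proof. by rewrite /hip dagZ -scalemxAl mxtraceZ. Qed.

Lemma hipNr a b (u z : 'M[C]_(a, b)) : hip u (- z) = - hip u z.
Proof. by rewrite -scaleN1r hipZr mulN1r. Qed.

Lemma hipNl a b (u z : 'M[C]_(a, b)) : hip (- u) z = - hip u z.
Proof. by rewrite -scaleN1r hipZl rmorphN rmorph1 mulN1r. Qed.

Lemma hipBr a b (u z w : 'M[C]_(a, b)) : hip u (z - w) = hip u z - hip u w.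
Proof. by rewrite hipDr hipNr. Qed.

Lemma hipBl a b (u z w : 'M[C]_(a, b)) : hip (z - w) u = hip z u - hip w u.
Proof. by rewrite hipDl hipNl. Qed.

Lemma hip0r a b (u : 'M[C]_(a, b)) : hip u 0 = 0.
Proof. by rewrite /hip mulmx0 mxtrace0. Qed.

Lemma hip0l a b (u : 'M[C]_(a, b)) : hip 0 u = 0.
Proof. by rewrite /hip dag0 mul0mx mxtrace0. Qed.

Lemma hip_sumr (I : Type) (r : seq I) (P : pred I) a b (u : 'M[C]_(a, b))
    (F : I -> 'M[C]_(a, b)) :
  hip u (\sum_(i <- r | P i) F i) = \sum_(i <- r | P i) hip u (F i).
Proof.
by elim/big_rec2: _ => [|i x A _ <-]; rewrite ?hip0r // hipDr.
Qed.

Lemma hip_suml (I : Type) (r : seq I) (P : pred I) a b (u : 'M[C]_(a, b))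
    (F : I -> 'M[C]_(a, b)) :
  hip (\sum_(i <- r | P i) F i) u = \sum_(i <- r | P i) hip (F i) u.
Proof.
by elim/big_rec2: _ => [|i x A _ <-]; rewrite ?hip0l // hipDl.
Qed.

Lemma hip_conj a b (u z : 'M[C]_(a, b)) : (hip u z)^* = hip z u.
Proof.
rewrite /hip -trace_map_mx map_mxM -map_mx_comp (map_mx_id (@conjCK _)).
by rewrite -[LHS]mxtrace_tr trmx_mul trmxK map_trmx.
Qed.

Lemma hip_mull a b c (A : 'M[C]_(c, a)) (u : 'M[C]_(a, b)) (z : 'M[C]_(c, b)) :
  hip (A *m u) z = hip u (A^t* *m z).
Proof. by rewrite /hip dagM mulmxA. Qed.

Lemma hip_mulr a b c (B : 'M[C]_(b, c)) (u : 'M[C]_(a, b)) (z : 'M[C]_(a, c)) :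
  hip (u *m B) z = hip u (z *m B^t*).
Proof. by rewrite /hip dagM -mulmxA mxtrace_mulC mulmxA. Qed.

Lemma hip_mull' a b c (A : 'M[C]_(a, c)) (u : 'M[C]_(a, b)) (z : 'M[C]_(c, b)) :
  hip u (A *m z) = hip (A^t* *m u) z.
Proof. by rewrite hip_mull trmxCK. Qed.

Lemma hip_mulr' a b c (B : 'M[C]_(c, b)) (u : 'M[C]_(a, b)) (z : 'M[C]_(a, c)) :
  hip u (z *m B) = hip (u *m B^t*) z.
Proof. by rewrite hip_mulr trmxCK. Qed.

Lemma nsqE a b (u : 'M[C]_(a, b)) : nsq u = \sum_i \sum_j `|u i j| ^+ 2.
Proof.
rewrite /nsq /hip /mxtrace exchange_big; apply: eq_bigr => j _.
by rewrite mxE; apply: eq_bigr => i _; rewrite !mxE normCK mulrC.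
Qed.

Lemma nsq_ge0 a b (u : 'M[C]_(a, b)) : 0 <= nsq u.
Proof.
by rewrite nsqE; apply: sumr_ge0 => i _; apply: sumr_ge0 => j _; rewrite
  exprn_ge0.
Qed.

Lemma nsq_eq0 a b (u : 'M[C]_(a, b)) : (nsq u == 0) = (u == 0).
Proof.
apply/eqP/eqP => [|->]; last by rewrite /nsq hip0r.
rewrite nsqE => /eqP; rewrite psumr_eq0 => [/allP u0|i _]; last first.
  by apply: sumr_ge0 => j _; rewrite exprn_ge0.
apply/matrixP => i j; rewrite mxE.
have /implyP/(_ isT) := u0 i (mem_index_enum i).
rewrite psumr_eq0 => [/allP ui0|k _]; last by rewrite exprn_ge0.
have /implyP/(_ isT) := ui0 j (mem_index_enum j).
by rewrite expf_eq0 /= normr_eq0 => /eqP.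
Qed.

Lemma nsq0 a b : nsq (0 : 'M[C]_(a, b)) = 0.
Proof. exact: hip0r. Qed.

Lemma nsqD a b (u z : 'M[C]_(a, b)) :
  nsq (u + z) = nsq u + (hip u z + hip z u) + nsq z.
Proof. by rewrite /nsq hipDl !hipDr !addrA. Qed.

Lemma nsqZ a b k (u : 'M[C]_(a, b)) : nsq (k *: u) = `|k| ^+ 2 * nsq u.
Proof. by rewrite /nsq hipZl hipZr mulrA normCK [k * _]mulrC. Qed.

Lemma nsqN a b (u : 'M[C]_(a, b)) : nsq (- u) = nsq u.
Proof. by rewrite /nsq hipNl hipNr opprK. Qed.

(** Expand [nsq (u - z) >= 0]. This replaces Cauchy-Schwarz: [T] is a contraction iff
    [2 Re <u, T y> <= |u|^2 + |y|^2] for all [u], [y], as the choice [u = T y] shows. *)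
Lemma hip_le a b (u z : 'M[C]_(a, b)) : hip u z + hip z u <= nsq u + nsq z.
Proof.
rewrite -subr_ge0; have := nsq_ge0 (u - z); rewrite /nsq hipBl !hipBr.
by congr (_ <= _); ring.
Qed.

Lemma hip_ge a b (u z : 'M[C]_(a, b)) : - (nsq u + nsq z) <= hip u z + hip z u.
Proof. by have := hip_le u (- z); rewrite hipNr hipNl nsqN -opprD lerNl. Qed.

Lemma nsq_unitl a b c (U : 'M[C]_(c, a)) (u : 'M[C]_(a, b)) :
  U^t* *m U = 1%:M -> nsq (U *m u) = nsq u.
Proof. by move=> UU; rewrite /nsq hip_mull mulmxA UU mul1mx. Qed.

Lemma nsq_unitr a b c (U : 'M[C]_(b, c)) (u : 'M[C]_(a, b)) :
  U *m U^t* = 1%:M -> nsq (u *m U) = nsq u.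
Proof. by move=> UU; rewrite /nsq hip_mulr -mulmxA UU mulmx1. Qed.

Lemma nsq_dag a b (u : 'M[C]_(a, b)) : nsq (u^t* ) = nsq u.
Proof. by rewrite /nsq /hip trmxCK [RHS]mxtrace_mulC. Qed.

Lemma nsq_row_mx a b c (u : 'M[C]_(a, b)) (z : 'M[C]_(a, c)) :
  nsq (row_mx u z) = nsq u + nsq z.
Proof.
rewrite !nsqE -big_split; apply: eq_bigr => i _ /=; rewrite big_split_ord /=.
by congr (_ + _); apply: eq_bigr => j _; rewrite ?row_mxEl ?row_mxEr.
Qed.

Lemma nsq_col_mx a b c (u : 'M[C]_(b, a)) (z : 'M[C]_(c, a)) :
  nsq (col_mx u z) = nsq u + nsq z.
Proof. by rewrite -!(nsq_dag u, nsq_dag z, nsq_dag (col_mx _ _)) tr_col_mx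
  map_row_mx nsq_row_mx. Qed.

(** Twice the left side is a sum over pairs of [2 Re <F i, F j>], each at most
    [|F i|^2 + |F j|^2]. *)
Lemma nsq_sum (I : finType) a b (F : I -> 'M[C]_(a, b)) :
  nsq (\sum_i F i) <= #|I|%:R * \sum_i nsq (F i).
Proof.
have S1 : nsq (\sum_i F i) = \sum_i \sum_j hip (F i) (F j).
  by rewrite /nsq hip_suml; apply: eq_bigr => i _; rewrite hip_sumr.
have S2 : nsq (\sum_i F i) = \sum_i \sum_j hip (F j) (F i).
  by rewrite S1 exchange_big.
have S3 : #|I|%:R * \sum_i nsq (F i) = \sum_i \sum_(j : I) nsq (F i).
  by rewrite mulr_sumr; apply: eq_bigr => i _; rewrite sumr_const mulr_natl.
have S4 : #|I|%:R * \sum_i nsq (F i) = \sum_(i : I) \sum_j nsq (F j).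
  by rewrite S3 exchange_big.
rewrite -(ler_pMn2r (isT : (0 < 2)%N)) !mulr2n {1}S1 S2 {1}S3 S4.
rewrite -!big_split; apply: ler_sum => i _; rewrite -!big_split.
by apply: ler_sum => j _; apply: hip_le.
Qed.

(** Split [A *m u] into rank-one terms, a column of [A] times a row of [u]. The constant is crude,
    but it does not depend on the number of columns of [u]. *)
Lemma nsq_mul a b c (A : 'M[C]_(a, b)) (u : 'M[C]_(b, c)) :
  nsq (A *m u) <= (b%:R * nsq A) * nsq u.
Proof.
rewrite -mulrA.
have -> : A *m u = \sum_k col k A *m row k u.
  by apply/matrixP => i j; rewrite mxE summxE; apply: eq_bigr => k _; rewrite
    mxE big_ord1 !mxE.
apply: le_trans (nsq_sum _) _; rewrite card_ord ler_wpM2l ?ler0n //.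
have colE k : nsq (col k A *m row k u) = nsq (col k A) * nsq (row k u).
  rewrite /nsq hip_mull mulmxA /hip -[_ *m row k u]/((_ *m _) *m _).
  rewrite [(col k A)^t* *m _]mx11_scalar mul_scalar_mx -scalemxAr mxtraceZ.
  by rewrite mxtrace_scalar mulr1n.
under eq_bigr do rewrite colE.
have colA k : nsq (col k A) <= nsq A.
  rewrite !nsqE; apply: ler_sum => i _; rewrite big_ord1 mxE (bigD1 k) //=
    lerDl.
  by apply: sumr_ge0 => j _; rewrite exprn_ge0.
apply: le_trans (_ : \sum_k nsq A * nsq (row k u) <= _).
  by apply: ler_sum => k _; rewrite ler_wpM2r ?nsq_ge0.
rewrite -mulr_sumr ler_wpM2l ?nsq_ge0 // [nsq u]nsqE.
by apply: ler_sum => k _; rewrite nsqE big_ord1; apply: ler_sum => j _; rewrite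
  mxE.
Qed.

End FrobeniusProduct.

(** * Pencils and inclusion of balls *)

Section Projections.
Context (C : numClosedFieldType).

(** The rows of [Q1] are an orthonormal basis of the row space of [Q]. Compression by [Q] thus
    becomes a pencil of smaller size, to which minimality can be applied. *)
Lemma projection_factor n (Q : 'M[C]_n) :
  Q *m Q = Q -> Q^t* = Q ->
  exists Q1 : 'M[C]_(\rank Q, n), Q1 *m Q1^t* = 1%:M /\ Q1^t* *m Q1 = Q.
Proof.
move=> QQ Qh; pose S := schmidt (row_base Q).
have SS : S *m S^t* = 1%:M.
  by apply/unitarymxP/schmidt_unitarymx/rank_leq_col.
have eqS : (S :=: Q)%MS.
  by apply: eqmx_trans (eq_row_base Q); apply: eqmx_schmidt_free; apply:
    row_base_free.
exists S; split=> //.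
have /submxP[Z QZ] : (Q <= S)%MS by rewrite eqS.
have /submxP[W SW] : (S <= Q)%MS by rewrite eqS.
have E1 : Q *m (S^t* *m S) = Q by rewrite {1}QZ -mulmxA (mulmxA S) SS mul1mx
  -QZ.
have E2 : S *m Q = S by rewrite SW -mulmxA QQ.
have := congr1 (fun A => A^t*) E1; rewrite !dagM trmxCK Qh => E3.
by rewrite -[RHS]E3 -mulmxA E2.
Qed.

Lemma projection_rank_lt n (Q : 'M[C]_n) k (A : 'M[C]_(n, k)) :
  Q *m A = 0 -> A != 0 -> (\rank Q < n)%N.
Proof.
move=> QA A0; rewrite ltn_neqAle rank_leq_row andbT; apply/negP => /eqP rQ.
have Qu : Q \in unitmx by rewrite -row_free_unit /row_free rQ.
by move: A0; rewrite -[A](mulKmx Qu) QA mulmx0 eqxx.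
Qed.

End Projections.

(** The substitute for limits over an abstract closed field, through [arch_le]. *)
Definition archimedean_field (C : numClosedFieldType) : Prop :=
  forall x : C, 0 <= x -> exists n : nat, x < n%:R.

Lemma Cplx_archimedean (R : realType) : archimedean_field (Cplx R).
Proof.
case=> a b; rewrite lecE /= => /andP[/eqP -> a0].
exists (Num.bound a).
have -> : ((Num.bound a)%:R : Cplx R) = ((Num.bound a)%:R)%:C%C.
  by rewrite rmorph_nat.
by rewrite ltcE /= eqxx; apply: archi_boundP.
Qed.

(** The case [n = 0] shows that [c] is nonnegative and [n = 1] that [a - b] is real; [b < a] would
    then contradict an integer bound on [c / (a - b)]. *)
Lemma arch_le (C : numClosedFieldType) (a b c : C) : archimedean_field C ->
  (forall n : nat, a *+ n <= b *+ n + c) -> a <= b.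
Proof.
move=> archC H; have c0 : 0 <= c by have := H 0%N; rewrite !mulr0n add0r.
have dR : a - b \is Num.real.
  by have := H 1%N; rewrite !mulr1n -lerBlDl => /ler_real ->; apply: ger0_real.
rewrite -subr_le0 real_leNgt ?real0 //; apply/negP => d0.
have [n] := archC _ (divr_ge0 c0 (ltW d0)).
rewrite ltr_pdivrMr // mulr_natl mulrnBl ltrBrDl => /(le_lt_trans (H n)).
by rewrite ltxx.
Qed.

Section Pencils.
Context (C : numClosedFieldType).

(* The action of [\sum_j K j *t X j] on [b * n] columns, a vector of
   [C^b (x) C^n] being seen as a matrix [y] and [X j] being transposed. *)
Definition pv g a b n m (K : 'I_g -> 'M[C]_(a, b)) (X : 'I_g -> 'M[C]_(n, m))
  (y : 'M[C]_(b, n)) : 'M[C]_(a, m) := \sum_j K j *m y *m X j.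

Definition contr g a b n m (K : 'I_g -> 'M[C]_(a, b))
    (X : 'I_g -> 'M[C]_(n, m)) : Prop :=
  forall y, nsq (pv K X y) <= nsq y.

(** Inclusion of the closed unit ball of [L] in that of [K]; by homogeneity it amounts to the
    inclusion of the open balls ([ball_dom], [dom_ball]). *)
Definition dom g a b a' b' (K : 'I_g -> 'M[C]_(a, b))
    (L : 'I_g -> 'M[C]_(a', b')) : Prop :=
  forall n (X : 'I_g -> 'M[C]_n), contr L X -> contr K X.

Definition dagp g a b (K : 'I_g -> 'M[C]_(a, b)) : 'I_g -> 'M[C]_(b, a) :=
  fun j => (K j)^t*.

Section Basics.
Context (g : nat).

Lemma pvD a b n m (K : 'I_g -> 'M[C]_(a, b)) (X : 'I_g -> 'M[C]_(n, m)) y z :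
  pv K X (y + z) = pv K X y + pv K X z.
Proof.
by rewrite /pv -big_split; apply: eq_bigr => j _ /=; rewrite mulmxDr mulmxDl.
Qed.

Lemma pvZX a b n m (K : 'I_g -> 'M[C]_(a, b)) (X : 'I_g -> 'M[C]_(n, m)) k y :
  pv K (fun j => k *: X j) y = k *: pv K X y.
Proof. by rewrite /pv scaler_sumr; apply: eq_bigr => j _; rewrite -scalemxAr.
  Qed.

Lemma pv_mull a a' b n m (A : 'M[C]_(a', a)) (K : 'I_g -> 'M[C]_(a, b))
    (X : 'I_g -> 'M[C]_(n, m)) y :
  A *m pv K X y = pv (fun j => A *m K j) X y.
Proof. by rewrite /pv mulmx_sumr; apply: eq_bigr => j _; rewrite !mulmxA. Qed.

Lemma pv_mulr a b b' n m (B : 'M[C]_(b, b')) (K : 'I_g -> 'M[C]_(a, b))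
    (X : 'I_g -> 'M[C]_(n, m)) y :
  pv K X (B *m y) = pv (fun j => K j *m B) X y.
Proof. by apply: eq_bigr => j _; rewrite !mulmxA. Qed.

Lemma pv_adj a b n m (K : 'I_g -> 'M[C]_(a, b)) (X : 'I_g -> 'M[C]_(n, m)) u y :
  hip u (pv K X y) = hip (pv (dagp K) (dagp X) u) y.
Proof.
rewrite /pv hip_sumr hip_suml; apply: eq_bigr => j _.
by rewrite hip_mulr' hip_mull' mulmxA.
Qed.

Lemma dagpK a b (K : 'I_g -> 'M[C]_(a, b)) : dagp (dagp K) = K.
Proof. by apply: funext => j; rewrite /dagp trmxCK. Qed.

Lemma dagp_row_mx a b c (K : 'I_g -> 'M[C]_(a, b)) (T : 'I_g -> 'M[C]_(a, c)) :
  dagp (fun j => row_mx (K j) (T j)) = fun j => col_mx (dagp K j) (dagp T j).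
Proof. by apply: funext => j; rewrite /dagp tr_row_mx map_col_mx. Qed.

(** If [w] is the image of [u] under the adjoint of the contraction [T], then
    [2 |w|^2 = 2 Re <u, T w> <= |u|^2 + |w|^2]. *)
Lemma contr_adj a b n m (K : 'I_g -> 'M[C]_(a, b)) (X : 'I_g -> 'M[C]_(n, m)) :
  contr K X -> contr (dagp K) (dagp X).
Proof.
move=> KX u; set w := pv _ _ u.
have E : hip u (pv K X w) = nsq w by rewrite pv_adj.
have E' : hip (pv K X w) u = nsq w.
  by rewrite -hip_conj E; apply/CrealP; rewrite ger0_real ?nsq_ge0.
have := hip_le u (pv K X w); rewrite E E' => /le_trans.
move=> /(_ (nsq u + nsq w)); rewrite lerD2l lerD2r; apply; exact: KX.
Qed.

Lemma dom_adj a b a' b' (K : 'I_g -> 'M[C]_(a, b)) (L : 'I_g -> 'M[C]_(a', b'))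
  :
  dom K L -> dom (dagp K) (dagp L).
Proof.
move=> KL n X /contr_adj; rewrite dagpK => /KL /contr_adj.
by rewrite dagpK.
Qed.

Lemma dom_trans a b a' b' a'' b'' (K : 'I_g -> 'M[C]_(a, b))
    (L : 'I_g -> 'M[C]_(a', b')) (M : 'I_g -> 'M[C]_(a'', b'')) :
  dom K L -> dom L M -> dom K M.
Proof. by move=> KL LM n X /LM /KL. Qed.

Definition corner n m (X : 'I_g -> 'M[C]_(n, m)) : 'I_g -> 'M[C]_(n + m) :=
  fun j => block_mx 0 (X j) 0 0.

Lemma pv_corner a b n m (K : 'I_g -> 'M[C]_(a, b)) (X : 'I_g -> 'M[C]_(n, m)) y
  z :
  pv K (corner X) (row_mx y z) = row_mx 0 (pv K X y).
Proof.
rewrite /pv [RHS](_ : _ = \sum_j row_mx 0 (K j *m y *m X j)); last first.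
  elim/big_rec2: _ => [|j A B _ <-]; first by rewrite row_mx0.
  by rewrite add_row_mx add0r.
apply: eq_bigr => j _; rewrite mul_mx_row /corner mul_row_block.
by rewrite !mulmx0 !addr0.
Qed.

(* A rectangular tuple is a corner of a square one. *)
Lemma dom_rect a b a' b' n m (K : 'I_g -> 'M[C]_(a, b))
    (L : 'I_g -> 'M[C]_(a', b')) (X : 'I_g -> 'M[C]_(n, m)) :
  dom K L -> contr L X -> contr K X.
Proof.
move=> KL LX.
have LY : contr L (corner X).
  move=> y; rewrite -[y]hsubmxK pv_corner !nsq_row_mx nsq0 add0r.
  by apply: le_trans (LX _) _; rewrite lerDl nsq_ge0.
move=> y; have := KL _ _ LY (row_mx y 0).
by rewrite pv_corner !nsq_row_mx !nsq0 add0r addr0.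
Qed.

Lemma nsq_kraus N a b n (E : 'I_N -> 'M[C]_(a, b)) (u : 'M[C]_(b, n)) :
  \sum_i (E i)^t* *m E i = 1%:M -> \sum_i nsq (E i *m u) = nsq u.
Proof.
move=> E1; have -> : nsq u = hip u ((\sum_i (E i)^t* *m E i) *m u).
  by rewrite E1 mul1mx.
rewrite mulmx_suml hip_sumr.
by apply: eq_bigr => i _; rewrite /nsq hip_mull mulmxA.
Qed.

Lemma pv_kraus N a b a' b' n m (K : 'I_g -> 'M[C]_(a, b))
    (L : 'I_g -> 'M[C]_(a', b')) (E : 'I_N -> 'M[C]_(a', a))
    (F : 'I_N -> 'M[C]_(b', b)) (X : 'I_g -> 'M[C]_(n, m)) u y :
  (forall j, K j = \sum_i (E i)^t* *m L j *m F i) ->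
  hip u (pv K X y) = \sum_i hip (E i *m u) (pv L X (F i *m y)).
Proof.
move=> KE; rewrite [LHS](_ : _ = hip u (\sum_i (E i)^t* *m pv L X (F i *m y))).
  by rewrite hip_sumr; apply: eq_bigr => i _; rewrite hip_mull.
congr hip; rewrite /pv; under [RHS]eq_bigr do rewrite mulmx_sumr.
rewrite exchange_big; apply: eq_bigr => j _.
by rewrite KE !mulmx_suml; apply: eq_bigr => i _; rewrite !mulmxA.
Qed.

(** The bound on [2 Re <u, K(X) y>] is the sum over [i] of the bounds for [L] at [E_i u], [F_i y],
    whose squared norms add up to those of [u] and [y]. *)
Lemma dom_kraus N a b a' b' (K : 'I_g -> 'M[C]_(a, b))
    (L : 'I_g -> 'M[C]_(a', b')) (E : 'I_N -> 'M[C]_(a', a))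
    (F : 'I_N -> 'M[C]_(b', b)) :
  (forall j, K j = \sum_i (E i)^t* *m L j *m F i) ->
  \sum_i (E i)^t* *m E i = 1%:M -> \sum_i (F i)^t* *m F i = 1%:M ->
  dom K L.
Proof.
move=> KE E1 F1 n X LX y; set u := pv K X y.
have B : nsq u + nsq u <= nsq u + nsq y.
  have E2 : nsq u = \sum_i hip (E i *m u) (pv L X (F i *m y)).
    by rewrite -(pv_kraus X u y KE).
  have E3 : nsq u = \sum_i hip (pv L X (F i *m y)) (E i *m u).
    rewrite -[LHS](CrealP (ger0_real (nsq_ge0 u))) E2 rmorph_sum.
    by apply: eq_bigr => i _; apply: hip_conj.
  rewrite {1}E2 {1}E3 -(nsq_kraus u E1) -(nsq_kraus y F1) -!big_split.
  apply: ler_sum => i _; apply: le_trans (hip_le _ _) _.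
  by rewrite lerD2l; apply: LX.
by rewrite lerD2l in B.
Qed.

Lemma dom_mull a b a' (A : 'M[C]_(a', a)) (K : 'I_g -> 'M[C]_(a, b)) :
  A *m A^t* = 1%:M -> dom (fun j => A *m K j) K.
Proof.
move=> A1 n X KX y; apply: le_trans (KX y); rewrite -pv_mull.
set z := pv K X y; have := hip_le (A^t* *m (A *m z)) z.
have E1 : hip (A^t* *m (A *m z)) z = nsq (A *m z) by rewrite hip_mull trmxCK.
have E2 : hip z (A^t* *m (A *m z)) = nsq (A *m z) by rewrite hip_mull' trmxCK.
have E3 : nsq (A^t* *m (A *m z)) = nsq (A *m z) by rewrite nsq_unitl ?trmxCK.
by rewrite E1 E2 E3 lerD2l.
Qed.

Lemma dom_mulr a b b' (B : 'M[C]_(b, b')) (K : 'I_g -> 'M[C]_(a, b)) :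
  B^t* *m B = 1%:M -> dom (fun j => K j *m B) K.
Proof.
by move=> B1 n X KX y; rewrite -pv_mulr; apply: le_trans (KX _) _; rewrite
  nsq_unitl.
Qed.

Lemma pv_bound a b n m (K : 'I_g -> 'M[C]_(a, b)) (X : 'I_g -> 'M[C]_(n, m)) :
  exists2 c : C, 0 <= c & forall y, nsq (pv K X y) <= c * nsq y.
Proof.
pose c j : C := (n%:R * nsq ((X j)^t*)) * (b%:R * nsq (K j)).
have cj y j : nsq (K j *m y *m X j) <= c j * nsq y.
  rewrite -nsq_dag dagM; apply: le_trans (nsq_mul _ _) _.
  rewrite [nsq ((K j *m y)^t*)]nsq_dag -[leRHS]mulrA ler_wpM2l ?nsq_mul //.
  by rewrite mulr_ge0 ?ler0n ?nsq_ge0.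
exists (g%:R * \sum_j c j); last first.
  move=> y; apply: le_trans (nsq_sum _) _.
  rewrite card_ord -mulrA ler_wpM2l ?ler0n // mulr_suml.
  by apply: ler_sum => j _; apply: cj.
rewrite mulr_ge0 ?ler0n // sumr_ge0 // => j _.
by rewrite !mulr_ge0 ?ler0n ?nsq_ge0.
Qed.

End Basics.

Definition nondeg g a b (K : 'I_g -> 'M[C]_(a, b)) : Prop :=
  forall n (X : 'I_g -> 'M[C]_n), (forall y, pv K X y = 0) -> forall j, X j = 0.

(** A pencil with the ball of a nondegenerate one is itself nondegenerate, by [nondeg_dom]; this
    therefore agrees with minimality among nondegenerate pencils. *)
Definition minp g a b (K : 'I_g -> 'M[C]_(a, b)) : Prop :=
  nondeg K /\ forall a' b' (L : 'I_g -> 'M[C]_(a', b')),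
    dom K L -> dom L K -> (a * b <= a' * b')%N.

End Pencils.

(** * Rigidity of minimal pencils *)

Section Rigidity.
Context (C : numClosedFieldType) (g : nat).

(** With a size 0 every tuple is annihilated, in particular the nonzero tuple of 1 by 1 identities.
    Positive sizes allow cancelling a factor in comparisons of [a * b]. *)
Lemma nondeg_gt0 a b (K : 'I_g -> 'M[C]_(a, b)) :
  (0 < g)%N -> nondeg K -> (0 < a)%N /\ (0 < b)%N.
Proof.
move=> g0 K0; apply/andP; apply: contraT; rewrite negb_and -!eqn0Ngt => ab.
have pv0 y : pv K (fun=> 1%:M : 'M[C]_1) y = 0.
  case/orP: ab => /eqP E.
    by apply/matrixP => i j; have := ltn_ord i; rewrite [X in (_ < X)%N]E ltn0.
  rewrite /pv big1 // => j _; have -> : y = 0.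
    by apply/matrixP => i k; have := ltn_ord i; rewrite [X in (_ < X)%N]E ltn0.
  by rewrite mulmx0 mul0mx.
have /matrixP/(_ 0 0)/eqP := K0 1%N _ pv0 (Ordinal g0).
by rewrite !mxE oner_eq0.
Qed.

(** If [K(X) = 0], all multiples of [X] lie in the ball of [K], hence in that of [L]; so
    [k^2 |L(X) y|^2 <= |y|^2] for every integer [k], and [L(X) = 0]. *)
Lemma nondeg_dom a b a' b' (K : 'I_g -> 'M[C]_(a, b))
    (L : 'I_g -> 'M[C]_(a', b')) :
  archimedean_field C -> dom L K -> nondeg L -> nondeg K.
Proof.
move=> archC LK L0 n X KX; apply: L0 => y; apply/eqP; rewrite -nsq_eq0.
rewrite eq_le nsq_ge0 andbT; apply: (@arch_le _ _ 0 (nsq y) archC) => k.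
rewrite mul0rn add0r.
have : contr L (fun j => (k%:R : C) *: X j).
  by apply: LK => z; rewrite pvZX KX scaler0 nsq0 nsq_ge0.
move=> /(_ y); rewrite pvZX nsqZ; apply: le_trans.
rewrite -[leLHS]mulr_natl ler_wpM2r ?nsq_ge0 // normr_nat -natrX ler_nat.
by case: k => // k; rewrite expnS expn1 leq_pmulr.
Qed.

Lemma minp_dom a b a' b' (K : 'I_g -> 'M[C]_(a, b))
    (L : 'I_g -> 'M[C]_(a', b')) :
  (0 < g)%N -> minp K -> dom K L -> dom L K -> (a' <= a)%N -> (b' <= b)%N ->
  a' = a /\ b' = b.
Proof.
move=> g0 [K0 Kmin] KL LK aa bb; have [a0 b0] := nondeg_gt0 g0 K0.
have le := Kmin _ _ L KL LK; split; apply/eqP; rewrite eqn_leq ?aa ?bb /=.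
  by rewrite -(leq_pmul2r b0) (leq_trans le) // leq_mul2l bb orbT.
by rewrite -(leq_pmul2l a0) (leq_trans le) // leq_mul2r aa orbT.
Qed.

Lemma minp_adj a b (K : 'I_g -> 'M[C]_(a, b)) : minp K -> minp (dagp K).
Proof.
move=> [K0 Kmin]; split; last first.
  move=> a' b' L KL LK; rewrite mulnC [leqRHS]mulnC; apply: (Kmin _ _ (dagp L)).
    by rewrite -[K]dagpK; apply: dom_adj.
  by rewrite -[K]dagpK; apply: dom_adj.
move=> n X KX j; rewrite -[X j]trmxCK -[(X j)^t*]/(dagp X j).
rewrite (K0 _ (dagp X)) ?dag0 // => y.
apply/eqP; rewrite -nsq_eq0 /nsq pv_adj [dagp (dagp X)]dagpK KX hip0l //.
Qed.

Section Intertwine.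
Context (a b N : nat) (K : 'I_g -> 'M[C]_(a, b)).
Context (E : 'I_N -> 'M[C]_a) (F : 'I_N -> 'M[C]_b).

(* Otherwise take a row [v] of a nonzero [Th i]: as [\sum_i Th_i^* Th_i] is the
   defect [S tau - tau], averaging [K = S^k K] over [k] shows that the
   compression of [K] to the orthogonal of [v] still defines the ball. *)
Lemma minp_intertwine : archimedean_field C -> (0 < g)%N -> minp K ->
  (forall j, K j = \sum_i (E i)^t* *m K j *m F i) ->
  \sum_i (E i)^t* *m E i = 1%:M -> \sum_i (F i)^t* *m F i = 1%:M ->
  forall i j, K j *m F i = E i *m K j.
Proof.
move=> archC g0 Kmin KE E1 F1 i0 j0; apply/eqP; rewrite -subr_eq0;
  apply/negPn/negP.
pose Th i := K j0 *m F i - E i *m K j0; rewrite -/(Th i0) => Th0.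
have [r v0] : exists r, row r (Th i0) != 0.
  apply/existsP; rewrite -negb_forall; apply: contra Th0 => /forallP H.
  by apply/eqP/row_matrixP => r; rewrite row0; apply/eqP.
set v := row r (Th i0) in v0.
pose nv := nsq v; have nv0 : nv != 0 by rewrite nsq_eq0.
have nvgt0 : 0 < nv by rewrite lt_def nv0 nsq_ge0.
have nvE : v *m v^t* = nv%:M.
  by rewrite [LHS]mx11_scalar /nv /nsq /hip mxtrace_mulC /mxtrace big_ord1.
pose Q := 1%:M - nv^-1 *: (v^t* *m v).
have PP : (v^t* *m v) *m (v^t* *m v) = nv *: (v^t* *m v).
  by rewrite mulmxA -(mulmxA (v^t* )) nvE mul_mx_scalar -scalemxAl.
have QQ : Q *m Q = Q.
  rewrite /Q mulmxBl mul1mx mulmxBr mulmx1 -scalemxAl -scalemxAr PP.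
  by rewrite [in nv^-1 *: (nv *: _)]scalerA mulVf // scale1r subrr subr0.
have nvR : (nv^-1)^* = nv^-1 by apply/CrealP; rewrite ger0_real // invr_ge0 ltW.
have Qh : Q^t* = Q by rewrite /Q dagB dag1 dagZ dagM trmxCK nvR.
have Qv : Q *m v^t* = 0.
  rewrite /Q mulmxBl mul1mx -scalemxAl -mulmxA nvE mul_mx_scalar scalerA.
  by rewrite mulVf // scale1r subrr.
have rQ : (\rank Q < b)%N.
  by apply: projection_rank_lt Qv _; rewrite -nsq_eq0 nsq_dag.
have [Q1 [Q11 Q1Q]] := projection_factor QQ Qh.
suff KL : dom K (fun j => K j *m Q1^t*).
  have LK : dom (fun j => K j *m Q1^t*) K by apply: dom_mulr; rewrite trmxCK.
  have [_ /eqP] := minp_dom g0 Kmin KL LK (leqnn _) (ltnW rQ).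
  by rewrite ltn_eqF.
move=> n X LX.
(* Twice the real part of the form, to be bounded by [nsq u + nsq y]. The factorization of [K] makes
   it invariant under averaging by [E] and [F]. *)
pose bf (u : 'M[C]_(a, n)) (y : 'M[C]_(b, n)) := hip u (pv K X y) + hip (pv K X
  y) u.
have bfS u y : bf u y = \sum_i bf (E i *m u) (F i *m y).
  rewrite /bf big_split /=; congr (_ + _); first exact: pv_kraus.
  rewrite -hip_conj (pv_kraus X u y KE) rmorph_sum.
  by apply: eq_bigr => i _; apply: hip_conj.
pose tau (y : 'M[C]_(b, n)) := nsq (K j0 *m y).
pose S f (y : 'M[C]_(b, n)) := \sum_i (f (F i *m y) : C).
(* Expanding the squares of [Th i], the cross terms sum to [tau y] by the factorization of [K j0],
   and the terms in [E i] sum to [tau y] as well: the defect [S tau - tau] is the sum of the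
   [nsq (Th i *m y)]. *)
have vTh y : nsq (v *m y) <= S tau y - tau y.
  have -> : S tau y - tau y = \sum_i nsq (Th i *m y).
    have -> : \sum_i nsq (Th i *m y) = \sum_i (tau (F i *m y)
       - (hip (E i *m (K j0 *m y)) (K j0 *m (F i *m y))
       + hip (K j0 *m (F i *m y)) (E i *m (K j0 *m y)))
       + nsq (E i *m (K j0 *m y))).
      apply: eq_bigr => i _; rewrite /Th mulmxBl -!mulmxA nsqD nsqN hipNr hipNl.
      by rewrite -opprD; congr (_ - _ + _); apply: addrC.
    rewrite big_split /= (nsq_kraus _ E1) sumrB big_split /=.
    have H : \sum_i hip (E i *m (K j0 *m y)) (K j0 *m (F i *m y)) = tau y.
      rewrite -[RHS]/(hip (K j0 *m y) (K j0 *m y)).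
      rewrite [X in _ = hip _ (X *m _)]KE mulmx_suml hip_sumr.
      by apply: eq_bigr => i _; rewrite hip_mull !mulmxA.
    have H' : \sum_i hip (K j0 *m (F i *m y)) (E i *m (K j0 *m y)) = tau y.
      rewrite -[RHS](CrealP (ger0_real (nsq_ge0 _))) -/(tau y) -H rmorph_sum.
      by apply: eq_bigr => i _; rewrite -hip_conj.
    by rewrite H H' /S -/(tau y); ring.
  apply: le_trans (_ : nsq (Th i0 *m y) <= _).
    rewrite /v -row_mul !nsqE big_ord1 (bigD1 r) //= ler_wpDr //.
      by rewrite sumr_ge0 // => i _; apply: sumr_ge0 => j _; rewrite exprn_ge0.
    by apply: ler_sum => i _; rewrite mxE.
  rewrite (bigD1 i0) //= ler_wpDr // sumr_ge0 // => i _; exact: nsq_ge0.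
have nvi0 : 0 <= nv^-1 by rewrite invr_ge0 ltW.
have [be be0 Hbe] := pv_bound K X.
pose ga := be * (nv^-1 ^+ 2 * nv).
have ga0 : 0 <= ga by rewrite !mulr_ge0 ?exprn_ge0 ?invr_ge0 // ltW.
have gaH y : nsq (pv K X (nv^-1 *: (v^t* *m v *m y))) <= ga * nsq (v *m y).
  apply: le_trans (Hbe _) _; rewrite /ga -mulrA ler_wpM2l //.
  rewrite nsqZ -[leRHS]mulrA ger0_norm // ler_wpM2l ?exprn_ge0 //.
  by rewrite -mulmxA /nsq hip_mull trmxCK mulmxA nvE mul_scalar_mx hipZr.
(* Split [y] along [Q] and [v]. The first part is controlled by the compressed pencil; the second
   costs [e ^+ 2 * nsq u] plus a multiple of the defect, by [hip_le] at [e *: u] and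
   [e^-1 *: z2]. *)
have B1 (e : C) u y : 0 < e -> bf u y <=
    (1 + e ^+ 2) * nsq u + nsq y + (e^-1) ^+ 2 * ga * (S tau y - tau y).
  move=> e0; have ei0 : 0 <= e^-1 by rewrite invr_ge0 ltW.
  pose z1 := pv K X (Q *m y).
  pose z2 := pv K X (nv^-1 *: (v^t* *m v *m y)).
  have zE : pv K X y = z1 + z2.
    rewrite -pvD; congr (pv K X _).
    by rewrite /Q mulmxBl mul1mx -scalemxAl subrK.
  have -> : bf u y = (hip u z1 + hip z1 u) +
      (hip (e *: u) (e^-1 *: z2) + hip (e^-1 *: z2) (e *: u)).
    rewrite /bf zE hipDr hipDl !hipZl !hipZr.
    have -> : e^* = e by apply/CrealP/ger0_real/ltW.
    have -> : (e^-1)^* = e^-1.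
      by apply/CrealP; rewrite ger0_real // invr_ge0 ltW.
    by field; rewrite gt_eqF.
  apply: le_trans (lerD (hip_le _ _) (hip_le _ _)) _.
  rewrite !nsqZ (ger0_norm ei0) (ger0_norm (ltW e0)).
  have z1le : nsq z1 <= nsq y.
    rewrite /z1 -Q1Q -mulmxA pv_mulr; apply: le_trans (LX _) _.
    rewrite /nsq hip_mull mulmxA Q1Q /Q mulmxBl mul1mx hipBr -scalemxAl hipZr.
    rewrite gerBl -mulmxA hip_mull' trmxCK -/(nsq (v *m y)).
    by rewrite mulr_ge0 ?nsq_ge0 // invr_ge0 ltW.
  have z2le := le_trans (gaH y) (ler_wpM2l ga0 (vTh y)).
  have -> : (1 + e ^+ 2) * nsq u + nsq y +
      (e^-1) ^+ 2 * ga * (S tau y - tau y) =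
    nsq u + nsq y + (e ^+ 2 * nsq u + (e^-1) ^+ 2 * (ga * (S tau y - tau y))).
    by ring.
  apply: lerD; first by rewrite lerD2l.
  by rewrite lerD2l ler_wpM2l // exprn_ge0 // invr_ge0 ltW.
have [bt bt0 Hbt] : exists2 c : C, 0 <= c & forall y, tau y <= c * nsq y.
  exists (b%:R * nsq (K j0)); first by rewrite mulr_ge0 ?ler0n ?nsq_ge0.
  by move=> y; apply: nsq_mul.
have Stau k y : iter k S tau y <= bt * nsq y.
  elim: k y => [|k IH] y; first exact: Hbt.
  rewrite iterS /S -(nsq_kraus y F1) mulr_sumr; apply: ler_sum => i _; exact:
    IH.
(* Summed over the iterates of the averaging the defects telescope: the total error involves only
   [iter k S tau], which stays below [bt * nsq y]. *)
have B2 (e : C) k u y : 0 < e -> bf u y *+ k <=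
    ((1 + e ^+ 2) * nsq u + nsq y) *+ k
    + (e^-1) ^+ 2 * ga * (iter k S tau y - tau y).
  move=> e0; elim: k u y => [|k IH] u y.
    by rewrite !mulr0n /= subrr mulr0 addr0.
  have IH' : bf u y *+ k <= ((1 + e ^+ 2) * nsq u + nsq y) *+ k
      + (e^-1) ^+ 2 * ga * (iter k.+1 S tau y - S tau y).
    rewrite bfS -sumrMnl -{1}(nsq_kraus u E1) -{1}(nsq_kraus y F1).
    rewrite mulr_sumr -big_split -sumrMnl /= /S -sumrB mulr_sumr -big_split /=.
    by apply: ler_sum => i _; apply: IH.
  rewrite !mulrSr; apply: le_trans (lerD IH' (B1 e u y e0)) _.
  by rewrite le_eqVlt; apply/orP; left; apply/eqP; ring.
(* Divide by [k] and let it grow; [B4] then lets [e = 1 / (k + 1)] tend to 0. *)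
have B3 (e : C) u y : 0 < e -> bf u y <= (1 + e ^+ 2) * nsq u + nsq y.
  move=> e0; apply: (@arch_le _ _ _ ((e^-1) ^+ 2 * ga * (bt * nsq y)) archC) =>
    k.
  apply: le_trans (B2 e k u y e0) _; rewrite lerD2l ler_wpM2l //.
    by rewrite mulr_ge0 // exprn_ge0 // invr_ge0 ltW.
  by rewrite (le_trans _ (Stau k y)) // gerBl nsq_ge0.
have B4 u y : bf u y <= nsq u + nsq y.
  apply: (@arch_le _ _ _ (nsq u) archC) => -[|k].
    by rewrite !mulr0n add0r nsq_ge0.
  have k0 : (0 : C) < (k.+1%:R)^-1 by rewrite invr_gt0 ltr0Sn.
  rewrite -(mulr_natl (bf u y)) -(mulr_natl (nsq u + nsq y)).
  apply: le_trans (ler_wpM2l (ler0n _ _) (B3 _ u y k0)) _.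
  have fE (c s t : C) : c != 0 ->
      c * ((1 + c^-1 ^+ 2) * s + t) = c * (s + t) + c^-1 * s.
    by move=> c0; field.
  rewrite fE ?pnatr_eq0 //.
  rewrite lerD2l ler_piMl ?nsq_ge0 // invf_le1 ?ltr0Sn // ler1n //.
move=> y; have := B4 (pv K X y) y.
by rewrite /bf -/(nsq _) lerD2l.
Qed.

End Intertwine.

End Rigidity.

(** * Kraus factorizations *)

Section PositiveSemidefinite.
Context (C : numClosedFieldType).

Lemma unitary_hermE n (P : 'M[C]_n) : P \is unitarymx -> P^t* *m P = 1%:M.
Proof. by move=> /unitarymxP/mulmx1C. Qed.

Lemma herm_spectral n (G : 'M[C]_n) : G^t* = G ->
  exists (P : 'M[C]_n) (D : 'rV[C]_n),
    [/\ P *m P^t* = 1%:M, P^t* *m P = 1%:M, G = P^t* *m diag_mx D *m P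
      & forall i, D 0 i = hip (row i P) (row i P *m G)].
Proof.
move=> Gh; have Gn : G \is normalmx by apply/normalmxP; rewrite Gh.
pose P := spectralmx G.
have GE : G = invmx P *m diag_mx (spectral_diag G) *m P.
  exact/orthomx_spectralP.
have Pu : P \is unitarymx by apply: spectral_unitarymx.
rewrite invmx_unitary // in GE.
have PP := unitary_hermE Pu; move/unitarymxP: Pu => PP'.
exists P, (spectral_diag G); split=> // i.
rewrite /hip mxtrace_mulC /mxtrace big_ord1.
have PGP : P *m G *m P^t* = diag_mx (spectral_diag G).
  by rewrite [X in P *m X]GE !mulmxA PP' mul1mx -mulmxA PP' mulmx1.
have -> : row i P *m G *m (row i P)^t* =
    row i (P *m G *m P^t*) *m (delta_mx 0 i)^t*.
  by rewrite !rowE dagM !mulmxA.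
rewrite PGP mxE (bigD1 i) //= big1 ?addr0 => [|k /negbTE ki].
  by rewrite !mxE eqxx mulr1n !eqxx /= conjC1 mulr1.
by rewrite !mxE ki andbF conjC0 mulr0.
Qed.

Lemma psd_factor n (G : 'M[C]_n) : G^t* = G ->
  (forall x : 'rV_n, 0 <= hip x (x *m G)) -> exists S : 'M[C]_n, G = S^t* *m S.
Proof.
move=> /herm_spectral[P [D [PP PP' GE DE]]] G0.
have D0 i : 0 <= D 0 i by rewrite DE.
exists (diag_mx (\row_i sqrtC (D 0 i)) *m P).
rewrite dagM -mulmxA (mulmxA _ _ P) [in LHS]GE -mulmxA; congr (_ *m (_ *m _)).
rewrite tr_diag_mx map_diag_mx mulmx_diag; congr diag_mx.
apply/rowP => i; rewrite !mxE.
rewrite [X in X * _](CrealP (ger0_real _)) ?sqrtC_ge0 //.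
by rewrite -expr2 sqrtCK.
Qed.

Lemma hip_rows a b (u z : 'M[C]_(a, b)) :
  hip u z = \sum_i hip (row i u) (row i z).
Proof.
rewrite /hip /mxtrace; under [RHS]eq_bigr do under eq_bigr do rewrite mxE
  big_ord1.
rewrite exchange_big; apply: eq_bigr => j _; rewrite mxE; apply: eq_bigr => i _.
by rewrite !mxE.
Qed.

Lemma hip_rowsl n m (S : 'M[C]_(n, m)) (v : 'M[C]_m) :
  hip S (S *m v) = \sum_i hip (row i S) (row i S *m v).
Proof. by rewrite hip_rows; apply: eq_bigr => i _; rewrite row_mul. Qed.

Lemma hip_rowsr n m (S : 'M[C]_(n, m)) (v : 'M[C]_m) :
  hip (S *m v) S = \sum_i hip (row i S *m v) (row i S).
Proof. by rewrite hip_rows; apply: eq_bigr => i _; rewrite row_mul. Qed.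

Lemma re_mul_conj (x y a b : C) :
  x \is Num.real -> y \is Num.real -> a \is Num.real -> b \is Num.real ->
  (x - 'i * y) * (a + b * 'i) + ((x - 'i * y) * (a + b * 'i))^* =
  (x * a + y * b) *+ 2.
Proof.
move=> /CrealP xr /CrealP yr /CrealP ar /CrealP br.
rewrite rmorphM rmorphB rmorphD !rmorphM /= conjCi xr yr ar br.
have -> : (x - 'i * y) * (a + b * 'i) + (x - - 'i * y) * (a + b * - 'i) =
  (x * a - 'i ^+ 2 * (y * b)) *+ 2 by ring.
by rewrite sqrCi mulN1r opprK.
Qed.

End PositiveSemidefinite.

(** * Extension and representation of positive functionals *)

Section PositiveExtension.
Context (R : realType) (N : nat).
Local Notation C := (Cplx R).
Implicit Types (v w : 'M[C]_N) (x : 'rV[C]_N) (t s : R).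

Definition qre v x : C := hip x (x *m v) + hip (x *m v) x.

(** The matrices with positive semidefinite hermitian part, a cone in the real vector space of all
    matrices; skew-hermitian ones lie in it with their opposites. *)
Definition cone v : Prop := forall x, 0 <= qre v x.

Lemma qreD v w x : qre (v + w) x = qre v x + qre w x.
Proof. by rewrite /qre mulmxDr hipDr hipDl addrACA. Qed.

Lemma conj_real t : (t%:C%C : C)^* = t%:C%C.
Proof. by apply/CrealP; rewrite complex_real. Qed.

Lemma qreZ t v x : qre (t%:C%C *: v) x = t%:C%C * qre v x.
Proof.
rewrite /qre -scalemxAr hipZr hipZl mulrDr; congr (_ + _ * _).
exact: conj_real.
Qed.

Lemma coneD v w : cone v -> cone w -> cone (v + w).
Proof. by move=> v0 w0 x; rewrite qreD addr_ge0. Qed.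

Lemma coneZ t v : 0 <= t -> cone v -> cone (t%:C%C *: v).
Proof. by move=> t0 v0 x; rewrite qreZ mulr_ge0 // lecR. Qed.

(** The identity is an order unit, because the form of [v] is bounded below by a multiple of
    [nsq x]. This makes both classes of the Riesz extension nonempty. *)
Lemma cone_unit v : exists t, cone (t%:C%C *: 1%:M + v).
Proof.
pose c : C := N%:R * nsq (v^t* ); have c0 : 0 <= c by rewrite mulr_ge0 ?nsq_ge0.
have [k ck] := Cplx_archimedean c0.
exists (1 + k%:R) => x; rewrite qreD qreZ /qre mulmx1 -/(nsq x).
have H : nsq (x *m v) <= c * nsq x.
  by rewrite -nsq_dag dagM; apply: le_trans (nsq_mul _ _) _; rewrite [nsq (x^t*
    )]nsq_dag.
have := hip_ge x (x *m v); rewrite -subr_ge0 opprK => H1.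
have H2 : nsq x + nsq (x *m v) <= (1 + k%:R) * nsq x.
  rewrite mulrDl mul1r lerD2l; apply: le_trans H _.
  by rewrite ler_wpM2r ?nsq_ge0 ?ltW.
have -> : ((1 + k%:R : R)%:C%C : C) = 1 + k%:R by rewrite rmorphD rmorph1
  rmorph_nat.
have H3 : 0 <= (1 + k%:R) * nsq x :> C by rewrite mulr_ge0 ?nsq_ge0 // addr_ge0.
rewrite mulrDr -addrA; apply: addr_ge0 => //.
by apply: le_trans H1 _; rewrite [leRHS]addrC lerD2l.
Qed.

(** The graph of a real-linear positive functional on a subspace containing the identity. It is
    single-valued by positivity: 0 lies in the cone, so the difference of two values at one point is
    nonnegative both ways. *)
Definition pos_graph (Ga : 'M[C]_N -> R -> Prop) : Prop :=
  [/\ Ga 0 0, forall v w t s, Ga v t -> Ga w s -> Ga (v + w) (t + s),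
      forall r v t, Ga v t -> Ga (r%:C%C *: v) (r * t),
      forall v t, Ga v t -> cone v -> 0 <= t
    & exists t, Ga 1%:M t].

(* M. Riesz: a positive functional extends to one more dimension, the value at
   the new vector being any number between two Dedekind classes. *)
Lemma pos_graph_ext1 Ga w0 : pos_graph Ga ->
  exists Ga', [/\ pos_graph Ga', forall v t, Ga v t -> Ga' v t
                & exists t, Ga' w0 t].
Proof.
case=> G0 GD GZ Gpos [t1 G1].
pose A := [set t | exists2 w, Ga w (- t) & cone (w + w0)]%classic.
pose B := [set t | exists2 w, Ga w t & cone (w - w0)]%classic.
have A0 : exists t, A t.
  have [c ct] := cone_unit w0; exists (- (c * t1)).
  by exists (c%:C%C *: 1%:M); rewrite ?opprK //; apply: GZ.
have B0 : exists t, B t.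
  by have [c ct] := cone_unit (- w0); exists (c * t1), (c%:C%C *: 1%:M) => //;
    apply: GZ.
have AB t s : A t -> B s -> t <= s.
  move=> [w Gw cw] [w' Gw' cw']; rewrite -subr_ge0 addrC.
  apply: (Gpos (w + w')); first exact: GD.
  have -> : w + w' = (w + w0) + (w' - w0) by rewrite addrACA subrr addr0.
  exact: coneD.
pose th := sup A.
have thA t : A t -> t <= th.
  move=> At; have [s Bs] := B0.
  have ub : has_ubound A by exists s => u Au; apply: AB Au Bs.
  exact: (ub_le_sup ub At).
have thB s : B s -> th <= s.
  move=> Bs; have ub : ubound A s by move=> u Au; apply: AB Au Bs.
  exact: (ge_sup A0 ub).
exists (fun v t => exists w s a, [/\ Ga w s, v = w + a%:C%C *: w0 & t = s + a *
  th]).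
split.
- split.
  + by exists 0, 0, 0; rewrite scale0r mul0r !addr0.
  + move=> _ _ _ _ [w [s [a [Gw -> ->]]]] [w' [s' [a' [Gw' -> ->]]]].
    exists (w + w'), (s + s'), (a + a'); split; first exact: GD.
      by rewrite rmorphD scalerDl addrACA.
    by rewrite mulrDl addrACA.
  + move=> r _ _ [w [s [a [Gw -> ->]]]].
    exists (r%:C%C *: w), (r * s), (r * a); split; first exact: GZ.
      by rewrite scalerDr scalerA rmorphM.
    by rewrite mulrDr mulrA.
  + move=> _ _ [w [s [a [Gw -> ->]]]] cv.
    (* After division by [|a|], [w + a w0] has the form [w' - w0] or [w' + w0] according to the sign
       of [a]; this gives an element of [B] or of [A]. *)
    have [a0|a0|a0] := ltgtP a 0.
    * have na : 0 < - a by rewrite oppr_gt0.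
      have Bs : B ((- a)^-1 * s).
        exists (((- a)^-1)%:C%C *: w); first exact: GZ.
        have -> : ((- a)^-1)%:C%C *: w - w0 = ((- a)^-1)%:C%C *: (w + a%:C%C *:
          w0).
          rewrite scalerDr scalerA -rmorphM invrN mulNr mulVf ?lt_eqF //.
          by rewrite rmorphN1 scaleN1r.
        by apply: coneZ => //; rewrite invr_ge0 ltW.
      have := thB _ Bs; rewrite mulrC ler_pdivlMr // mulrN -subr_ge0 opprK.
      by rewrite [a * th]mulrC.
    * have As : A (- (a^-1 * s)).
        exists (a^-1%:C%C *: w); first by rewrite opprK; apply: GZ.
        have -> : a^-1%:C%C *: w + w0 = a^-1%:C%C *: (w + a%:C%C *: w0).
          by rewrite scalerDr scalerA -rmorphM mulVf ?gt_eqF // rmorph1 scale1r.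
        by apply: coneZ => //; rewrite invr_ge0 ltW.
      have := thA _ As; rewrite mulrC -mulNr ler_pdivrMr //.
      by rewrite -[0 <= s + _]lerBlDl sub0r mulrC.
    * rewrite a0 mul0r addr0; apply: Gpos Gw _.
      by move: cv; rewrite a0 scale0r addr0.
  + by exists t1, 1%:M, t1, 0; rewrite scale0r mul0r !addr0.
- by move=> v t Gv; exists v, t, 0; rewrite scale0r mul0r !addr0.
- by exists th, 0, 0, 1; rewrite scale1r mul1r !add0r.
Qed.

Lemma pos_graph_ext (vs : seq 'M[C]_N) Ga : pos_graph Ga ->
  exists Ga', [/\ pos_graph Ga', forall v t, Ga v t -> Ga' v t
                & forall v, v \in vs -> exists t, Ga' v t].
Proof.
elim: vs Ga => [|w0 vs IH] Ga GG; first by exists Ga.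
have [Ga1 [GG1 sub1 [t1 G1]]] := pos_graph_ext1 w0 GG.
have [Ga2 [GG2 sub2 tot2]] := IH _ GG1.
exists Ga2; split=> // [v t /sub1/sub2//|v].
by rewrite inE => /predU1P[->|/tot2//]; exists t1; apply: sub2.
Qed.

(** The matrix units and their multiples by ['i] span all matrices over the reals, so finitely many
    one-dimensional extensions suffice. *)
Lemma pos_graph_total Ga : pos_graph Ga ->
  exists f : 'M[C]_N -> R,
    [/\ pos_graph (fun v t => t = f v) & forall v t, Ga v t -> t = f v].
Proof.
move=> GG.
pose d (ij : 'I_N * 'I_N) : 'M[C]_N := delta_mx ij.1 ij.2.
pose vs := [seq d ij | ij <- enum {: 'I_N * 'I_N}]
  ++ [seq ('i : C) *: d ij | ij <- enum {: 'I_N * 'I_N}].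
have [Ga' [[G0 GD GZ Gpos G1] sub tot]] := pos_graph_ext vs GG.
have tot' v : exists t, Ga' v t.
  have -> : v = \sum_ij ((complex.Re (v ij.1 ij.2))%:C%C *: d ij
                    + (complex.Im (v ij.1 ij.2))%:C%C *: (('i : C) *: d ij)).
    rewrite [LHS]matrix_sum_delta pair_bigA; apply: eq_bigr => ij _.
    rewrite scalerA -scalerDl; congr (_ *: _).
    by rewrite {1}[v _ _]complexE complexiE [_ * 'i]mulrC.
  apply: (big_ind (fun v => exists t, Ga' v t)) => [|w w' [t Gt] [t' Gt']|ij _].
  - by exists 0.
  - by exists (t + t'); apply: GD.
  have [t1 Gt1] : exists t, Ga' (d ij) t.
    by apply: tot; rewrite mem_cat; apply/orP; left; apply: map_f; rewrite
      mem_enum.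
  have [t2 Gt2] : exists t, Ga' (('i : C) *: d ij) t.
    apply: tot; rewrite mem_cat; apply/orP; right.
    by apply: (map_f (fun ij => 'i *: d ij)); rewrite mem_enum.
  by eexists; apply: GD; apply: GZ; eassumption.
have uni v t s : Ga' v t -> Ga' v s -> t = s.
  have le u u' : Ga' v u -> Ga' v u' -> u <= u'.
    move=> Gu Gu'; rewrite -subr_ge0 -mulN1r; apply: (Gpos (v + (-1)%:C%C *:
      v)).
      by apply: GD => //; apply: GZ.
    rewrite rmorphN rmorph1 scaleN1r subrr => x.
    by rewrite /qre mulmx0 hip0l hip0r addr0.
  by move=> Gt Gs; apply/eqP; rewrite eq_le !le.
pose f v := projT1 (cid (tot' v)).
have fP v : Ga' v (f v) by rewrite /f; case: cid.
exists f; split; last by move=> v t /sub Gv; apply: uni Gv (fP v).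
split.
- exact: uni G0 (fP _).
- by move=> v w _ _ -> ->; apply: uni (fP _); apply: GD.
- by move=> r v _ ->; apply: uni (fP _); apply: GZ.
- by move=> v _ ->; apply: Gpos.
- by exists (f 1%:M).
Qed.

(* The extended functional is [v |-> Re (\tr (G *m v))] with [G] positive
   semidefinite. *)
Lemma pos_graph_rep Ga : pos_graph Ga ->
  exists x : 'I_N -> 'rV[C]_N,
    forall v t, Ga v t -> t%:C%C *+ 2 = \sum_i qre v (x i).
Proof.
case/pos_graph_total => f [[/= f0 fD fZ fpos _] Gf].
have {}fD v w : f (v + w) = f v + f w by rewrite -(fD v w (f v) (f w)).
have {}fZ r v : f (r%:C%C *: v) = r * f v by rewrite -(fZ r v (f v)).
have {}fpos v : cone v -> 0 <= f v by apply: fpos.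
(* Values on the matrix units give the real parts of the entries of [G], values on their multiples
   by ['i] the imaginary parts up to sign. *)
pose G := \matrix_(i, j) ((f (delta_mx j i))%:C%C
          - 'i * (f (('i : C) *: delta_mx j i))%:C%C : C).
have fG v : (f v)%:C%C *+ 2 = \tr (G *m v) + (\tr (G *m v))^*.
  have -> : \tr (G *m v) = \sum_i \sum_j G j i * v i j.
    by rewrite exchange_big; apply: eq_bigr => i _; rewrite mxE.
  rewrite rmorph_sum -big_split {1}[v]matrix_sum_delta.
  have fs (I : finType) (F : I -> 'M[C]_N) : f (\sum_i F i) = \sum_i f (F i).
    by apply: (big_morph f fD); have := fZ 0 0; rewrite scaler0 mul0r.
  rewrite fs rmorph_sum -sumrMnl; apply: eq_bigr => i _.
  rewrite rmorph_sum -big_split fs rmorph_sum -sumrMnl; apply: eq_bigr => j _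
    /=.
  rewrite mxE; set x := f (delta_mx i j); set y := f (('i : C) *: delta_mx i j).
  have vE := complexE (v i j); rewrite complexiE mulrC in vE.
  set a := complex.Re _ in vE; set b := complex.Im _ in vE.

  have -> : v i j *: delta_mx i j =
      a%:C%C *: delta_mx i j + b%:C%C *: (('i : C) *: delta_mx i j).
    by rewrite scalerA -scalerDl vE.
  rewrite fD !fZ vE re_mul_conj ?complex_real //.
  by rewrite rmorphD !rmorphM; congr (_ *+ 2); congr (_ + _); rewrite mulrC.
(* A skew-hermitian matrix and its opposite both lie in [cone], so [f] vanishes there; [f] is then
   invariant under the adjoint and [G] is hermitian. *)
have fdag v : f (v^t* ) = f v.
  have c0 w : w^t* = - w -> f w = 0.
    move=> wN; have q0 x : qre w x = 0.
      by rewrite /qre hip_mulr wN mulmxN hipNr subrr.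
    apply/eqP; rewrite eq_le; apply/andP; split; last first.
      by apply: fpos => x; rewrite q0.
    have := fZ (-1) w; rewrite mulN1r => fN.
    rewrite -oppr_ge0 -fN; apply: fpos => x.
    by rewrite qreZ q0 mulr0.
  have := c0 (v - v^t* ); rewrite dagB trmxCK opprB => /(_ erefl).
  rewrite fD -scaleN1r; have := fZ (-1) (v^t* ); rewrite rmorphN1 => ->.
  by rewrite mulN1r => /eqP; rewrite subr_eq0 => /eqP.
have Gh : G^t* = G.
  apply/matrixP => i j; rewrite !mxE.
  have E1 : f (delta_mx i j) = f (delta_mx j i).
    by rewrite -fdag trmx_delta map_delta_mx.
  have E2 : f (('i : C) *: delta_mx i j) = - f (('i : C) *: delta_mx j i).
    rewrite -fdag dagZ conjCi trmx_delta map_delta_mx scaleNr -scaleN1r.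
    by have := fZ (-1) (('i : C) *: delta_mx j i); rewrite rmorphN1 mulN1r =>
      ->.
  rewrite E1 E2 rmorphN mulrN opprK rmorphD rmorphM /= conjCi mulNr.
  by congr (_ - _ * _); apply: conj_real.
(* Rank-one matrices [x^t* *m x] lie in [cone] and test the positivity of [G]. *)
have G0 x : 0 <= hip x (x *m G).
  have hr : (hip x (x *m G))^* = hip x (x *m G) by rewrite hip_conj hip_mulr Gh.
  have tE : \tr (G *m (x^t* *m x)) = hip x (x *m G).
    by rewrite mxtrace_mulC /hip mulmxA.
  have := fG (x^t* *m x); rewrite tE hr -mulr2n => /eqP; rewrite eqr_pMn2r //
    => /eqP <-.
  rewrite lecR; apply: fpos => z; rewrite /qre.
  have E1 : hip z (z *m (x^t* *m x)) = nsq (z *m x^t*) by rewrite mulmxA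
    hip_mulr'.
  have E2 : hip (z *m (x^t* *m x)) z = nsq (z *m x^t*) by rewrite mulmxA
    hip_mulr.
  by rewrite E1 E2 addr_ge0 ?nsq_ge0.
have [S GS] := psd_factor Gh G0.
exists (fun i => row i S) => v t /Gf ->.
rewrite fG GS /qre.
rewrite -mulmxA -/(hip S (S *m v)) hip_conj big_split /=.
by rewrite -(hip_rowsl S v) -(hip_rowsr S v).
Qed.

End PositiveExtension.

(** * Kraus operators for an inclusion of balls *)

Section Kraus.
Context (C : numClosedFieldType) (g a b a' b' : nat).
Context (K : 'I_g -> 'M[C]_(a, b)) (L : 'I_g -> 'M[C]_(a', b')).
Implicit Types (A : 'M[C]_a) (B : 'M[C]_b) (Y : 'I_g -> 'M[C]_(b, a)).
Implicit Types (u : 'M[C]_(a', a)) (y : 'M[C]_(b', b)).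

(* [kform A B Y] is the matrix of the form
   [<u, uA> + <y, yB> + 2 <u, \sum_j L_j y Y_j>] in the pair [(u, y)], coded by
   the row [kvec u y]; [kval A B Y] is the value on it of the positive
   functional whose extension yields the Kraus operators. *)
Definition kform A B Y : 'M[C]_(a' * a + b' * b) :=
  block_mx (lin_mulmxr A) 0
    (2%:R *: \sum_j lin_mulmx (L j) *m lin_mulmxr (Y j)) (lin_mulmxr B).

Definition kvec u y : 'rV[C]_(a' * a + b' * b) := row_mx (mxvec u) (mxvec y).

Definition kval A B Y : C :=
  \tr A + \tr B + (\sum_j \tr (K j *m Y j) + (\sum_j \tr (K j *m Y j))^*).

Lemma hipE m n (u z : 'M[C]_(m, n)) :
  hip u z = \sum_i \sum_j (u i j)^* * z i j.
Proof.
rewrite /hip /mxtrace exchange_big; apply: eq_bigr => j _.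
by rewrite mxE; apply: eq_bigr => i _; rewrite !mxE.
Qed.

Lemma hip_mxvec m n (u z : 'M[C]_(m, n)) : hip (mxvec u) (mxvec z) = hip u z.
Proof.
rewrite !hipE big_ord1 (reindex _ (curry_mxvec_bij _ _)) /= [RHS]pair_bigA.
by apply: eq_bigr => -[i j] _ /=; rewrite !mxvecE.
Qed.

Lemma re_sum_eq0 (z d : C) : 0 <= d -> z + z^* = z + d + (z + d)^* -> d = 0.
Proof.
move=> d0; rewrite rmorphD /= [X in _ = _ + (_ + X)](CrealP (ger0_real d0)) =>
  E.
have /eqP : d *+ 2 = 0 by apply: (addrI (z + z^*)); rewrite addr0 {2}E mulr2n;
  ring.
by rewrite mulrn_eq0 /= => /eqP.
Qed.

Lemma hip_row_mx m n1 n2 (u1 z1 : 'M[C]_(m, n1)) (u2 z2 : 'M[C]_(m, n2)) :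
  hip (row_mx u1 u2) (row_mx z1 z2) = hip u1 z1 + hip u2 z2.
Proof.
by rewrite /hip tr_row_mx map_col_mx mul_col_row mxtrace_block.
Qed.

Lemma kform_hip A B Y u y :
  hip (kvec u y) (kvec u y *m kform A B Y) =
  hip u (u *m A) + hip y (y *m B) + 2%:R * hip u (pv L Y y).
Proof.
rewrite /kvec /kform mul_row_block mulmx0 add0r hip_row_mx hipDr.
rewrite /lin_mulmxr /lin_mulmx !mul_vec_lin /= !hip_mxvec.
rewrite -scalemxAr hipZr mulmx_sumr addrAC; congr (_ + _ * _).
rewrite hip_sumr /pv hip_sumr; apply: eq_bigr => j _.
by rewrite mulmxA !mul_vec_lin /= hip_mxvec.
Qed.

Lemma kform_lin k A B Y A' B' Y' :
  kform (k *: A + A') (k *: B + B') (fun j => k *: Y j + Y' j) =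
  k *: kform A B Y + kform A' B' Y'.
Proof.
rewrite /kform scale_block_mx add_block_mx !linearP scaler0 addr0.
congr block_mx; rewrite scalerA mulrC -scalerA -scalerDr; congr (_ *: _).
rewrite scaler_sumr -big_split; apply: eq_bigr => j _ /=.
by rewrite linearP mulmxDr -scalemxAr.
Qed.

Lemma kvecK (x : 'rV_(a' * a + b' * b)) :
  x = kvec (vec_mx (lsubmx x)) (vec_mx (rsubmx x)).
Proof. by rewrite /kvec !vec_mxK hsubmxK. Qed.

Lemma kform1 : kform 1%:M 1%:M (fun=> 0) = 1%:M.
Proof.
rewrite /kform big1 => [|j _]; last by rewrite linear0 mulmx0.
rewrite scaler0 [RHS]scalar_mx_block; congr block_mx.
  by apply/row_matrixP => i; rewrite !rowE -[delta_mx 0 i]vec_mxK mul_vec_lin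
    /= !mulmx1.
by apply/row_matrixP => i; rewrite !rowE -[delta_mx 0 i]vec_mxK mul_vec_lin /=
  !mulmx1.
Qed.

Lemma kform0 : kform 0 0 (fun=> 0) = 0.
Proof.
rewrite /kform big1 => [|j _]; last by rewrite linear0 mulmx0.
by rewrite !linear0 block_mx0.
Qed.

Lemma kval0 : kval 0 0 (fun=> 0) = 0.
Proof.
rewrite /kval !mxtrace0 big1 => [|j _]; last by rewrite mulmx0 mxtrace0.
by rewrite rmorph0 !addr0.
Qed.

Lemma hip_herm m n (A : 'M[C]_n) (u : 'M[C]_(m, n)) : A^t* = A ->
  (hip u (u *m A))^* = hip u (u *m A).
Proof. by move=> Ah; rewrite hip_conj hip_mulr Ah. Qed.

(* Up to the factors [S] and [T], the positivity of [kform A B Y] says that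
   [Y] is in the unit ball of [L]. *)
Lemma kval_ge_definite A B Y (S : 'M[C]_a) (T : 'M[C]_b) : dom K L ->
  A = S^t* *m S -> B = T^t* *m T -> S \in unitmx -> T \in unitmx ->
  (forall u y, 0 <= hip u (u *m A) + hip y (y *m B)
     + (hip u (pv L Y y) + hip (pv L Y y) u)) ->
  0 <= kval A B Y.
Proof.
move=> KL AE BE Su Tu H.
have dagu n (Z : 'M[C]_n) : Z \in unitmx -> Z^t* \in unitmx.
  by rewrite map_unitmx unitmx_tr.
have /dagu Su' := Su; have /dagu Tu' := Tu.
pose X j := invmx (T^t*) *m Y j *m invmx S.
have YE j : Y j = T^t* *m X j *m S.
  by rewrite /X !mulmxA mulmxV // mul1mx mulmxKV.
have pvE c d (M : 'I_g -> 'M[C]_(c, d)) z :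
    pv M Y z = pv M X (z *m T^t*) *m S.
  rewrite /pv mulmx_suml; apply: eq_bigr => j _.
  by rewrite YE !mulmxA.
have hipMS n m (u z : 'M[C]_(n, m)) (Z : 'M[C]_m) : Z \in unitmx ->
    hip (u *m invmx (Z^t*)) (z *m Z) = hip u z.
  by move=> Zu; rewrite hip_mulr' mulmxKV // dagu.
have LX : contr L X.
  (* This [u'] minimizes the form: the hypothesis becomes [nsq y' - nsq (pv L X y') >= 0]. *)
  move=> y'; pose u' := - pv L X y'.
  have := H (u' *m invmx (S^t*)) (y' *m invmx (T^t*)).
  have -> : pv L Y (y' *m invmx (T^t*)) = pv L X y' *m S by rewrite pvE mulmxKV.
  rewrite AE BE !mulmxA !mulmxKV // !hipMS // -[hip (_ *m S) _]hip_conj hipMS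
    //.
  rewrite hip_conj /u' !hipNl !hipNr opprK /nsq => H'.
  rewrite -subr_ge0; apply: le_trans H' _; rewrite le_eqVlt; apply/orP; left;
    apply/eqP; ring.
(* [X] is rectangular, of size [b] by [a]. Its contractivity for [K], tested on the pair [S^t*],
   [T^t*], is the positivity of [kval A B Y]. *)
have KX := dom_rect KL LX.
have E1 : \tr A = nsq (S^t*) by rewrite AE nsq_dag.
have E2 : \tr B = nsq (T^t*) by rewrite BE nsq_dag.
have E3 : \sum_j \tr (K j *m Y j) = hip (S^t*) (pv K X (T^t*)).
  rewrite /pv hip_sumr; apply: eq_bigr => j _.
  by rewrite YE /hip trmxCK !mulmxA mxtrace_mulC !mulmxA.
rewrite /kval E1 E2 E3 hip_conj -subr_ge0.
have := hip_ge (S^t*) (pv K X (T^t*)); rewrite -subr_ge0 opprK => H1.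
have H2 := KX (T^t*).
rewrite subr0; apply: le_trans H1 _; rewrite addrC lerD2r lerD2l.
exact: H2.
Qed.

(** The form only makes [A] and [B] semidefinite. Adding [e] times the identity makes them
    invertible and changes [kval] by [e * (a + b)]; then [e] tends to 0. Positive [a'] and [b'] let
    a single row be embedded as a test matrix. *)
Lemma kval_ge0 A B Y : archimedean_field C -> (0 < a')%N -> (0 < b')%N ->
  dom K L -> A^t* = A -> B^t* = B ->
  (forall u y, 0 <= hip u (u *m A) + hip y (y *m B)
     + (hip u (pv L Y y) + hip (pv L Y y) u)) ->
  0 <= kval A B Y.
Proof.
move=> archC a0 b0 KL Ah Bh H.
have psdA (x : 'rV[C]_a) : 0 <= hip x (x *m A).
  pose d : 'cV[C]_a' := delta_mx (Ordinal a0) 0.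
  have dd : d^t* *m d = 1%:M.
    by apply/matrixP => i j; rewrite trmx_delta map_delta_mx mul_delta_mx !ord1
      !mxE.
  have := H (d *m x) 0; rewrite mul0mx hip0l addr0.
  have -> : pv L Y 0 = 0 by rewrite /pv big1 // => j _; rewrite mulmx0 mul0mx.
  by rewrite hip0l hip0r !addr0 -mulmxA hip_mull mulmxA dd mul1mx.
have psdB (x : 'rV[C]_b) : 0 <= hip x (x *m B).
  pose d : 'cV[C]_b' := delta_mx (Ordinal b0) 0.
  have dd : d^t* *m d = 1%:M.
    by apply/matrixP => i j; rewrite trmx_delta map_delta_mx mul_delta_mx !ord1
      !mxE.
  have := H 0 (d *m x); rewrite mul0mx hip0l add0r.
  by rewrite hip0l hip0r !addr0 -mulmxA hip_mull mulmxA dd mul1mx.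
have def n (Z : 'M[C]_n) (e : C) : 0 < e -> Z^t* = Z ->
    (forall x : 'rV_n, 0 <= hip x (x *m Z)) ->
    exists2 S : 'M[C]_n, Z + e%:M = S^t* *m S & S \in unitmx.
  move=> e0 Zh Z0.
  have Zp (x : 'rV_n) : hip x (x *m (Z + e%:M)) = hip x (x *m Z) + e * nsq x.
    by rewrite mulmxDr mul_mx_scalar hipDr hipZr.
  have [S SE] : exists S : 'M[C]_n, Z + e%:M = S^t* *m S.
    have eh : (Z + e%:M)^t* = Z + e%:M.
      rewrite dagD Zh tr_scalar_mx map_scalar_mx; congr (_ + _%:M).
      by apply/CrealP/ger0_real/ltW.
    by apply: (psd_factor eh) => x; rewrite Zp addr_ge0 // mulr_ge0 ?nsq_ge0 //
      ltW.
  exists S => //.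
  suff : Z + e%:M \in unitmx by rewrite SE unitmx_mul => /andP[].
  rewrite -row_free_unit; apply: inj_row_free => x xZ.
  have := Zp x; rewrite xZ hip0r => /esym/eqP.
  have ex0 : 0 <= e * nsq x by rewrite mulr_ge0 ?nsq_ge0 // ltW.
  rewrite (paddr_eq0 (Z0 x) ex0) mulf_eq0 (gt_eqF e0) /= nsq_eq0.
  by move=> /andP[_ /eqP].
apply: (@arch_le _ _ _ (a%:R + b%:R) archC) => -[|k].
  by rewrite !mulr0n add0r addr_ge0 ?ler0n.
rewrite mul0rn.
pose e : C := k.+1%:R^-1; have e0 : 0 < e by rewrite invr_gt0 ltr0Sn.
have [S SE Su] := def _ A e e0 Ah psdA.
have [T TE Tu] := def _ B e e0 Bh psdB.
have := kval_ge_definite (Y := Y) KL SE TE Su Tu.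
have -> : kval (A + e%:M) (B + e%:M) Y = kval A B Y + e * (a%:R + b%:R).
  by rewrite /kval !mxtraceD !mxtrace_scalar mulrDr -[e *+ a]mulr_natr -[e *+
    b]mulr_natr; ring.
move=> H1; rewrite -[_ *+ k.+1]mulr_natl.
have -> : a%:R + b%:R = k.+1%:R * (e * (a%:R + b%:R)).
  by rewrite mulrA mulfV ?mul1r // pnatr_eq0.
rewrite -mulrDr mulr_ge0 ?ler0n // H1 // => u y.
rewrite !mulmxDr !mul_mx_scalar !hipDr !hipZr.
apply: le_trans (H u y) _; rewrite lerD2r addrACA lerDl.
by rewrite addr_ge0 // mulr_ge0 ?nsq_ge0 // ltW.
Qed.

Lemma kval_lin k A B Y A' B' Y' : k^* = k ->
  kval (k *: A + A') (k *: B + B') (fun j => k *: Y j + Y' j) =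
  k * kval A B Y + kval A' B' Y'.
Proof.
move=> kr; rewrite /kval !mxtraceD !mxtraceZ.
have -> : \sum_j \tr (K j *m (k *: Y j + Y' j)) =
    k * \sum_j \tr (K j *m Y j) + \sum_j \tr (K j *m Y' j).
  rewrite mulr_sumr -big_split; apply: eq_bigr => j _ /=.
  by rewrite mulmxDr mxtraceD -scalemxAr mxtraceZ.
by rewrite rmorphD rmorphM /= kr; ring.
Qed.

Lemma kform_re A B Y u y : A^t* = A -> B^t* = B ->
  hip (kvec u y) (kvec u y *m kform A B Y) +
  hip (kvec u y *m kform A B Y) (kvec u y) =
  (hip u (u *m A) + hip y (y *m B) + (hip u (pv L Y y) + hip (pv L Y y) u)) *+
    2.
Proof.
move=> Ah Bh; rewrite -[X in _ + X]hip_conj kform_hip !rmorphD rmorphM /=.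
rewrite conjC_nat (hip_herm u Ah) (hip_herm y Bh) hip_conj mulr2n; ring.
Qed.

End Kraus.

Section KrausExistence.
Context (R : realType) (g a b a' b' : nat).
Local Notation C := (Cplx R).
Context (K : 'I_g -> 'M[C]_(a, b)) (L : 'I_g -> 'M[C]_(a', b')).

(** A relation, because [kform] need not be injective in [Y]; that the value depends on the matrix
    alone is a consequence of positivity. *)
Definition kgraph (v : 'M[C]_(a' * a + b' * b)) (t : R) : Prop :=
  exists A B Y, [/\ A^t* = A, B^t* = B, v = kform L A B Y & t%:C%C = kval K A B
    Y].

Lemma kform_qre (A : 'M[C]_a) (B : 'M[C]_b) Y u y : A^t* = A -> B^t* = B ->
  qre (kform L A B Y) (kvec u y) =
  (hip u (u *m A) + hip y (y *m B) + (hip u (pv L Y y) + hip (pv L Y y) u)) *+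
    2.
Proof. exact: kform_re. Qed.

Lemma kgraph_pos : (0 < a')%N -> (0 < b')%N -> dom K L -> pos_graph kgraph.
Proof.
move=> a0 b0 KL.
have lin k v t w s : kgraph v t -> kgraph w s ->
    kgraph (k%:C%C *: v + w) (k * t + s).
  move=> [A [B [Y [Ah Bh -> tE]]]] [A' [B' [Y' [Ah' Bh' -> sE]]]].
  exists (k%:C%C *: A + A'), (k%:C%C *: B + B'), (fun j => k%:C%C *: Y j + Y'
    j).
  split.
  - by rewrite dagD dagZ conj_real Ah Ah'.
  - by rewrite dagD dagZ conj_real Bh Bh'.
  - by rewrite kform_lin.
  - by rewrite rmorphD rmorphM /= tE sE kval_lin // conj_real.
have g0 : kgraph 0 0.
  by exists 0, 0, (fun=> 0); rewrite kform0 kval0 !dag0.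
split=> //.
- by move=> v w t s Gv Gw; have := lin 1 _ _ _ _ Gv Gw; rewrite scale1r mul1r.
- by move=> r v t Gv; have := lin r _ _ _ _ Gv g0; rewrite !addr0.
- move=> v t [A [B [Y [Ah Bh -> tE]]]] cv; rewrite -(@lecR R) tE.
  apply: (kval_ge0 (@Cplx_archimedean R) a0 b0 KL Ah Bh) => u y.
  by have := cv (kvec u y); rewrite kform_qre // pmulrn_lge0.
- exists (a%:R + b%:R), 1%:M, 1%:M, (fun=> 0); rewrite !dag1; split=> //.
    by rewrite kform1.
  rewrite /kval !mxtrace1 big1 => [|j _]; last by rewrite mulmx0 mxtrace0.
  by rewrite rmorph0 !addr0 rmorphD !rmorph_nat.
Qed.

(** Each representing row [x i] unfolds into a pair of Kraus operators [u i], [y i]. Comparing the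
    two expressions of the functional as [A], [B], [Y] vary gives the three identities, each tested
    on its own defect. *)
Lemma kraus_of_dom : (0 < a')%N -> (0 < b')%N -> dom K L ->
  exists N (E : 'I_N -> 'M[C]_(a', a)) (F : 'I_N -> 'M[C]_(b', b)),
    [/\ forall j, K j = \sum_i (E i)^t* *m L j *m F i,
        \sum_i (E i)^t* *m E i = 1%:M & \sum_i (F i)^t* *m F i = 1%:M].
Proof.
move=> a0 b0 KL; have [x xE] := pos_graph_rep (kgraph_pos a0 b0 KL).
pose u i := vec_mx (lsubmx (x i)); pose y i := vec_mx (rsubmx (x i)).
have H A B Y : A^t* = A -> B^t* = B ->
    kval K A B Y = \sum_i (hip (u i) (u i *m A) + hip (y i) (y i *m B)
      + (hip (u i) (pv L Y (y i)) + hip (pv L Y (y i)) (u i))).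
  move=> Ah Bh.
  have trh n (Z : 'M[C]_n) : Z^t* = Z -> (\tr Z)^* = \tr Z.
    by move=> {2}<-; rewrite trace_map_mx mxtrace_tr.
  have [t tE] : exists t : R, t%:C%C = kval K A B Y.
    exists (complex.Re (kval K A B Y)); apply/RRe_real/CrealP.
    rewrite /kval !rmorphD /= (trh _ _ Ah) (trh _ _ Bh) conjCK.
    by rewrite [X in _ + X]addrC.
  have /xE : kgraph (kform L A B Y) t by exists A, B, Y.
  rewrite tE; under eq_bigr do rewrite [x _](@kvecK C) kform_qre //.
  by rewrite sumrMnl => /eqP; rewrite eqr_pMn2r // => /eqP.
have herm n m N0 (w : 'I_N0 -> 'M[C]_(m, n)) :
    let S := \sum_i (w i)^t* *m w i - 1%:M in S^t* = S.
  rewrite /= dagB dag1 dag_sum; congr (_ - _); apply: eq_bigr => i _.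
  by rewrite dagM trmxCK.
have traceS n m N0 (w : 'I_N0 -> 'M[C]_(m, n)) (S : 'M[C]_n) :
    \sum_i hip (w i) (w i *m S) = \tr ((\sum_i (w i)^t* *m w i) *m S).
  rewrite mulmx_suml [RHS](big_morph _ (@mxtraceD _ _) (@mxtrace0 _ _)).
  by apply: eq_bigr => i _; rewrite /hip mulmxA.
have nsqS n (S : 'M[C]_n) : S^t* = S -> \tr (S *m S) = 0 -> S = 0.
  by move=> Sh S0; apply/eqP; rewrite -nsq_eq0 /nsq /hip Sh S0.
have pv0 y0 : pv L (fun=> 0 : 'M[C]_(b, a)) y0 = 0.
  by rewrite /pv big1 // => j _; rewrite mulmx0.
have tr0 : \sum_j \tr (K j *m (0 : 'M[C]_(b, a))) = 0.
  by rewrite big1 // => j _; rewrite mulmx0 mxtrace0.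
exists (a' * a + b' * b)%N, u, y; split.
- pose D j := \sum_i (u i)^t* *m L j *m y i - K j.
  suff D0 j : D j = 0 by move=> j; apply/esym/eqP; rewrite -subr_eq0;
    apply/eqP/D0.
  (* With [Y j] the adjoint of the defect [D j], the two sides differ by twice the sum of the [nsq]
     of the defects. *)
  have := H 0 0 (fun j => (D j)^t*) (dag0 _ _ _) (dag0 _ _ _).
  rewrite /kval !mxtrace0 !add0r.
  under [RHS]eq_bigr do rewrite !mulmx0 !hip0r !add0r.
  rewrite big_split /=.
  have -> : \sum_i hip (pv L (fun j => (D j)^t*) (y i)) (u i) =
      (\sum_i hip (u i) (pv L (fun j => (D j)^t*) (y i)))^*.
    by rewrite rmorph_sum; apply: eq_bigr => i _; rewrite -hip_conj.
  have -> : \sum_i hip (u i) (pv L (fun j => (D j)^t*) (y i)) =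
      \sum_j \tr (K j *m (D j)^t*) + \sum_j nsq ((D j)^t*).
    rewrite -big_split /=; under eq_bigr do rewrite /pv hip_sumr.
    rewrite exchange_big; apply: eq_bigr => k _ /=.
    rewrite /nsq /hip trmxCK -mxtraceD -mulmxDl /D subrKC mulmx_suml.
    rewrite [RHS](big_morph _ (@mxtraceD _ _) (@mxtrace0 _ _)).
    by apply: eq_bigr => i _; rewrite /hip !mulmxA.
  set z := \sum_j _; set d := \sum_j _ => E.
  have : d = 0 by apply: (re_sum_eq0 (z := z)) => //; apply: sumr_ge0 => *;
    apply: nsq_ge0.
  move/eqP; rewrite psumr_eq0 => [|i _]; last exact: nsq_ge0.
  move=> /allP/(_ j (mem_index_enum j)); rewrite /= nsq_eq0 => /eqP Dj.
  by rewrite -[D j]trmxCK Dj dag0.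
- pose S := \sum_i (u i)^t* *m u i - 1%:M.
  suff : S = 0 by move=> /eqP; rewrite subr_eq0 => /eqP.
  apply: nsqS; first exact: herm.
  have := H S 0 (fun=> 0) (herm _ _ _ _) (dag0 _ _ _).
  rewrite /kval tr0 mxtrace0 rmorph0 !addr0.
  under [RHS]eq_bigr do rewrite mulmx0 pv0 !hip0r hip0l !addr0.
  rewrite traceS => SE.
  by rewrite {1}/S mulmxBl mul1mx raddfB /= -SE subrr.
- pose S := \sum_i (y i)^t* *m y i - 1%:M.
  suff : S = 0 by move=> /eqP; rewrite subr_eq0 => /eqP.
  apply: nsqS; first exact: herm.
  have := H 0 S (fun=> 0) (dag0 _ _ _) (herm _ _ _ _).
  rewrite /kval tr0 mxtrace0 rmorph0 !addr0 add0r.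
  under [RHS]eq_bigr do rewrite mulmx0 pv0 !hip0r hip0l !addr0 add0r.
  rewrite traceS => SE.
  by rewrite {1}/S mulmxBl mul1mx raddfB /= -SE subrr.
Qed.

End KrausExistence.

(** * Intertwiners of minimal pencils *)

Section FunctionalCalculus.
Context (C : numClosedFieldType).

Definition conj_diag n (P : 'M[C]_n) (D : 'rV[C]_n) (h : C -> C) : 'M[C]_n :=
  P^t* *m diag_mx (map_mx h D) *m P.

Lemma conj_diagM n (P : 'M[C]_n) (D : 'rV[C]_n) (h k : C -> C) : P *m P^t* =
  1%:M ->
  conj_diag P D h *m conj_diag P D k = conj_diag P D (fun x => h x * k x).
Proof.
move=> PP; rewrite /conj_diag !mulmxA -[X in X *m _ *m P]mulmxA PP mulmx1.
rewrite -[_ *m _ *m diag_mx _]mulmxA mulmx_diag; congr (_ *m diag_mx _ *m _).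
by apply/rowP => i; rewrite !mxE.
Qed.

Lemma conj_diag_ext n (P : 'M[C]_n) (D : 'rV[C]_n) (h k : C -> C) : (forall i,
  h (D 0 i) = k (D 0 i)) ->
  conj_diag P D h = conj_diag P D k.
Proof.
move=> hk; rewrite /conj_diag; congr (_ *m diag_mx _ *m _).
by apply/rowP => i; rewrite !mxE hk.
Qed.

Lemma conj_diag_herm n (P : 'M[C]_n) (D : 'rV[C]_n) (h : C -> C) : (forall i,
  (h (D 0 i))^* = h (D 0 i)) ->
  (conj_diag P D h)^t* = conj_diag P D h.
Proof.
move=> hr; rewrite /conj_diag !dagM trmxCK tr_diag_mx map_diag_mx mulmxA.
congr (_ *m diag_mx _ *m _).
by apply/rowP => i; rewrite !mxE; apply: hr.
Qed.

(** In eigenbases the hypothesis reads [D_i T_ij = T_ij E_j]: a nonzero entry forces equal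
    eigenvalues, at which [h] takes the same value. *)
Lemma conj_diag_comm n m (P : 'M[C]_n) (D : 'rV[C]_n)
    (Q : 'M[C]_m) (E : 'rV[C]_m) (T : 'M[C]_(n, m)) (h : C -> C) :
  P^t* *m P = 1%:M -> Q^t* *m Q = 1%:M -> P *m P^t* = 1%:M -> Q *m Q^t* = 1%:M
    ->
  conj_diag P D id *m T = T *m conj_diag Q E id ->
  conj_diag P D h *m T = T *m conj_diag Q E h.
Proof.
move=> PP QQ PP' QQ' H; have [T1 T1E] : exists T1, T1 = P *m T *m Q^t* by
  exists (P *m T *m Q^t*).
have diagE k : P *m (conj_diag P D k *m T) *m Q^t* = diag_mx (map_mx k D) *m T1.
  by rewrite T1E /conj_diag !mulmxA PP' mul1mx.
have diagE' k : P *m (T *m conj_diag Q E k) *m Q^t* = T1 *m diag_mx (map_mx k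
  E).
  by rewrite T1E /conj_diag !mulmxA -[_ *m Q *m Q^t*]mulmxA QQ' mulmx1.
have H1 i j : D 0 i * T1 i j = T1 i j * E 0 j.
  have := congr1 (fun Z => (P *m Z *m Q^t*) i j) H; rewrite diagE diagE'.
  by rewrite mul_diag_mx mul_mx_diag !mxE.
have H2 : diag_mx (map_mx h D) *m T1 = T1 *m diag_mx (map_mx h E).
  rewrite mul_diag_mx mul_mx_diag; apply/matrixP => i j; rewrite !mxE.
  have [->|T0] := eqVneq (T1 i j) 0; first by rewrite mulr0 mul0r.
  have -> : D 0 i = E 0 j by apply: (mulIf T0); rewrite H1 mulrC.
  by rewrite mulrC.
have conjK Z : Z = P^t* *m (P *m Z *m Q^t*) *m Q.
  by rewrite !mulmxA PP mul1mx -mulmxA QQ mulmx1.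
by rewrite [LHS]conjK [RHS]conjK diagE diagE' H2.
Qed.

End FunctionalCalculus.

Section Intertwiners.
Context (C : numClosedFieldType) (g : nat).

(** The relation for the adjoints makes these pairs stable under adjoints as well as composition, so
    that [X^t* *m X] and [Y^t* *m Y] intertwine [K] with itself. *)
Definition itw a b c d (K : 'I_g -> 'M[C]_(a, b)) (M : 'I_g -> 'M[C]_(c, d))
    (X : 'M[C]_(c, a)) (Y : 'M[C]_(d, b)) : Prop :=
  forall j, M j *m Y = X *m K j /\ (M j)^t* *m X = Y *m (K j)^t*.

Lemma itw_comp a b c d e f (K : 'I_g -> 'M[C]_(a, b)) (M : 'I_g -> 'M[C]_(c, d))
    (P : 'I_g -> 'M[C]_(e, f)) X Y X' Y' :
  itw K M X Y -> itw M P X' Y' -> itw K P (X' *m X) (Y' *m Y).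
Proof.
move=> H H' j; have [h1 h2] := H j; have [h3 h4] := H' j.
by rewrite !mulmxA h3 h4 -!mulmxA h1 h2 !mulmxA.
Qed.

Lemma itw_dag a b c d (K : 'I_g -> 'M[C]_(a, b)) (M : 'I_g -> 'M[C]_(c, d)) X Y
  :
  itw K M X Y -> itw M K (X^t*) (Y^t*).
Proof.
move=> H j; have [h1 h2] := H j; split.
  by rewrite -[LHS]trmxCK dagM trmxCK -h2 dagM trmxCK.
by rewrite -dagM -h1 dagM.
Qed.

Lemma itwD a b c d (K : 'I_g -> 'M[C]_(a, b)) (M : 'I_g -> 'M[C]_(c, d))
    X Y X' Y' : itw K M X Y -> itw K M X' Y' -> itw K M (X + X') (Y + Y').
Proof.
move=> H H' j; have [h1 h2] := H j; have [h3 h4] := H' j.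
by rewrite !mulmxDr !mulmxDl h1 h2 h3 h4.
Qed.

Lemma itwN a b c d (K : 'I_g -> 'M[C]_(a, b)) (M : 'I_g -> 'M[C]_(c, d)) X Y :
  itw K M X Y -> itw K M (- X) (- Y).
Proof. by move=> H j; have [h1 h2] := H j; rewrite !mulmxN !mulNmx h1 h2. Qed.

Lemma itw0 a b c d (K : 'I_g -> 'M[C]_(a, b)) (M : 'I_g -> 'M[C]_(c, d)) :
  itw K M 0 0.
Proof. by move=> j; rewrite !mulmx0 !mul0mx. Qed.

Lemma itw1 a b (K : 'I_g -> 'M[C]_(a, b)) : itw K K 1%:M 1%:M.
Proof. by move=> j; rewrite !mulmx1 !mul1mx. Qed.

Lemma dag_mul_eq0 a b (X : 'M[C]_(a, b)) : X^t* *m X = 0 -> X = 0.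
Proof. by move=> X0; apply/eqP; rewrite -nsq_eq0 /nsq /hip X0 mxtrace0. Qed.

Definition pisom a b (X : 'M[C]_(a, b)) : Prop :=
  X^t* *m X *m (X^t* *m X) = X^t* *m X.

Lemma pisomE a b (X : 'M[C]_(a, b)) : pisom X -> X *m (X^t* *m X) = X.
Proof.
move=> XX; apply/eqP; rewrite -subr_eq0; apply/eqP/dag_mul_eq0.
rewrite dagB dagM dagM trmxCK mulmxBl !mulmxBr.
by rewrite !mulmxA -[X^t* *m X *m X^t* *m X]mulmxA XX -mulmxA XX !subrr.
Qed.

(** The polar parts of [X] and [Y]: since [X^* X K_j = K_j Y^* Y], the inverse square roots are
    intertwined too. The factorizations on both sides keep track of kernels and ranges. *)
Lemma itw_polar a b c d (K : 'I_g -> 'M[C]_(a, b)) (M : 'I_g -> 'M[C]_(c, d)) X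
  Y :
  itw K M X Y ->
  exists W V, [/\ itw K M W V, pisom W /\ pisom V,
    (W = 0 -> X = 0) /\ (V = 0 -> Y = 0),
    (exists A, W = X *m A) /\ (exists A, V = Y *m A)
  & (exists A, W = A *m X) /\ (exists A, V = A *m Y)].
Proof.
move=> H.
have dec n m (Z : 'M[C]_(n, m)) : exists (P : 'M[C]_m) (D : 'rV[C]_m),
    [/\ P^t* *m P = 1%:M, P *m P^t* = 1%:M, forall i, 0 <= D 0 i
      & Z^t* *m Z = conj_diag P D id].
  have Zh : (Z^t* *m Z)^t* = Z^t* *m Z by rewrite dagM trmxCK.
  have [P [D [PP PP' ZE DE]]] := herm_spectral Zh.
  exists P, D; split=> // [i|].
    by rewrite DE mulmxA hip_mulr' nsq_ge0.
  by rewrite ZE /conj_diag (_ : map_mx id D = D) //; apply/rowP => i; rewrite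
    mxE.
have [P [D [PP PP' D0 XE]]] := dec _ _ X.
have [Q [E [QQ QQ' E0 YE]]] := dec _ _ Y.
(* [h 0 = 0], so that the spectral functions below ignore the kernel. *)
pose h (x : C) := (sqrtC x)^-1.
have hr x : 0 <= x -> (h x)^* = h x.
  by move=> x0; apply/CrealP/ger0_real; rewrite invr_ge0 sqrtC_ge0.
have part n m (Z : 'M[C]_(n, m)) (U : 'M[C]_m) (F : 'rV[C]_m) : U^t* *m U =
  1%:M ->
    U *m U^t* = 1%:M -> (forall i, 0 <= F 0 i) -> Z^t* *m Z = conj_diag U F id
      ->
    let S := conj_diag U F h in
    [/\ pisom (Z *m S), Z *m S = 0 -> Z = 0 & exists A, Z *m S = A *m Z].
  move=> UU UU' F0 ZE S.
  have Sh : S^t* = S by apply: conj_diag_herm => i; apply: hr.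
  have WW : (Z *m S)^t* *m (Z *m S) = conj_diag U F (fun x => (x != 0)%:R).
    rewrite dagM Sh -mulmxA (mulmxA _ Z) ZE !conj_diagM //.
    apply: conj_diag_ext => i; rewrite /h; set x := F 0 i.
    have [->|x0] := eqVneq x 0; first by rewrite mul0r mulr0.
    rewrite mulrCA -[x in x * _]sqrtCK expr2 mulrA mulfK ?sqrtC_eq0 //.
    by rewrite mulfV ?sqrtC_eq0.
  split.
  - rewrite /pisom WW conj_diagM //; apply: conj_diag_ext => i.
    by case: eqP; rewrite /= ?mulr0 ?mulr1.
  - move=> W0; apply: dag_mul_eq0; rewrite ZE.
    have : conj_diag U F id *m conj_diag U F (fun x => (x != 0)%:R) = 0.
      by rewrite -WW W0 mulmx0 mulmx0.
    rewrite conj_diagM // => <-; apply: conj_diag_ext => i.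
    by case: eqVneq => [->|]; rewrite ?mulr0 ?mulr1.
  (* [Z], the power -3/2 of [Z^* Z], then the adjoint of [Z]: a further [Z] on the right brings the
     power back to -1/2. *)
  - exists (Z *m conj_diag U F (fun x => (x * sqrtC x)^-1) *m Z^t*).
    rewrite -[RHS]mulmxA -[RHS]mulmxA ZE conj_diagM //; congr (_ *m _).
    apply: conj_diag_ext => i; rewrite /h; set x := F 0 i.
    have [->|x0] := eqVneq x 0; first by rewrite sqrtC0 invr0 mulr0.
    by rewrite invfM mulrAC mulVf // mul1r.
have [wX nX aX] := part _ _ _ _ _ PP PP' D0 XE.
have [wY nY aY] := part _ _ _ _ _ QQ QQ' E0 YE.
exists (X *m conj_diag P D h), (Y *m conj_diag Q E h); split=> //; last first.
  by split; eexists.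
have XYK j : conj_diag P D h *m K j = K j *m conj_diag Q E h.
  apply: conj_diag_comm => //; rewrite -XE -YE.
  by have [] := itw_comp H (itw_dag H) j.
have YXK j : conj_diag Q E h *m (K j)^t* = (K j)^t* *m conj_diag P D h.
  apply: conj_diag_comm => //; rewrite -XE -YE.
  by have [] := itw_comp H (itw_dag H) j.
move=> j; have [h1 h2] := H j; split.
  by rewrite [LHS]mulmxA h1 -[LHS]mulmxA -XYK [LHS]mulmxA.
by rewrite [LHS]mulmxA h2 -[LHS]mulmxA -YXK [LHS]mulmxA.
Qed.

End Intertwiners.

(** * Isometric embeddings of minimal pencils *)

Section MinimalPencils.
Context (C : numClosedFieldType) (g : nat).

Lemma pisom_proj n m (X : 'M[C]_(n, m)) : pisom X ->
  let Q := 1%:M - X^t* *m X in Q *m Q = Q /\ Q^t* = Q.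
Proof.
move=> XX Q; split; last by rewrite /Q dagB dag1 dagM trmxCK.
by rewrite /Q mulmxBl mul1mx mulmxBr mulmx1 XX subrr subr0.
Qed.

(* A partial isometry moving a nonzero summand of [K] onto an orthogonal one
   makes the former redundant. *)
Lemma minp_commutant a b (K : 'I_g -> 'M[C]_(a, b)) (W : 'M[C]_a) (V : 'M[C]_b)
  :
  (0 < g)%N -> minp K -> itw K K W V -> pisom W -> pisom V ->
  W *m W = 0 -> V *m V = 0 -> W = 0 /\ V = 0.
Proof.
move=> g0 Kmin KWV pW pV WW VV.
have [QQ Qh] := pisom_proj pW; have [PP Ph] := pisom_proj pV.
set Q := 1%:M - W^t* *m W in QQ Qh; set P := 1%:M - V^t* *m V in PP Ph.
have [Q1 [Q11 Q1Q]] := projection_factor QQ Qh.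
have [P1 [P11 P1P]] := projection_factor PP Ph.
have WQ : Q *m W = W by rewrite /Q mulmxBl mul1mx -mulmxA WW mulmx0 subr0.
have VP : P *m V = V by rewrite /P mulmxBl mul1mx -mulmxA VV mulmx0 subr0.
have QK j : Q *m K j = K j *m P.
  have [h _] := itw_comp KWV (itw_dag KWV) j.
  by rewrite /Q /P mulmxBl mulmxBr mul1mx mulmx1 h.
pose L j := Q1 *m K j *m P1^t*.
(* The compression by [Q] and [P] serves twice: in its own place and, transported by [W] and [V],
   for the removed summand. [Q + W^* W = 1] makes this a Kraus factorization. *)
pose E (i : 'I_2) := if i == ord0 then Q1 else Q1 *m W.
pose F (i : 'I_2) := if i == ord0 then P1 else P1 *m V.
have E1 : \sum_i (E i)^t* *m E i = 1%:M.
  rewrite big_ord_recl big_ord1 /E /= Q1Q dagM -mulmxA (mulmxA _ Q1) Q1Q WQ.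
  by rewrite subrK.
have F1 : \sum_i (F i)^t* *m F i = 1%:M.
  rewrite big_ord_recl big_ord1 /F /= P1P dagM -mulmxA (mulmxA _ P1) P1P VP.
  by rewrite subrK.
have LK : dom L K.
  apply: (@dom_trans _ _ _ _ _ _ _ _ _ (fun j => Q1 *m K j)).
    by apply: dom_mulr; rewrite trmxCK.
  exact: dom_mull.
have KL : dom K L.
  apply: (dom_kraus (E := E) (F := F)) E1 F1 => j.
  rewrite big_ord_recl big_ord1 /E /F /L /=.
  have [h1 h2] := KWV j.
  have e1 : Q1^t* *m (Q1 *m K j *m P1^t*) *m P1 = Q *m K j.
    by rewrite !mulmxA Q1Q -mulmxA P1P -mulmxA -QK mulmxA QQ.
  have -> : (Q1 *m W)^t* *m (Q1 *m K j *m P1^t*) *m (P1 *m V) =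
      W^t* *m (Q1^t* *m (Q1 *m K j *m P1^t*) *m P1) *m V.
    by rewrite dagM !mulmxA.
  rewrite e1 QK -mulmxA -mulmxA VP h1 mulmxA -QK.
  by rewrite -mulmxDl subrK mul1mx.
have [rQ rP] := minp_dom g0 Kmin KL LK (rank_leq_row _) (rank_leq_row _).
have QW : Q *m (W^t* *m W) = 0 by rewrite /Q mulmxBl mul1mx pW subrr.
have PV : P *m (V^t* *m V) = 0 by rewrite /P mulmxBl mul1mx pV subrr.
split; apply/eqP/contraT => X0.
  have W0 : W^t* *m W != 0 by apply: contraNneq X0 => /dag_mul_eq0 ->.
  by have := projection_rank_lt QW W0; rewrite rQ ltnn.
have V0 : V^t* *m V != 0 by apply: contraNneq X0 => /dag_mul_eq0 ->.
by have := projection_rank_lt PV V0; rewrite rP ltnn.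
Qed.

Lemma rank_add_proj n (P Q : 'M[C]_n) : P *m P = P -> Q *m Q = Q ->
  P *m Q = 0 -> Q *m P = 0 ->
  (\rank P <= \rank (P + Q)%R)%N /\ (\rank P = \rank (P + Q)%R -> Q = 0).
Proof.
move=> PP QQ PQ QP.
have sPS : (P <= (P + Q)%R)%MS.
  by apply/submxP; exists P; rewrite mulmxDr PP PQ addr0.
have sQS : (Q <= (P + Q)%R)%MS.
  by apply/submxP; exists Q; rewrite mulmxDr QQ QP add0r.
split; first exact: mxrankS.
move=> rk; have /eqmxP eqPS : (P == (P + Q)%R)%MS.
  by rewrite -(mxrank_leqif_eq sPS) rk.
have /submxP[Z QZ] : (Q <= P)%MS by rewrite eqPS.
by rewrite -QQ {1}QZ -mulmxA PQ mulmx0.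
Qed.

Section Embedding.
Context (a b c d N : nat) (K : 'I_g -> 'M[C]_(a, b)) (M : 'I_g -> 'M[C]_(c, d)).
Context (X : 'I_N -> 'M[C]_(c, a)) (Y : 'I_N -> 'M[C]_(d, b)).

(** [Q] and [P] project to what is not yet embedded, and some [X_i Q] or [Y_i P] is nonzero since
    the [X_i^* X_i] and the [Y_i^* Y_i] sum to 1. The pair [W^* X_i Q], [V^* Y_i P] intertwines [K]
    with itself and its polar part squares to 0, so [minp_commutant] kills it: the ranges of [X_i Q]
    and [W] are orthogonal, and the polar part of [X_i Q] can be added to [W]; likewise for [V]. *)
Lemma itw_extend W V : (0 < g)%N -> minp K ->
  (forall i, itw K M (X i) (Y i)) ->
  \sum_i (X i)^t* *m X i = 1%:M -> \sum_i (Y i)^t* *m Y i = 1%:M ->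
  itw K M W V -> pisom W -> pisom V ->
  W^t* *m W = 1%:M /\ V^t* *m V = 1%:M \/
  exists W' V', [/\ itw K M W' V', pisom W', pisom V'
    & (\rank (W^t* *m W) + \rank (V^t* *m V) <
       \rank (W'^t* *m W') + \rank (V'^t* *m V'))%N].
Proof.
move=> g0 Kmin KXY X1 Y1 KWV pW pV.
pose Q := 1%:M - W^t* *m W; pose P := 1%:M - V^t* *m V.
have [/andP[/eqP Q0 /eqP P0]|QP0] := boolP ((Q == 0) && (P == 0)).
  by left; split; apply/esym/eqP; rewrite -subr_eq0; apply/eqP.
right; have [i XYi] : exists i, (X i *m Q != 0) || (Y i *m P != 0).
  apply/existsP; apply: contraNT QP0; rewrite negb_exists => /forallP H.
  apply/andP; split; apply/eqP.
    rewrite -[Q]mul1mx -X1 mulmx_suml big1 // => i _.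
    by have := H i; rewrite negb_or !negbK -mulmxA => /andP[/eqP-> _]; rewrite
      mulmx0.
  rewrite -[P]mul1mx -Y1 mulmx_suml big1 // => i _.
  by have := H i; rewrite negb_or !negbK -mulmxA => /andP[_ /eqP->]; rewrite
    mulmx0.
have [QQ Qh] := pisom_proj pW; have [PP Ph] := pisom_proj pV.
rewrite -/Q in QQ Qh; rewrite -/P in PP Ph.
have KQP : itw K K Q P.
  by apply: itwD (itw1 K) (itwN _); apply: itw_comp KWV (itw_dag KWV).
have := itw_comp KQP (KXY i).
set X' := X i *m Q; set Y' := Y i *m P => KXY'.
have XQ : X' *m Q = X' by rewrite /X' -mulmxA QQ.
have YP : Y' *m P = Y' by rewrite /Y' -mulmxA PP.
have WQ : W *m Q = 0 by rewrite /Q mulmxBr mulmx1 pisomE // subrr.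
have VP : V *m P = 0 by rewrite /P mulmxBr mulmx1 pisomE // subrr.
have QW : Q *m W^t* = 0 by rewrite -Qh -dagM WQ dag0.
have PV : P *m V^t* = 0 by rewrite -Ph -dagM VP dag0.
have [A [B [KAB [pA pB] [A0 B0] [[TA AE] [TB BE]] [[SA AE'] [SB BE']]]]] :=
  itw_polar (itw_comp KXY' (itw_dag KWV)).
have [A00 B00] : A = 0 /\ B = 0.
  apply: minp_commutant g0 Kmin KAB pA pB _ _.
    by rewrite {1}AE' AE -[X']XQ !mulmxA -(mulmxA _ Q (W^t*)) QW mulmx0 !mul0mx.
  by rewrite {1}BE' BE -[Y']YP !mulmxA -(mulmxA _ P (V^t*)) PV mulmx0 !mul0mx.
have WX0 := A0 A00; have VY0 := B0 B00.
have [E [F [KEF [pE pF] [E0 F0] [[TE EE] [TF FE]] [[SE EE'] [SF FE']]]]] :=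
  itw_polar KXY'.
have WE : W^t* *m E = 0 by rewrite EE mulmxA WX0 mul0mx.
have VF : V^t* *m F = 0 by rewrite FE mulmxA VY0 mul0mx.
have EW : E^t* *m W = 0 by rewrite -[LHS]trmxCK dagM trmxCK WE dag0.
have FV : F^t* *m V = 0 by rewrite -[LHS]trmxCK dagM trmxCK VF dag0.
have EQ : E *m Q = E by rewrite EE' -mulmxA XQ.
have FP : F *m P = F by rewrite FE' -mulmxA YP.
have EWW : E *m (W^t* *m W) = 0.
  by rewrite -[E]EQ mulmxA -(mulmxA E) QW mulmx0 mul0mx.
have FVV : F *m (V^t* *m V) = 0.
  by rewrite -[F]FP mulmxA -(mulmxA F) PV mulmx0 mul0mx.
have WEs : (W + E)^t* *m (W + E) = W^t* *m W + E^t* *m E.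
  by rewrite dagD mulmxDl !mulmxDr WE EW addr0 add0r.
have VFs : (V + F)^t* *m (V + F) = V^t* *m V + F^t* *m F.
  by rewrite dagD mulmxDl !mulmxDr VF FV addr0 add0r.
have oE : E^t* *m E *m (W^t* *m W) = 0 by rewrite -mulmxA EWW mulmx0.
have oE' : W^t* *m W *m (E^t* *m E) = 0.
  by have := congr1 (fun Z => Z^t*) oE; rewrite /= !dagM !trmxCK dag0.
have oF : F^t* *m F *m (V^t* *m V) = 0 by rewrite -mulmxA FVV mulmx0.
have oF' : V^t* *m V *m (F^t* *m F) = 0.
  by have := congr1 (fun Z => Z^t*) oF; rewrite /= !dagM !trmxCK dag0.
exists (W + E), (V + F); split.
- exact: itwD.
- by rewrite /pisom WEs mulmxDl !mulmxDr pW oE oE' pE addr0 add0r.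
- by rewrite /pisom VFs mulmxDl !mulmxDr pV oF oF' pF addr0 add0r.
rewrite WEs VFs.
have [leE eqE] := rank_add_proj pW pE oE' oE.
have [leF eqF] := rank_add_proj pV pF oF' oF.
rewrite ltnNge; apply/negP => le.
have rE : \rank (W^t* *m W) = \rank (W^t* *m W + E^t* *m E)%R.
  by apply/eqP; rewrite eqn_leq leE -(leq_add2r (\rank (V^t* *m V)))
    (leq_trans _ le) // leq_add2l.
have rF : \rank (V^t* *m V) = \rank (V^t* *m V + F^t* *m F)%R.
  by apply/eqP; rewrite eqn_leq leF -(leq_add2l (\rank (W^t* *m W)))
    (leq_trans _ le) // leq_add2r.
have /dag_mul_eq0/E0 X0 := eqE rE; have /dag_mul_eq0/F0 Y0 := eqF rF.
by move: XYi; rewrite -/X' -/Y' X0 Y0 !eqxx.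
Qed.

(** Extend the zero pair repeatedly: the sum of the ranks grows at each step and cannot exceed
    [a + b]. *)
Lemma minp_embedding : (0 < g)%N -> minp K ->
  (forall i, itw K M (X i) (Y i)) ->
  \sum_i (X i)^t* *m X i = 1%:M -> \sum_i (Y i)^t* *m Y i = 1%:M ->
  exists W V, [/\ itw K M W V, W^t* *m W = 1%:M & V^t* *m V = 1%:M].
Proof.
move=> g0 Kmin KXY X1 Y1.
have step k : (exists W V, [/\ itw K M W V, W^t* *m W = 1%:M & V^t* *m V =
  1%:M])
    \/ exists W V, [/\ itw K M W V, pisom W, pisom V
      & (k <= \rank (W^t* *m W) + \rank (V^t* *m V))%N].
  elim: k => [|k [IH|[W [V [KWV pW pV le]]]]]; [right | by left |].
    by exists 0, 0; split=> //; rewrite /pisom ?mulmx0 //; apply: itw0.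
  have [[W1 V1]|[W' [V' [KWV' pW' pV' lt]]]] := itw_extend g0 Kmin KXY X1 Y1
    KWV pW pV.
    by left; exists W, V.
  by right; exists W', V'; split=> //; apply: leq_ltn_trans lt.
have [//|[W [V [_ _ _]]]] := step (a + b).+1.
by rewrite ltnNge leq_add ?rank_leq_row.
Qed.

End Embedding.

(** The products [A_k X_i], [B_k Y_i] factor [K] through itself, hence intertwine it. Therefore [M_j
    Y_i = sum_k A_k^* K_j B_k Y_i = sum_k A_k^* A_k X_i K_j = X_i K_j]; the adjoint relation uses
    the minimality of [dagp K]. *)
Lemma kraus_intertwine a b c d n m (K : 'I_g -> 'M[C]_(a, b))
    (M : 'I_g -> 'M[C]_(c, d)) (A : 'I_n -> 'M[C]_(a, c)) (B : 'I_n ->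
      'M[C]_(b, d))
    (X : 'I_m -> 'M[C]_(c, a)) (Y : 'I_m -> 'M[C]_(d, b)) :
  archimedean_field C -> (0 < g)%N -> minp K ->
  (forall j, M j = \sum_i (A i)^t* *m K j *m B i) ->
  \sum_i (A i)^t* *m A i = 1%:M -> \sum_i (B i)^t* *m B i = 1%:M ->
  (forall j, K j = \sum_i (X i)^t* *m M j *m Y i) ->
  \sum_i (X i)^t* *m X i = 1%:M -> \sum_i (Y i)^t* *m Y i = 1%:M ->
  forall i, itw K M (X i) (Y i).
Proof.
move=> archC g0 Kmin MAB A1 B1 KXY X1 Y1.
pose I := ('I_m * 'I_n)%type.
pose E (k : 'I_#|{: I}|) := A (enum_val k).2 *m X (enum_val k).1.
pose F (k : 'I_#|{: I}|) := B (enum_val k).2 *m Y (enum_val k).1.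
have sumI r s (G : 'I_m -> 'I_n -> 'M[C]_(r, s)) :
    \sum_(k < #|{: I}|) G (enum_val k).1 (enum_val k).2 = \sum_i \sum_j G i j.
  rewrite pair_bigA /= [RHS](reindex (@enum_val _ [pred _ : I | true])) //.
  exact/onW_bij/enum_val_bij.
have KEF j : K j = \sum_i (E i)^t* *m K j *m F i.
  rewrite (sumI _ _ (fun i k => (A k *m X i)^t* *m K j *m (B k *m Y i))).
  rewrite {1}KXY; apply: eq_bigr => i _; rewrite MAB mulmx_sumr mulmx_suml.
  by apply: eq_bigr => k _; rewrite dagM !mulmxA.
have E1 : \sum_i (E i)^t* *m E i = 1%:M.
  rewrite (sumI _ _ (fun i k => (A k *m X i)^t* *m (A k *m X i))) -X1.
  apply: eq_bigr => i _; rewrite -[Z in _ = _ *m Z]mul1mx -A1 mulmx_suml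
    mulmx_sumr.
  by apply: eq_bigr => k _; rewrite dagM !mulmxA.
have F1 : \sum_i (F i)^t* *m F i = 1%:M.
  rewrite (sumI _ _ (fun i k => (B k *m Y i)^t* *m (B k *m Y i))) -Y1.
  apply: eq_bigr => i _; rewrite -[Z in _ = _ *m Z]mul1mx -B1 mulmx_suml
    mulmx_sumr.
  by apply: eq_bigr => k _; rewrite dagM !mulmxA.
have EF := minp_intertwine archC g0 Kmin KEF E1 F1.
have KEF' j : dagp K j = \sum_i (F i)^t* *m dagp K j *m E i.
  rewrite /dagp {1}KEF dag_sum; apply: eq_bigr => i _.
  by rewrite [LHS]dagM [Z in _ *m Z]dagM trmxCK mulmxA.
have FE := minp_intertwine archC g0 (minp_adj Kmin) KEF' F1 E1.
move=> i j; split.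
  rewrite MAB mulmx_suml -[X i]mul1mx -A1 !mulmx_suml; apply: eq_bigr => k _.
  have := EF (enum_rank (i, k)) j; rewrite /E /F enum_rankK /= => h.
  by rewrite -!mulmxA h !mulmxA.
have -> : (M j)^t* = \sum_k (B k)^t* *m (K j)^t* *m A k.
  by rewrite MAB dag_sum; apply: eq_bigr => k _; rewrite !dagM trmxCK mulmxA.
rewrite mulmx_suml -[Y i]mul1mx -B1 !mulmx_suml; apply: eq_bigr => k _.
have := FE (enum_rank (i, k)) j; rewrite /E /F enum_rankK /= => h.
by rewrite -!mulmxA -[(K j)^t*]/(dagp K j) h !mulmxA.
Qed.

(** [V] is unitary, so the stacked matrix has the same [nsq] as its product with [V], which is
    [W K_j], hence as [K_j]: nothing is left for [T]. *)
Lemma summand_col_eq0 a b c (K : 'I_g -> 'M[C]_(a, b)) (T : 'I_g -> 'M[C]_(c,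
  b))
    W V : itw K (fun j => col_mx (K j) (T j)) W V ->
  W^t* *m W = 1%:M -> V *m V^t* = 1%:M -> forall j, T j = 0.
Proof.
move=> WV W1 V1 j; have [h _] := WV j; have V1' := mulmx1C V1.
have : nsq (col_mx (K j) (T j)) = nsq (K j).
  by rewrite -[LHS](nsq_unitr _ V1) h nsq_unitl.
rewrite nsq_col_mx -[RHS]addr0 => /addrI/eqP; rewrite nsq_eq0 => /eqP//.
Qed.

End MinimalPencils.

Section Summands.
Context (R : realType) (g : nat).
Local Notation C := (Cplx R).

Lemma minp_summand a b c d (K : 'I_g -> 'M[C]_(a, b)) (M : 'I_g -> 'M[C]_(c,
  d)) :
  (0 < g)%N -> minp K -> dom K M -> dom M K ->
  exists W V, [/\ itw K M W V, W^t* *m W = 1%:M & V^t* *m V = 1%:M].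
Proof.
move=> g0 Kmin KM MK.
have K0 := Kmin.1; have [a0 b0] := nondeg_gt0 g0 K0.
have M0 := nondeg_dom (@Cplx_archimedean R) KM K0.
have [c0 d0] := nondeg_gt0 g0 M0.
have [n [A [B [MAB A1 B1]]]] := kraus_of_dom a0 b0 MK.
have [m [X [Y [KXY X1 Y1]]]] := kraus_of_dom c0 d0 KM.
apply: (minp_embedding g0 Kmin _ X1 Y1) => i.
exact: (kraus_intertwine (@Cplx_archimedean R) g0 Kmin MAB A1 B1 KXY X1 Y1).
Qed.

Lemma minp_col a b c (K : 'I_g -> 'M[C]_(a, b)) (T : 'I_g -> 'M[C]_(c, b)) :
  (0 < g)%N -> minp K -> dom (fun j => col_mx (K j) (T j)) K -> forall j, T j =
    0.
Proof.
move=> g0 Kmin MK j; set M := fun j => col_mx (K j) (T j) in MK.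
have KM : dom K M.
  have KE : K = (fun j => row_mx 1%:M 0 *m M j).
    by apply: funext => k; rewrite mul_row_col mul1mx mul0mx addr0.
  rewrite [X in dom X _]KE; apply: dom_mull.
  by rewrite tr_row_mx map_col_mx mul_row_col dag1 mulmx1 mul0mx addr0.
(* [K] and [M] have the same number of columns, so the isometry [V] is square, hence unitary. *)
have [W [V [WV W1 /mulmx1C V1]]] := minp_summand g0 Kmin KM MK.
exact: (summand_col_eq0 WV W1 V1).
Qed.

Lemma minp_row a b c (K : 'I_g -> 'M[C]_(a, b)) (T : 'I_g -> 'M[C]_(a, c)) :
  (0 < g)%N -> minp K -> dom (fun j => row_mx (K j) (T j)) K -> forall j, T j =
    0.
Proof.
move=> g0 /minp_adj Kmin MK j; rewrite -[T j]trmxCK.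
rewrite [X in X^t*](_ : _ = dagp T j) // (minp_col g0 Kmin) ?dag0 //.
by rewrite -dagp_row_mx; apply: dom_adj.
Qed.

End Summands.

(** * Nilpotent evaluations *)

Section NilpotentPaths.
Context (C : numClosedFieldType) (g : nat).

(* Products in the reverse order of the letters: the transpose of the value of
   the word [w] at the transposed tuple. *)
Definition tev n (Z : 'I_g -> 'M[C]_n) (w : seq 'I_g) : 'M[C]_n :=
  foldr (fun j A => A *m Z j) 1%:M w.

(** The series [h] cut at length [N], acting on a vector written as a matrix, as in [pv]. *)
Definition sev c d N n (h : seq 'I_g -> 'M[C]_(c, d)) (Z : 'I_g -> 'M[C]_n)
    (y : 'M[C]_(d, n)) : 'M[C]_(c, n) :=
  \sum_(m < N) \sum_(w : m.-tuple 'I_g) h w *m y *m tev Z w.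

Definition scontr a b (L : 'I_g -> 'M[C]_(a, b)) n m (Z : 'I_g -> 'M[C]_(n, m))
    (rho : C) : Prop := forall y, nsq (pv L Z y) <= rho ^+ 2 * nsq y.

(** The algebraic content of mapping the ball into a ball: at nilpotent points the series is a
    finite sum, so no convergence is involved. *)
Definition nilcontr a b (L : 'I_g -> 'M[C]_(a, b)) c d
    (h : seq 'I_g -> 'M[C]_(c, d)) : Prop :=
  forall n (Z : 'I_g -> 'M[C]_n) N rho, 0 <= rho -> rho < 1 ->
    (forall w, (N <= size w)%N -> tev Z w = 0) -> scontr L Z rho ->
    forall y, nsq (sev N h Z y) <= nsq y.

Section Path.
Context (n k : nat).

Definition path_dim := (k.+1 * n)%N.

(** The projection to the copy number [s] among [k + 1] copies of the [n]-dimensional space. With a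
    natural number as index it vanishes beyond [k], which is where a path ends. *)
Definition slot (s : nat) : 'M[C]_(n, path_dim) :=
  \matrix_(i, c) (((mxtens_unindex c).1 == s :> nat) &&
                  ((mxtens_unindex c).2 == i))%:R.

Lemma sum_slots (F : 'I_path_dim -> C) :
  \sum_c F c = \sum_(s < k.+1) \sum_(i < n) F (mxtens_index (s, i)).
Proof.
rewrite pair_bigA /= (reindex (@mxtens_index k.+1 n)) /=; last first.
  exists (@mxtens_unindex k.+1 n) => x _; [exact: mxtens_indexK | exact:
    mxtens_unindexK].
by apply: eq_bigr => -[s i] _.
Qed.

Lemma slotM s t : (s <= k)%N -> slot s *m (slot t)^t* = if s == t then 1%:M
  else 0.
Proof.
move=> sk; apply/matrixP => i j.
have -> : (if s == t then 1%:M else 0 : 'M[C]_n) i j = ((s == t) && (i ==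
  j))%:R.
  by case: eqP => _; rewrite mxE.
rewrite !mxE sum_slots.
have sk' : (s < k.+1)%N by [].
rewrite (bigD1 (Ordinal sk')) //= [X in _ + X]big1 ?addr0; last first.
  move=> s' ss'; rewrite big1 // => i' _; rewrite !mxE mxtens_indexK /=.
  by rewrite -val_eqE /= in ss'; rewrite (negbTE ss') mul0r.
rewrite (bigD1 i) //= big1 ?addr0; last first.
  by move=> i' ii'; rewrite !mxE mxtens_indexK /= (negbTE ii') andbF mul0r.
by rewrite !mxE mxtens_indexK /= !eqxx mul1r rmorph_nat.
Qed.

Lemma slot0 s : (k < s)%N -> slot s = 0.
Proof.
move=> ks; apply/matrixP => i c; rewrite !mxE.
by case: eqP => [E|//]; have := ltn_ord (mxtens_unindex c).1; rewrite E ltnS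
  leqNgt ks.
Qed.

Lemma slot1 : \sum_(s < k.+1) (slot s)^t* *m slot s = 1%:M.
Proof.
apply/matrixP => c c'; rewrite summxE mxE.
rewrite (bigD1 (mxtens_unindex c).1) //= big1 ?addr0; last first.
  move=> s sc; rewrite mxE big1 // => i _; rewrite !mxE.
  by rewrite -val_eqE eq_sym /= in sc; rewrite (negbTE sc) conjC0 mul0r.
rewrite mxE (bigD1 (mxtens_unindex c).2) //= big1 ?addr0; last first.
  move=> i; rewrite eq_sym => /negbTE ic.
  by rewrite !mxE ic andbF conjC0 mul0r.
rewrite !mxE !eqxx conjC1 mul1r; congr (_%:R); congr (nat_of_bool _).
rewrite [RHS]eq_sym -(inj_eq (can_inj (@mxtens_unindexK k.+1 n))).
by rewrite -pair_eqE.
Qed.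

Lemma nsq_slots b (y : 'M[C]_(b, path_dim)) :
  nsq y = \sum_(s < k.+1) nsq (y *m (slot s)^t*).
Proof.
rewrite {1}/nsq -[X in hip _ X]mulmx1 -slot1 mulmx_sumr hip_sumr.
by apply: eq_bigr => s _; rewrite mulmxA hip_mulr'.
Qed.

Context (B : nat -> 'I_g -> 'M[C]_n).

(* [path_tuple] moves slot [s] to slot [s.+1] by [B s], so that [path_word s w]
   is the action of the word [w] on slot [s]. *)
Definition path_tuple (j : 'I_g) : 'M[C]_path_dim :=
  \sum_(s < k) (slot s)^t* *m B s j *m slot s.+1.

Fixpoint path_word (s : nat) (w : seq 'I_g) : 'M[C]_n :=
  if w is j :: w' then path_word s w' *m B (s + size w') j else 1%:M.

Lemma slot_path s j : slot s *m path_tuple j = B s j *m slot s.+1.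
Proof.
have [sk|ks] := ltnP s k; last first.
  rewrite (@slot0 s.+1) // mulmx0 /path_tuple mulmx_sumr big1 // => t _.
  have [ks'|ks'] := eqVneq k s; last by rewrite slot0 ?mul0mx // ltn_neqAle ks'
    ks.
  by rewrite !mulmxA slotM -?ks' // gtn_eqF ?ltn_ord //= !mul0mx.
rewrite /path_tuple mulmx_sumr (bigD1 (Ordinal sk)) //= big1 ?addr0.
  by rewrite !mulmxA (slotM _ (ltnW sk)) eqxx mul1mx.
move=> t; rewrite -val_eqE /= eq_sym => /negbTE ts.
by rewrite !mulmxA (slotM _ (ltnW sk)) ts !mul0mx.
Qed.

Lemma path_slot t j : (t < k)%N ->
  path_tuple j *m (slot t.+1)^t* = (slot t)^t* *m B t j.
Proof.
move=> tk; rewrite /path_tuple mulmx_suml (bigD1 (Ordinal tk)) //= big1 ?addr0.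
  by rewrite -mulmxA slotM // eqxx mulmx1.
move=> s st; rewrite -mulmxA slotM // eqSS.
by rewrite -val_eqE /= in st; rewrite (negbTE st) mulmx0.
Qed.

Lemma slot_word s w : slot s *m tev path_tuple w = path_word s w *m slot (s +
  size w).
Proof.
elim: w => [|j w IH] /=; first by rewrite mulmx1 mul1mx addn0.
by rewrite mulmxA IH -mulmxA slot_path mulmxA addnS.
Qed.

Lemma path_nil w : (k < size w)%N -> tev path_tuple w = 0.
Proof.
move=> kw; rewrite -[LHS]mul1mx -slot1 mulmx_suml big1 // => s _.
by rewrite -mulmxA slot_word (@slot0 (s + size w)) ?mulmx0 // ltn_addl.
Qed.

(** A weighted shift: slot [t + 1] of the output depends only on slot [t] of the input, so the
    bounds on the single steps add up orthogonally. *)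
Lemma path_scontr a b (L : 'I_g -> 'M[C]_(a, b)) rho : 0 <= rho ^+ 2 ->
  (forall s, scontr L (B s) rho) -> scontr L path_tuple rho.
Proof.
move=> rho0 LB y.
have comp t : (t < k)%N ->
    pv L path_tuple y *m (slot t.+1)^t* = pv L (B t) (y *m (slot t)^t*).
  move=> tk; rewrite /pv mulmx_suml; apply: eq_bigr => j _.
  by rewrite -mulmxA path_slot // !mulmxA.
have comp0 : pv L path_tuple y *m (slot 0)^t* = 0.
  rewrite /pv mulmx_suml big1 // => j _; rewrite -mulmxA /path_tuple mulmx_suml.
  by rewrite big1 ?mulmx0 // => s _; rewrite -mulmxA slotM // ?ltn_ord //=
    mulmx0.
rewrite (nsq_slots (pv _ _ _)) big_ord_recl comp0 nsq0 add0r.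
apply: le_trans (_ : \sum_(s < k) rho ^+ 2 * nsq (y *m (slot s)^t*) <= _).
  by apply: ler_sum => s _; rewrite lift0 comp //; apply: LB.
rewrite -mulr_sumr ler_wpM2l //.
by rewrite (nsq_slots y) big_ord_recr /= lerDl nsq_ge0.
Qed.

(** Only words of length [t] lead from slot [s] to slot [s + t]. *)
Lemma sev_slot c d (h : seq 'I_g -> 'M[C]_(c, d)) s t (y : 'M[C]_(d, n)) :
  (s + t <= k)%N ->
  sev k.+1 h path_tuple (y *m slot s) *m (slot (s + t))^t* =
  \sum_(w : t.-tuple 'I_g) h w *m y *m path_word s w.
Proof.
move=> stk; rewrite /sev mulmx_suml.
have tk : (t < k.+1)%N by rewrite ltnS (leq_trans _ stk) // leq_addl.
have term (m : 'I_k.+1) (w : m.-tuple 'I_g) :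
    h w *m (y *m slot s) *m tev path_tuple w *m (slot (s + t))^t* =
    h w *m y *m path_word s w *m (slot (s + m) *m (slot (s + t))^t*).
  rewrite -!mulmxA; congr (_ *m (_ *m _)).
  by rewrite !mulmxA slot_word size_tuple.
rewrite (bigD1 (Ordinal tk)) //= [X in _ + X]big1 ?addr0; last first.
  move=> m mt; rewrite mulmx_suml big1 // => w _; rewrite term.
  have [smk|smk] := leqP (s + m) k; last by rewrite slot0 // mul0mx mulmx0.
  by rewrite slotM // eqn_add2l -[m == t :> nat]/(m == Ordinal tk) (negbTE mt)
    mulmx0.
rewrite mulmx_suml; apply: eq_bigr => w _.
by rewrite (@term (Ordinal tk) w) /= slotM // eqxx mulmx1.
Qed.

End Path.

End NilpotentPaths.

(** * Domination of coefficients through nilpotent paths *)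

Section NilpotentDomination.
Context (C : numClosedFieldType) (g : nat).

Lemma sum_tuple_rcons (V : nmodType) k (F : seq 'I_g -> V) :
  \sum_(w : k.+1.-tuple 'I_g) F w = \sum_(v : k.-tuple 'I_g) \sum_j F (rcons v
    j).
Proof.
pose f (p : k.-tuple 'I_g * 'I_g) : k.+1.-tuple 'I_g := [tuple of rcons p.1
  p.2].
rewrite pair_bigA (reindex f) //=; apply/onW_bij/inj_card_bij.
  move=> [v j] [v' j'] /(congr1 val) /= /eqP; rewrite eqseq_rcons => /andP[/eqP
    vv /eqP ->].
  by congr (_, _); apply: val_inj.
by rewrite card_prod !card_tuple card_ord expnSr.
Qed.

Lemma sum_tuple_cons (V : nmodType) k (F : seq 'I_g -> V) :
  \sum_(w : k.+1.-tuple 'I_g) F w = \sum_(v : k.-tuple 'I_g) \sum_j F (j :: v).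
Proof.
pose f (p : k.-tuple 'I_g * 'I_g) : k.+1.-tuple 'I_g := [tuple of p.2 :: p.1].
rewrite pair_bigA (reindex f) //=; apply/onW_bij/inj_card_bij.
  move=> [v j] [v' j'] /(congr1 val) /= [-> vv].
  by congr (_, _); apply: val_inj.
by rewrite card_prod !card_tuple card_ord expnSr.
Qed.

Lemma path_word_cat n (B : nat -> 'I_g -> 'M[C]_n) s v w :
  path_word B s (v ++ w) = path_word B s w *m path_word B (s + size w) v.
Proof.
elim: v => [|j v IH] /=; first by rewrite mulmx1.
by rewrite IH mulmxA size_cat [(size v + _)%N]addnC addnA.
Qed.

(** Each step admits a single letter, so only a suffix of [u] survives. The index counts from the
    end because the last letter of a word acts at the first step. *)
Lemma path_word_letters n (B : nat -> 'I_g -> 'M[C]_n) (o : nat) (u : seq 'I_g)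
  j0 e :
  (forall i j, (i < size u)%N ->
     B (o + i)%N j = (e *+ (j == nth j0 u (size u - i.+1)))%:M) ->
  forall v, (size v <= size u)%N ->
  path_word B o v = (e ^+ size v *+ (v == drop (size u - size v) u))%:M.
Proof.
move=> HB; elim=> [_|j v IH /= vu]; first by rewrite /= subn0 drop_size eqxx.
rewrite (IH (ltnW vu)) HB // -scalar_mxM exprSr; congr (_%:M).
have E : drop (size u - (size v).+1) u =
    nth j0 u (size u - (size v).+1) :: drop (size u - size v) u.
  rewrite (drop_nth j0) ?ltn_subrL // ?(leq_ltn_trans _ vu) //.
  by rewrite subnSK.
by rewrite E eqseq_cons mulrnAl mulrnAr -mulrnA mulnb.
Qed.

Lemma sum_letters c d n (h : seq 'I_g -> 'M[C]_(c, d)) (B : nat -> 'I_g ->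
  'M[C]_n) s
    (y : 'M[C]_(d, n)) :
  \sum_(w : 1.-tuple 'I_g) h w *m y *m path_word B s w =
  pv (fun j => h [:: j]) (B s) y.
Proof.
rewrite (sum_tuple_cons _ (fun w => h w *m y *m path_word B s w)).
rewrite (big_pred1 [tuple]) => [|v]; last first.
  by apply/esym/eqP/val_inj/size0nil/size_tuple.
by apply: eq_bigr => j _; rewrite /= mul1mx addn0.
Qed.

Lemma pv_col_mx a b c n m (K : 'I_g -> 'M[C]_(a, b)) (T : 'I_g -> 'M[C]_(c, b))
    (X : 'I_g -> 'M[C]_(n, m)) y :
  pv (fun j => col_mx (K j) (T j)) X y = col_mx (pv K X y) (pv T X y).
Proof.
rewrite /pv; elim/big_rec3: _ => [|j A B D _ ->]; first by rewrite col_mx0.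
by rewrite mul_col_mx mul_col_mx add_col_mx.
Qed.

Lemma pv_row_mx a b c n m (K : 'I_g -> 'M[C]_(a, b)) (T : 'I_g -> 'M[C]_(a, c))
    (X : 'I_g -> 'M[C]_(n, m)) y z :
  pv (fun j => row_mx (K j) (T j)) X (col_mx y z) = pv K X y + pv T X z.
Proof.
rewrite /pv -big_split; apply: eq_bigr => j _.
by rewrite mul_row_col mulmxDl.
Qed.

Section Lifts.
Context (a b c d : nat) (L : 'I_g -> 'M[C]_(a, b)) (h : seq 'I_g -> 'M[C]_(c,
  d)).
Context (hL : nilcontr L h).

(** Input in slot 0, output read in slots 1 and [k], which [1 < k] keeps distinct: the two squared
    norms add. *)
Lemma nilcontr_col n k (B : nat -> 'I_g -> 'M[C]_n) rho y : 0 <= rho -> rho < 1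
  ->
  (forall s, scontr L (B s) rho) -> (1 < k)%N ->
  nsq (pv (fun j => h [:: j]) (B 0%N) y) +
  nsq (\sum_(w : k.-tuple 'I_g) h w *m y *m path_word B 0 w) <= nsq y.
Proof.
move=> r0 r1 LB k1.
have s1 : slot C n k 0 *m (slot C n k 0)^t* = 1%:M by rewrite slotM.
have LZ : scontr L (path_tuple k B) rho by apply: path_scontr; rewrite
  ?exprn_ge0.
have := hL r0 r1 (@path_nil _ _ n k B) LZ (y *m slot C n k 0).
rewrite (nsq_unitr _ s1); apply: le_trans.
have k1' : (1 < k.+1)%N by exact: ltnW.
rewrite (nsq_slots (sev _ _ _ _)) (bigD1 (Ordinal k1')) //= (bigD1 ord_max) /=;
  last first.
  by rewrite -val_eqE /= gtn_eqF.
have -> := sev_slot B h (s := 0) (t := 1) y (ltnW k1).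
have -> := sev_slot B h (s := 0) (t := k) y (leqnn _).
rewrite sum_letters addrA lerDl sumr_ge0 // => s _; exact: nsq_ge0.
Qed.

(** Inputs in slots [k] and 0 of a path of length [k + 1], output read in the last slot: [y] has one
    step left, [z] all of them. *)
Lemma nilcontr_row n k (B : nat -> 'I_g -> 'M[C]_n) rho y z : 0 <= rho -> rho <
  1 ->
  (forall s, scontr L (B s) rho) -> (0 < k)%N ->
  nsq (pv (fun j => h [:: j]) (B k) y +
       \sum_(w : k.+1.-tuple 'I_g) h w *m z *m path_word B 0 w) <= nsq y + nsq
         z.
Proof.
move=> r0 r1 LB k0.
have LZ : scontr L (path_tuple k.+1 B) rho by apply: path_scontr; rewrite
  ?exprn_ge0.
have := hL r0 r1 (@path_nil _ _ n k.+1 B) LZ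
  (y *m slot C n k.+1 k + z *m slot C n k.+1 0).
have -> : nsq (y *m slot C n k.+1 k + z *m slot C n k.+1 0) = nsq y + nsq z.
  rewrite nsqD !nsq_unitr ?slotM ?eqxx //.
  rewrite !hip_mulr -!mulmxA !slotM // eq_sym [k == _]gtn_eqF // !mulmx0 !hip0r.
  by rewrite !addr0.
apply: le_trans; rewrite (nsq_slots (sev _ _ _ _)) big_ord_recr /=.
have -> : forall y z, sev k.+2 h (path_tuple k.+1 B) (y + z) =
   sev k.+2 h (path_tuple k.+1 B) y + sev k.+2 h (path_tuple k.+1 B) z.
  move=> y1 z1; rewrite /sev -big_split; apply: eq_bigr => m _ /=.
  by rewrite -big_split; apply: eq_bigr => w _ /=; rewrite mulmxDr mulmxDl.
have E1 : sev k.+2 h (path_tuple k.+1 B) (y *m slot C n k.+1 k) *m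
    (slot C n k.+1 k.+1)^t* = pv (fun j => h [:: j]) (B k) y.
  have := @sev_slot _ _ n k.+1 B _ _ h k 1 y.
  by rewrite addn1 sum_letters; apply.
rewrite mulmxDl E1; have -> := sev_slot B h (s := 0) (t := k.+1) z (leqnn _).
rewrite lerDr sumr_ge0 // => s _; exact: nsq_ge0.
Qed.

(** Nilpotent evaluations are available at radius [rho < 1]; the loss vanishes for
    [rho = 1 - 1 / (k + 2)]. The lower bound 1/2 on [rho] leaves room for the scalar steps of
    [small_letters]. *)
Lemma dom_lim a' b' (K : 'I_g -> 'M[C]_(a', b')) : archimedean_field C ->
  (forall n (X : 'I_g -> 'M[C]_n) rho y, 2^-1 <= rho -> rho < 1 -> contr L X ->
     nsq (pv K (fun j => rho *: X j) y) <= nsq y) ->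
  dom K L.
Proof.
move=> archC H n X LX y.
have y0 := nsq_ge0 y; have z0 := nsq_ge0 (pv K X y).
have bnd k : nsq (pv K X y) *+ k.+2 <= nsq y *+ k.+2 + nsq (pv K X y) *+ 2.
  pose q : C := k.+2%:R^-1; pose rho : C := 1 - q.
  have q0 : 0 < q by rewrite invr_gt0 ltr0Sn.
  have q2 : q <= 2^-1 by rewrite lef_pV2 ?posrE ?ltr0Sn // ler_nat.
  have r1 : rho < 1 by rewrite gtrBl.
  have r2 : 2^-1 <= rho by rewrite lerBrDr -lerBrDl (le_trans q2) // le_eqVlt;
    apply/orP; left; apply/eqP; field.
  have := H n X rho y r2 r1 LX; rewrite pvZX nsqZ ger0_norm; last first.
    by apply: le_trans r2; rewrite invr_ge0 ler0n.
  move: z0; set z := nsq (pv K X y) => z0 le.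
  have le2 : (1 - q *+ 2) * z <= nsq y.
    apply: le_trans le; rewrite ler_wpM2r // -subr_ge0.
    have -> : rho ^+ 2 - (1 - q *+ 2) = q ^+ 2 by rewrite /rho; ring.
    by rewrite exprn_ge0 // ltW.
  have := ler_wpM2l (ler0n _ k.+2) le2.
  have qk : k.+2%:R * q = 1 by rewrite mulfV // pnatr_eq0.
  have -> : k.+2%:R * ((1 - q *+ 2) * z) = z *+ k.+2 - z *+ 2.
    rewrite -(mulr_natl z k.+2); move: (k.+2%:R) qk => kk qk.
    by transitivity (kk * z - kk * q * (z *+ 2)); [ring | rewrite qk mul1r].
  by rewrite mulr_natl lerBlDr.
apply: (@arch_le _ _ _ (nsq (pv K X y) *+ 2) archC) => -[|[|k]] //.
  by rewrite !mulr0n add0r mulrn_wge0.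
by rewrite !mulr1n mulr2n addrA lerDr addr_ge0.
Qed.

(** With an integer [k] above every [b * nsq (L j)], the weight [e = 1 / (2 k)] gives
    [e^2 k <= 1/4], whatever the size [n] and the letter. *)
Lemma small_letters : archimedean_field C ->
  exists2 e : C, 0 < e & forall n c0,
    scontr L (fun j => (e *+ (j == c0))%:M : 'M[C]_n) 2^-1.
Proof.
move=> archC; pose ka : C := \sum_j b%:R * nsq (L j).
have kaj j : b%:R * nsq (L j) <= ka.
  rewrite /ka (bigD1 j) //= lerDl sumr_ge0 // => i _.
  by rewrite mulr_ge0 ?nsq_ge0.
have ka0 : 0 <= ka by rewrite sumr_ge0 // => j _; rewrite mulr_ge0 ?nsq_ge0.
have [k kak] := archC _ ka0.
have k0 : 0 < k%:R :> C by apply: le_lt_trans kak.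
pose e : C := (2 * k%:R)^-1.
have e0 : 0 < e by rewrite invr_gt0 mulr_gt0.
exists e => // n c0 y.
have -> : pv L (fun j => (e *+ (j == c0))%:M) y = e *: (L c0 *m y).
  rewrite /pv (bigD1 c0) //= big1 ?addr0 => [|j /negbTE ->].
    by rewrite eqxx mul_mx_scalar.
  by rewrite mulr0n mul_mx_scalar scale0r.
rewrite nsqZ (ger0_norm (ltW e0)); apply: le_trans (_ : e ^+ 2 * (ka * nsq y)
  <= _).
  rewrite ler_wpM2l ?exprn_ge0 ?(ltW e0) // (le_trans (nsq_mul _ _)) //.
  by rewrite ler_wpM2r ?nsq_ge0.
rewrite mulrA ler_wpM2r ?nsq_ge0 //.
apply: le_trans (_ : e ^+ 2 * k%:R ^+ 2 <= _).
  rewrite ler_wpM2l ?exprn_ge0 ?(ltW e0) // (le_trans (ltW kak)) //.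
  rewrite -natrX ler_nat; case: (k) => // k'; by rewrite expnS expn1 leq_pmulr.
by rewrite /e -exprMn invfM mulfVK ?gt_eqF.
Qed.

(** The path starts with the step [rho X] and then spells [u] with weight [e]. Slot 1 receives the
    linear part; only the words [rcons u j] reach the last slot, with the factor [e ^+ size u]. *)
Lemma nilcontr_dom_col (u : seq 'I_g) : archimedean_field C -> (0 < size u)%N ->
  exists2 de : C, de != 0 &
    dom (fun j => col_mx (h [:: j]) (de *: h (rcons u j))) L.
Proof.
move=> archC u0; have [e e0 He] := small_letters archC.
exists (e ^+ size u); first by rewrite expf_neq0 // gt_eqF.
have j0 : 'I_g by case: (u) u0.
apply: dom_lim => // n X rho y r2 r1 LX.
have r0 : 0 <= rho by apply: le_trans r2; rewrite invr_ge0 ler0n.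
pose B s j : 'M[C]_n := if s is s'.+1 then
  (e *+ (j == nth j0 u (size u - s'.+1)))%:M else rho *: X j.
have LB s : scontr L (B s) rho.
  case: s => [|s] z /=.
    by rewrite pvZX nsqZ ger0_norm // ler_wpM2l ?exprn_ge0.
  apply: le_trans (He _ _ _) _; rewrite ler_wpM2r ?nsq_ge0 //.
  by rewrite lerXn2r // nnegrE // invr_ge0 ler0n.
have := nilcontr_col y r0 r1 LB (_ : (1 < (size u).+1)%N) => /(_ u0).
have -> : \sum_(w : (size u).+1.-tuple 'I_g) h w *m y *m path_word B 0 w =
    pv (fun j => e ^+ size u *: h (rcons u j)) (B 0%N) y.
  rewrite (sum_tuple_rcons _ (fun w => h w *m y *m path_word B 0 w)).
  have PB v : (size v <= size u)%N -> path_word B 1 v =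
      (e ^+ size v *+ (v == drop (size u - size v) u))%:M.
    by apply: (path_word_letters (j0 := j0)) => i j iu; rewrite add1n.
  rewrite (bigD1 (in_tuple u)) //= [X in _ + X]big1 ?addr0 => [|v vu].
    apply: eq_bigr => j _; rewrite -cats1 path_word_cat /= PB // subnn drop0
      eqxx.
    by rewrite mul1mx mul_mx_scalar -!scalemxAl -!scalemxAr.
  rewrite big1 // => j _; rewrite -cats1 path_word_cat /= PB ?size_tuple //.
  rewrite subnn drop0 (_ : (_ == u) = false) ?mulr0n ?mul_mx_scalar ?scale0r
    ?mulmx0 //.
  by apply: contraNF vu => /eqP vu; apply/eqP/val_inj.
by rewrite -nsq_col_mx; congr (nsq _ <= _); rewrite pv_col_mx.
Qed.

(** The mirror path spells [u] and ends with the step [rho X]. The input [y] enters just before that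
    step; [z] enters at slot 0 and reaches the end only through words [j :: u]. *)
Lemma nilcontr_dom_row (u : seq 'I_g) : archimedean_field C -> (0 < size u)%N ->
  exists2 de : C, de != 0 &
    dom (fun j => row_mx (h [:: j]) (de *: h (j :: u))) L.
Proof.
move=> archC u0; have [e e0 He] := small_letters archC.
exists (e ^+ size u); first by rewrite expf_neq0 // gt_eqF.
have j0 : 'I_g by case: (u) u0.
apply: dom_lim => // n X rho yz r2 r1 LX.
have r0 : 0 <= rho by apply: le_trans r2; rewrite invr_ge0 ler0n.
pose B s j : 'M[C]_n := if s == size u then rho *: X j else
  (e *+ (j == nth j0 u (size u - s.+1)))%:M.
have LB s : scontr L (B s) rho.
  rewrite /B; case: eqP => _ z.
    by rewrite pvZX nsqZ ger0_norm // ler_wpM2l ?exprn_ge0.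
  apply: le_trans (He _ _ _) _; rewrite ler_wpM2r ?nsq_ge0 //.
  by rewrite lerXn2r // nnegrE // invr_ge0 ler0n.
rewrite -[yz]vsubmxK; set y := usubmx yz; set z := dsubmx yz.
have := nilcontr_row y z r0 r1 LB u0.
have Bu : B (size u) = fun j => rho *: X j by apply: funext => j; rewrite /B
  eqxx.
have -> : \sum_(w : (size u).+1.-tuple 'I_g) h w *m z *m path_word B 0 w =
    pv (fun j => e ^+ size u *: h (j :: u)) (B (size u)) z.
  rewrite (sum_tuple_cons _ (fun w => h w *m z *m path_word B 0 w)).
  have PB v : (size v <= size u)%N -> path_word B 0 v =
      (e ^+ size v *+ (v == drop (size u - size v) u))%:M.
    by apply: (path_word_letters (j0 := j0)) => i j iu; rewrite /B add0n
      ltn_eqF.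
  rewrite (bigD1 (in_tuple u)) //= [X in _ + X]big1 ?addr0 => [|v vu].
    apply: eq_bigr => j _; rewrite PB // subnn drop0 eqxx.
    by rewrite mulr1n mul_scalar_mx -!scalemxAl -!scalemxAr.
  rewrite big1 // => j _; rewrite PB ?size_tuple //.
  rewrite subnn drop0 (_ : (_ == u) = false) ?mulr0n ?mul_scalar_mx ?scale0r
    ?mulmx0 //.
  by apply: contraNF vu => /eqP vu; apply/eqP/val_inj.
by rewrite Bu -nsq_col_mx -pv_row_mx.
Qed.

End Lifts.

End NilpotentDomination.

(** * Operator norms and power series *)

Section OperatorNorm.
Context (R : realType).
Local Notation C := (Cplx R).

Definition vecm b n (y : 'M[C]_(b, n)) : 'cV[C]_(b * n) :=
  \col_k y (mxtens_unindex k).1 (mxtens_unindex k).2.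

Lemma vecm_surj b n (v : 'cV[C]_(b * n)) : exists y, v = vecm y.
Proof.
exists (\matrix_(i, j) v (mxtens_index (i, j)) 0).
apply/matrixP => k o; rewrite !mxE !ord1; case: (mxtens_indexP k) => i j.
by rewrite mxtens_indexK.
Qed.

Lemma vecm_inj b n : injective (@vecm b n).
Proof.
move=> y z /matrixP yz; apply/matrixP => i j.
by have := yz (mxtens_index (i, j)) 0; rewrite !mxE mxtens_indexK.
Qed.

Lemma sum_mxtens (V : nmodType) m n (F : 'I_(m * n) -> V) :
  \sum_k F k = \sum_i \sum_j F (mxtens_index (i, j)).
Proof.
rewrite pair_bigA /= (reindex (@mxtens_index m n)) /=; last first.
  exists (@mxtens_unindex m n) => x _; [exact: mxtens_indexK | exact:
    mxtens_unindexK].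
by apply: eq_bigr => -[s i] _.
Qed.

Lemma nsq_vecm b n (y : 'M[C]_(b, n)) : nsq (vecm y) = nsq y.
Proof.
rewrite !nsqE sum_mxtens; apply: eq_bigr => i _; apply: eq_bigr => j _.
by rewrite big_ord1 mxE mxtens_indexK.
Qed.

(** The origin of the transposes: a Kronecker product acts on the matrix of a vector by
    [y |-> A y X^T]. *)
Lemma tens_vecm a b m n (A : 'M[C]_(a, b)) (X : 'M[C]_(m, n)) y :
  (A *t X) *m vecm y = vecm (A *m y *m X^T).
Proof.
apply/matrixP => k o; rewrite mxE sum_mxtens.
case: (mxtens_indexP k) => i j; rewrite mxE mxtens_indexK mxE /= exchange_big.
apply: eq_bigr => l _; rewrite mxE mulr_suml; apply: eq_bigr => l' _.
by rewrite tensmxE !mxE mxtens_indexK mulrAC.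
Qed.

Lemma vecm_sum (I : Type) (r : seq I) (P : pred I) b n (F : I -> 'M[C]_(b, n)) :
  vecm (\sum_(i <- r | P i) F i) = \sum_(i <- r | P i) vecm (F i).
Proof.
by apply/matrixP => k o; rewrite mxE !summxE; apply: eq_bigr => i _; rewrite
  mxE.
Qed.

Definition trt g n m (X : 'I_g -> 'M[C]_(n, m)) : 'I_g -> 'M[C]_(m, n) :=
  fun j => (X j)^T.

Lemma pencil_vecm g a b n (L : pencil R g a b) (X : mxtuple R g n) y :
  pencil_eval L X *m vecm y = vecm (pv L (trt X) y).
Proof.
rewrite /pencil_eval mulmx_suml /pv vecm_sum; apply: eq_bigr => j _.
exact: tens_vecm.
Qed.

Lemma nsq_eucl n (v : 'cV[C]_n) : nsq v = (eucl_norm v ^+ 2)%:C%C.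
Proof.
rewrite /eucl_norm sqr_sqrtr; last by apply: sumr_ge0 => i _; rewrite sqr_ge0.
rewrite nsqE rmorph_sum; apply: eq_bigr => i _ /=.
by rewrite big_ord1 rmorphXn.
Qed.

Lemma eucl_norm_ge0 n (v : 'cV[C]_n) : 0 <= eucl_norm v.
Proof. exact: sqrtr_ge0. Qed.

Lemma eucl_norm0 n : eucl_norm (0 : 'cV[C]_n) = 0.
Proof.
apply/eqP; rewrite -sqrf_eq0 -(inj_eq (@complexI R)) -nsq_eucl nsq0; exact:
  eqxx.
Qed.

Lemma eucl_normZ n (t : R) (v : 'cV[C]_n) : 0 <= t ->
  eucl_norm (t%:C%C *: v) = t * eucl_norm v.
Proof.
move=> t0; apply/eqP; rewrite -(eqrXn2 (n := 2)) ?eucl_norm_ge0 ?mulr_ge0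
  ?eucl_norm_ge0 //.
rewrite -(inj_eq (@complexI R)) -nsq_eucl nsqZ nsq_eucl.
have -> : `|t%:C%C : C| = t%:C%C by rewrite ger0_norm // lecR.
by rewrite -rmorphXn -rmorphM exprMn.
Qed.

Lemma opnorm_has_ub m n (A : 'M[C]_(m, n)) :
  has_ubound [set eucl_norm (A *m v) | v in [set v | eucl_norm v <= 1]]%classic.
Proof.
have [k kA] := Cplx_archimedean (mulr_ge0 (ler0n _ n) (nsq_ge0 A)).
exists (k%:R : R) => _ [v /= v1 <-].
rewrite -(ler_pXn2r (ltn0Sn 1)) ?nnegrE ?eucl_norm_ge0 ?ler0n //.
rewrite -lecR -nsq_eucl; apply: le_trans (nsq_mul _ _) _.
apply: le_trans (_ : k%:R * nsq v <= _); first by rewrite ler_wpM2r ?nsq_ge0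
  ?ltW.
apply: le_trans (_ : k%:R * 1 <= _).
  rewrite ler_wpM2l ?ler0n // nsq_eucl -[1](rmorph1 (real_complex R)) lecR.
  by rewrite expr_le1 // eucl_norm_ge0.
rewrite mulr1 rmorphXn rmorph_nat -natrX ler_nat.
by case: (k) => // k'; rewrite expnS expn1 leq_pmulr.
Qed.

Lemma opnorm_le m n (A : 'M[C]_(m, n)) (c : R) : 0 <= c ->
  opnorm A <= c <-> forall v : 'cV[C]_n, nsq (A *m v) <= (c ^+ 2)%:C%C * nsq v.
Proof.
move=> c0; split=> [Ac v|H]; last first.
  apply: ge_sup; first by exists (eucl_norm (A *m 0)), 0 => //=; rewrite
    eucl_norm0.
  move=> _ [v /= v1 <-].
  rewrite -(ler_pXn2r (ltn0Sn 1)) ?nnegrE ?eucl_norm_ge0 //.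
  rewrite -lecR -nsq_eucl; apply: le_trans (H v) _.
  rewrite nsq_eucl -rmorphM lecR ler_piMr ?exprn_ge0 //.
  by rewrite expr_le1 // eucl_norm_ge0.
have [->|v0] := eqVneq v 0; first by rewrite mulmx0 !nsq0 mulr0.
have ev : 0 < eucl_norm v.
  rewrite lt_def eucl_norm_ge0 andbT; apply: contraNneq v0 => ev.
  by rewrite -nsq_eq0 nsq_eucl ev expr0n.
have ti : 0 <= (eucl_norm v)^-1 by rewrite invr_ge0 ltW.
rewrite !nsq_eucl -rmorphM lecR -exprMn ler_pXn2r ?nnegrE ?eucl_norm_ge0 //;
  last first.
  by rewrite mulr_ge0 // ltW.
rewrite -ler_pdivrMr // mulrC -eucl_normZ // scalemxAr; apply: le_trans Ac.
apply: (ub_le_sup (opnorm_has_ub A)); exists ((eucl_norm v)^-1%:C%C *: v) =>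
  //=.
by rewrite eucl_normZ // mulVf // gt_eqF.
Qed.

End OperatorNorm.

(** * Pencil balls in terms of domination *)

Section Balls.
Context (R : realType) (g : nat).
Local Notation C := (Cplx R).

Lemma trtK n m (X : 'I_g -> 'M[C]_(n, m)) : trt (trt X) = X.
Proof. by apply: funext => j; rewrite /trt trmxK. Qed.

Lemma opnorm_ge0 m n (A : 'M[C]_(m, n)) : 0 <= opnorm A.
Proof.
apply: (ub_le_sup (opnorm_has_ub A)); exists 0; rewrite /= ?eucl_norm0 //.
by rewrite mulmx0 eucl_norm0.
Qed.

Lemma pencil_opnorm_le a b n (L : pencil R g a b) (X : mxtuple R g n) (c : R) :
  0 <= c -> opnorm (pencil_eval L X) <= c <-> scontr L (trt X) c%:C%C.
Proof.
move=> c0; split=> [/(opnorm_le _ c0) H y|H].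
  by have := H (vecm y); rewrite pencil_vecm !nsq_vecm rmorphXn.
apply/(opnorm_le _ c0) => v; have [y ->] := vecm_surj v.
by rewrite pencil_vecm !nsq_vecm rmorphXn; apply: H.
Qed.

Lemma pencil_contr a b n (L : pencil R g a b) (X : mxtuple R g n) :
  opnorm (pencil_eval L X) <= 1 <-> contr L (trt X).
Proof.
apply: (iff_trans (pencil_opnorm_le L X ler01)).
by split=> H y; have := H y; rewrite expr1n mul1r.
Qed.

Lemma pencil_evalZ a b n (L : pencil R g a b) (X : mxtuple R g n) (k : C) :
  pencil_eval L (fun j => k *: X j) = k *: pencil_eval L X.
Proof.
rewrite /pencil_eval scaler_sumr; apply: eq_bigr => j _.
by apply/matrixP => i l; rewrite !mxE mulrCA.
Qed.

Lemma opnormZ m n (A : 'M[C]_(m, n)) (t : R) : 0 < t ->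
  opnorm (t%:C%C *: A) = t * opnorm A.
Proof.
have le s B : 0 < s -> opnorm (s%:C%C *: B : 'M[C]_(m, n)) <= s * opnorm B.
  move=> s0; apply/opnorm_le => [|v]; first by rewrite mulr_ge0 ?opnorm_ge0
    ?ltW.
  have /(opnorm_le _ (opnorm_ge0 _)) H := lexx (opnorm B).
  rewrite -scalemxAl nsqZ ger0_norm ?lecR ?(ltW s0) // exprMn rmorphM
    -[leRHS]mulrA.
  by rewrite rmorphXn ler_wpM2l ?exprn_ge0 // lecR ltW.
move=> t0; apply/eqP; rewrite eq_le le //=.
have ti : 0 < t^-1 by rewrite invr_gt0.
rewrite -ler_pdivlMl //; apply: le_trans (le _ _ ti).
have tt : (t^-1)%:C%C * t%:C%C = 1 :> C.
  by rewrite -(rmorphM (real_complex R)) mulVf ?gt_eqF.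
by rewrite scalerA tt scale1r.
Qed.

Lemma opnorm_pencilZ a b n (L : pencil R g a b) (X : mxtuple R g n) (t : R) :
  0 < t -> opnorm (pencil_eval L (fun j => t%:C%C *: X j)) = t * opnorm
    (pencil_eval L X).
Proof. by move=> t0; rewrite pencil_evalZ opnormZ. Qed.

(** If [X] in the closed ball of [L] had [|K(X)| = c > 1], then [X / c] would lie in the open ball
    of [L] while [K(X / c)] has norm 1. *)
Lemma ball_dom a b a' b' (K : pencil R g a b) (L : pencil R g a' b') :
  (forall n (X : mxtuple R g n), pencil_ball L n X -> pencil_ball K n X) ->
  dom K L.
Proof.
move=> LK n X LX; rewrite -[X]trtK; apply/pencil_contr.
rewrite leNgt; apply/negP => c1.
set c := opnorm _ in c1; have c0 : 0 < c by apply: lt_trans c1.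
have ci : 0 < c^-1 by rewrite invr_gt0.
have /LK : pencil_ball L n (fun j => (c^-1)%:C%C *: trt X j).
  rewrite /pencil_ball /= opnorm_pencilZ //.
  apply: le_lt_trans (_ : c^-1 * 1 < 1); last by rewrite mulr1 invf_lt1.
  by rewrite ler_wpM2l ?(ltW ci) //; apply/pencil_contr; rewrite trtK.
by rewrite /pencil_ball /= opnorm_pencilZ // mulVf ?gt_eqF // ltxx.
Qed.

Lemma dom_ball a b a' b' (K : pencil R g a b) (L : pencil R g a' b') n
    (X : mxtuple R g n) : dom K L -> pencil_ball L n X -> pencil_ball K n X.
Proof.
move=> KL; rewrite /pencil_ball /= => LX.
(* The midpoint of [c] and 1 is positive even for [c = 0], so [X / s] makes sense and lies in the
   closed ball of [L]. *)
set c := opnorm _ in LX; pose s := (c + 1) / 2.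
have c0 : 0 <= c by apply: opnorm_ge0.
have cs : c <= s by rewrite /s; lra.
have s1 : s < 1 by rewrite /s; lra.
have s0 : 0 < s by rewrite /s; lra.
have si : 0 < s^-1 by rewrite invr_gt0.
have : contr K (trt (fun j => (s^-1)%:C%C *: X j)).
  by apply: KL; apply/pencil_contr; rewrite opnorm_pencilZ // ler_pdivrMl //
    mulr1.
move/pencil_contr; rewrite opnorm_pencilZ // ler_pdivrMl // mulr1 => le.
exact: le_lt_trans le s1.
Qed.

Lemma same_ball_dom a b a' b' (K : pencil R g a b) (L : pencil R g a' b') :
  same_ball K L <-> dom K L /\ dom L K.
Proof.
split=> [KL|[KL LK] n]; first by split; apply: ball_dom => n X; rewrite KL.
by apply/seteqP; split=> X; apply: dom_ball.
Qed.

Lemma nondegenerateP a b (L : pencil R g a b) : nondegenerate_pencil L <->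
  nondeg L.
Proof.
split=> H n X LX j.
  rewrite -[X j]trmxK -[(X j)^T]/(trt X j) H ?trmx0 //.
  apply/eqP; apply/eqP/matrixP => k l.
  have E (v : 'cV_(b * n)) : pencil_eval L (trt X) *m v = 0.
    have [y ->] := vecm_surj v; rewrite pencil_vecm trtK LX.
    by apply/matrixP => ? ?; rewrite !mxE.
  by have /matrixP/(_ k 0) := E (delta_mx l 0); rewrite -colE !mxE.
rewrite -[X j]trmxK -[(X j)^T]/(trt X j) H ?trmx0 // => y.
apply: vecm_inj; rewrite -pencil_vecm LX mul0mx.
by apply/matrixP => ? ?; rewrite !mxE.
Qed.

Lemma minimal_minp a b (L : pencil R g a b) : minimal_defining_pencil L -> minp
  L.
Proof.
move=> [/nondegenerateP L0 Lmin]; split=> [//|a' b' K LK KL].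
have sb : same_ball K L by apply/same_ball_dom; split.
have K0 : nondegenerate_pencil K.
  by apply/nondegenerateP; apply: (nondeg_dom (@Cplx_archimedean R) LK L0).
exact: Lmin K0 sb.
Qed.

End Balls.

Section Limits.
Context (K : numFieldType) (T : Type) (F : set_system T) (FF : Filter F).

Lemma cvg_sumf (V : normedModType K) (I : Type) (s : seq I) (u : I -> T -> V)
    (l : I -> V) : (forall i, u i x @[x --> F] --> l i) ->
  (\sum_(i <- s) u i x) @[x --> F] --> \sum_(i <- s) l i.
Proof.
move=> ul; elim: s => [|i s IH].
  by rewrite big_nil; under eq_fun do rewrite big_nil; apply: cvg_cst.
by rewrite big_cons; under eq_fun do rewrite big_cons; apply: cvgD.
Qed.

Lemma cvg_mx_linear m n p q (phi : 'M[K]_(m, n) -> 'M[K]_(p, q))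
    (u : T -> 'M[K]_(m, n)) l :
  (forall M, phi M = \sum_i \sum_j M i j *: phi (delta_mx i j)) ->
  u x @[x --> F] --> l -> phi (u x) @[x --> F] --> phi l.
Proof.
move=> phiE ul; rewrite [phi l]phiE; under eq_fun do rewrite phiE.
apply: cvg_sumf => i; apply: cvg_sumf => j; apply: cvgZr_tmp.
exact: (cvg_comp _ _ ul (@coord_continuous _ _ _ i j l)).
Qed.

Lemma cvg_mulmx m n p q (A : 'M[K]_(p, m)) (B : 'M[K]_(n, q))
    (u : T -> 'M[K]_(m, n)) l :
  u x @[x --> F] --> l -> (A *m u x *m B) @[x --> F] --> A *m l *m B.
Proof.
apply: (cvg_mx_linear (phi := fun M => A *m M *m B)) => M.
rewrite {1}[M]matrix_sum_delta mulmx_sumr mulmx_suml; apply: eq_bigr => i _.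
rewrite mulmx_sumr mulmx_suml; apply: eq_bigr => j _.
by rewrite -scalemxAr -scalemxAl.
Qed.

Lemma cvg_tensmx m n p q (A : 'M[K]_(p, q)) (u : T -> 'M[K]_(m, n)) l :
  u x @[x --> F] --> l -> (tensmx A (u x)) @[x --> F] --> tensmx A l.
Proof.
apply: (cvg_mx_linear (phi := fun M => tensmx A M)) => M.
apply/matrixP => i j; rewrite mxE {1}[M]matrix_sum_delta !summxE mulr_sumr.
apply: eq_bigr => k _; rewrite !summxE mulr_sumr; apply: eq_bigr => k' _.
by rewrite !mxE mulrCA.
Qed.

End Limits.

Section NCSeries.
Context (R : realType) (g : nat).
Local Notation C := (Cplx R).

Definition hcoef g' c d (L' : pencil R g' c d) (f : nc_map R g g') : nc_series
  R g c d :=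
  fun w => \sum_i f i w *: L' i.

Lemma tensmxZl a b m n (k : C) (A : 'M[C]_(a, b)) (B : 'M[C]_(m, n)) :
  (k *: A) *t B = A *t (k *: B).
Proof. by apply/matrixP => i j; rewrite !mxE mulrCA mulrA. Qed.

Lemma tensmxDl a b m n (A A' : 'M[C]_(a, b)) (B : 'M[C]_(m, n)) :
  (A + A') *t B = A *t B + A' *t B.
Proof. by apply/matrixP => i j; rewrite !mxE mulrDl. Qed.

Lemma tensmx_suml (I : Type) (r : seq I) a b m n (F : I -> 'M[C]_(a, b)) (B :
  'M[C]_(m, n)) :
  (\sum_(i <- r) F i) *t B = \sum_(i <- r) F i *t B.
Proof.
by apply/matrixP => i j; rewrite !mxE !summxE mulr_suml; apply: eq_bigr => k _;
  rewrite !mxE.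
Qed.

Lemma tensmx_sumr (I : Type) (r : seq I) a b m n (F : I -> 'M[C]_(m, n)) (A :
  'M[C]_(a, b)) :
  A *t (\sum_(i <- r) F i) = \sum_(i <- r) A *t F i.
Proof.
by apply/matrixP => i j; rewrite !mxE !summxE mulr_sumr; apply: eq_bigr => k _;
  rewrite !mxE.
Qed.

Lemma seriesE (V : zmodType) (u : nat -> V) n : series u n = \sum_(m < n) u m.
Proof. by rewrite /series /= big_mkord. Qed.

Section Composition.
Context (g' c d : nat) (L' : pencil R g' c d) (f : nc_map R g g').

Lemma hcoef_term n (X : mxtuple R g n) m :
  nc_term (hcoef L' f) X m = \sum_i L' i *t nc_scalar_term (f i) X m.
Proof.
rewrite /nc_term; under eq_bigr do rewrite tensmx_suml.
rewrite exchange_big; apply: eq_bigr => i _ /=; rewrite tensmx_sumr.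
by apply: eq_bigr => w _; rewrite tensmxZl.
Qed.

Lemma hcoef_series n (X : mxtuple R g n) N :
  series (nc_term (hcoef L' f) X) N =
  \sum_i L' i *t series (nc_scalar_term (f i) X) N.
Proof.
rewrite seriesE; under eq_bigr do rewrite hcoef_term.
rewrite exchange_big; apply: eq_bigr => i _ /=.
by rewrite -tensmx_sumr seriesE.
Qed.

Lemma hcoef_cvg n (X : mxtuple R g n) :
  (forall i, cvgn (series (nc_scalar_term (f i) X))) ->
  series (nc_term (hcoef L' f) X) @ \oo --> comp_eval L' f X.
Proof.
move=> cv; rewrite (_ : series _ =
    fun N => \sum_i L' i *t series (nc_scalar_term (f i) X) N); last first.
  by apply: funext => N; rewrite hcoef_series.
by apply: cvg_sumf => i; apply: cvg_tensmx; apply: cv.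
Qed.

Lemma tev_word_eval n (X : mxtuple R g n) w : (word_eval X w)^T = tev (trt X) w.
Proof.
elim: w => [|j w IH]; first by rewrite /word_eval big_nil trmx1.
rewrite /word_eval big_cons /= -IH.
exact: trmx_mul.
Qed.

Lemma nc_term_vecm n (X : mxtuple R g n) (h : nc_series R g c d) m y :
  nc_term h X m *m vecm y = vecm (\sum_(w : m.-tuple 'I_g) h w *m y *m tev (trt
    X) w).
Proof.
rewrite /nc_term mulmx_suml vecm_sum; apply: eq_bigr => w _.
by rewrite tens_vecm tev_word_eval.
Qed.

Section Nilpotent.
Context (n N : nat) (X : mxtuple R g n).
Context (X0 : forall w, (N <= size w)%N -> tev (trt X) w = 0).

Lemma nilpotent_scalar_eval (phi : nc_scalar_series R g) :
  nc_scalar_eval phi X = series (nc_scalar_term phi X) N.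
Proof.
have X0' w : (N <= size w)%N -> word_eval X w = 0.
  by move=> /X0; rewrite -tev_word_eval => /(congr1 trmx); rewrite trmxK trmx0.
apply: norm_lim_near_cst.
exists N => // k /= Nk; rewrite !seriesE -(subnKC Nk) big_split_ord /=.
rewrite [X in _ + X]big1 ?addr0 // => i _.
by rewrite /nc_scalar_term big1 // => w _; rewrite X0' ?scaler0 // size_tuple
  leq_addr.
Qed.

Lemma nilpotent_comp_eval y :
  comp_eval L' f X *m vecm y = vecm (sev N (hcoef L' f) (trt X) y).
Proof.
have -> : comp_eval L' f X = series (nc_term (hcoef L' f) X) N.
  rewrite hcoef_series /comp_eval /pencil_eval; apply: eq_bigr => i _.
  by rewrite /map_eval nilpotent_scalar_eval.
rewrite seriesE mulmx_suml /sev vecm_sum; apply: eq_bigr => m _.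
exact: nc_term_vecm.
Qed.

End Nilpotent.

Lemma ball_map_nilcontr a b (L : pencil R g a b) : analytic_ball_map L L' f ->
  nilcontr L (hcoef L' f).
Proof.
move=> [_ Lf] n Z N rho r0 r1 Z0 LZ y.
rewrite -nsq_vecm -[Z]trtK -nilpotent_comp_eval; last by rewrite trtK.
have [rR rE] : exists r : R, rho = r%:C%C.
  by exists (complex.Re rho); rewrite RRe_real // ger0_real.
rewrite rE lecR in r0; rewrite rE -[1](rmorph1 (real_complex R)) ltcR in r1.
have /Lf : pencil_ball L n (trt Z).
  apply: le_lt_trans r1; apply/pencil_opnorm_le; rewrite ?trtK -?rE //.
rewrite /pencil_ball /= => /ltW /(opnorm_le _ ler01)/(_ (vecm y)).
by rewrite expr1n mul1r nsq_vecm.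
Qed.

End Composition.

End NCSeries.

(** * The linear part and boundary values *)

Section LinearPart.
Context (R : realType) (g : nat).
Local Notation C := (Cplx R).

Lemma vecm_mul_inj m b n (A B : 'M[C]_(m, b * n)) :
  (forall y : 'M[C]_(b, n), A *m vecm y = B *m vecm y) -> A = B.
Proof.
move=> H; apply/matrixP => k l; have [y yE] := vecm_surj (delta_mx l 0 :
  'cV[C]_(b * n)).
by have /matrixP/(_ k 0) := H y; rewrite -yE -!colE !mxE.
Qed.

Lemma opnorm_eq a b c d (A : 'M[C]_(a, b)) (B : 'M[C]_(c, d)) :
  (forall r, 0 <= r -> opnorm A <= r <-> opnorm B <= r) -> opnorm A = opnorm B.
Proof.
move=> H; apply/eqP; rewrite eq_le; apply/andP; split.
  by apply/H => //; apply: opnorm_ge0.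
by apply/H => //; apply: opnorm_ge0.
Qed.

Lemma nsq_unimodular (K : numClosedFieldType) m n p (A : 'M[K]_(m, n)) k
    (v : 'M[K]_(n, p)) : `|k| = 1 -> nsq ((k *: A) *m v) = nsq (A *m v).
Proof. by move=> k1; rewrite -scalemxAl nsqZ k1 expr1n mul1r. Qed.

Lemma opnorm_unimodular m n (A : 'M[C]_(m, n)) (k : C) : `|k| = 1 ->
  opnorm (k *: A) = opnorm A.
Proof.
move=> k1; apply: opnorm_eq => r r0.
by split=> /(opnorm_le _ r0) H; apply/(opnorm_le _ r0) => v;
  have := H v; rewrite nsq_unimodular.
Qed.

Lemma expi_unimodular (t : R) : `|expi t| = 1.
Proof. by rewrite normc_def /= cos2Dsin2 sqrtr1. Qed.

Lemma tev_corner n m (X : 'I_g -> 'M[C]_(n, m)) w :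
  (2 <= size w)%N -> tev (corner X) w = 0.
Proof.
case: w => [|j [|k w]] //= _; rewrite -mulmxA /corner mulmx_block.
by rewrite !(mul0mx, mulmx0) !addr0 block_mx0 mulmx0.
Qed.

Lemma opnorm_corner a b (K : pencil R g a b) n (X : mxtuple R g n) :
  opnorm (pencil_eval K (trt (corner (trt X)))) = opnorm (pencil_eval K X).
Proof.
apply: opnorm_eq => r r0.
apply: iff_trans (pencil_opnorm_le K _ r0) _.
apply: iff_trans (iff_sym (pencil_opnorm_le K X r0)); rewrite trtK.
have r2 : 0 <= r%:C%C ^+ 2 :> C by rewrite exprn_ge0 // lecR.
split=> H y.
  by have := H (row_mx y 0); rewrite pv_corner !nsq_row_mx !nsq0 add0r addr0.
rewrite -[y]hsubmxK pv_corner !nsq_row_mx nsq0 add0r.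
by apply: le_trans (H _) _; rewrite ler_wpM2l // lerDl nsq_ge0.
Qed.

(** The line has positive measure, at least that of the unit interval, so a property true almost
    everywhere holds somewhere. *)
Lemma ae_exists (P : R -> Prop) : {ae @lebesgue_measure R, forall t, P t} ->
  exists t, P t.
Proof.
move=> aeP.
have pf : ProperFilter (almost_everywhere (@lebesgue_measure R)).
  apply: ae_properfilter_algebraOfSetsType.
  apply: (@lt_le_trans _ _ (lebesgue_measure `[0 : R, 1]%classic)).
    by rewrite lebesgue_measure_itv /= lte_fin ltr01 oppr0 adde0 lte_fin ltr01.
  by apply: le_measure; rewrite ?inE //=; apply: measurable_itv.
exact: filter_ex aeP.
Qed.

Lemma cvg_real_complex_left1 : (r%:C%C : C) @[r --> (1 : R)^'-] --> (1 : C).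
Proof.
apply/cvgrPdist_lt => eps eps0.
have epsR : (complex.Re eps)%:C%C = eps by rewrite RRe_real // gtr0_real.
have e0 : 0 < complex.Re eps by rewrite -(@ltcR R) epsR.
have id1 : r @[r --> (1 : R)^'-] --> (1 : R) by apply: cvg_at_left_filter;
  apply: cvg_id.
move/cvgrPdist_lt : id1 => /(_ _ e0); apply: filterS => r.
rewrite -(@ltcR R) epsR; congr (_ < _).
rewrite -[1 in RHS](rmorph1 (real_complex R)) -rmorphB normc_def /= expr0n /=
  addr0.
by rewrite sqrtr_sqr.
Qed.

Section Boundary.
Context (a b g' c d : nat) (L : pencil R g a b) (L' : pencil R g' c d).
Context (f : nc_map R g g').

Lemma coef_nil : vanishes_at_zero f -> hcoef L' f [::] = 0.
Proof.
move=> f0; rewrite /hcoef big1 // => i _.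
have := f0 1%N i; rewrite /map_eval (@nilpotent_scalar_eval _ _ _ 1).
  rewrite seriesE big_ord1 /nc_scalar_term (big_pred1 [tuple]) => [|v]; last
    first.
    by apply/esym/eqP/val_inj/size0nil/size_tuple.
  rewrite /word_eval big_nil => /matrixP/(_ 0 0).
  by rewrite !mxE mulr1 => ->; rewrite scale0r.
by move=> [|j w] //= _; rewrite /trt trmx0 mulmx0.
Qed.

Definition linear_part : pencil R g c d := fun j => hcoef L' f [:: j].

Lemma comp_eval_corner n (X : mxtuple R g n) (z : C) : vanishes_at_zero f ->
  comp_eval L' f (fun j => z *: trt (corner (trt X)) j) =
  z *: pencil_eval linear_part (trt (corner (trt X))).
Proof.
move=> f0; apply: vecm_mul_inj => y.
have trtE : trt (fun j => z *: trt (corner (trt X)) j) =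
    corner (fun j => z *: trt X j).
  apply: funext => j; rewrite /trt /corner linearZ /= trmxK scale_block_mx.
  by rewrite !scaler0.
rewrite (@nilpotent_comp_eval _ _ _ _ _ _ _ _ 2); last first.
  by move=> w; rewrite trtE; apply: tev_corner.
rewrite -pencil_evalZ pencil_vecm; congr vecm.
rewrite /sev big_ord_recl big_ord1 /= [X in X + _](_ : _ = 0) ?add0r; last
  first.
  rewrite (big_pred1 [tuple]) => [|v]; last first.
    by apply/esym/eqP/val_inj/size0nil/size_tuple.
  by rewrite /= coef_nil // mul0mx mul0mx.
rewrite (sum_tuple_cons _ (fun w => hcoef L' f w *m y *m tev (trt _) w)).
rewrite (big_pred1 [tuple]) => [|v]; last first.
  by apply/esym/eqP/val_inj/size0nil/size_tuple.
by apply: eq_bigr => j _; rewrite /= mul1mx.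
Qed.

Lemma boundary_linear_part n (X : mxtuple R g n) : vanishes_at_zero f ->
  maps_boundary_to_boundary L L' f -> opnorm (pencil_eval L X) = 1 ->
  opnorm (pencil_eval linear_part X) = 1.
Proof.
move=> f0 bd X1; rewrite -opnorm_corner.
(* One good angle is enough: on a corner tuple the radial limit is [expi t] times the linear part,
   whose norm does not depend on [t]. *)
have /bd/ae_exists[t [B Bt B1]] : pencil_sphere L _ (trt (corner (trt X))).
  by rewrite /pencil_sphere /= opnorm_corner.
rewrite -(opnorm_unimodular _ (expi_unimodular t)) -{}B1; congr opnorm.
set Xc := trt _ in Bt *; set A := pencil_eval linear_part Xc.
have E : (fun r : R => comp_eval L' f (fun j => (r%:C%C * expi t) *: Xc j)) =
    (fun r : R => (r%:C%C * expi t) *: A).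
  by apply: funext => r; rewrite comp_eval_corner.
have {}Bt : comp_eval L' f (fun j => (r%:C%C * expi t) *: Xc j)
    @[r --> (1 : R)^'-] --> B by exact: Bt.
have H : ((r%:C%C * expi t) *: A) @[r --> (1 : R)^'-] --> (1 * expi t) *: A.
  apply: cvgZr_tmp.
  by apply: cvgM; [exact: cvg_real_complex_left1 | exact: cvg_cst].
rewrite mul1r in H; rewrite E in Bt.
by apply: (cvg_unique (@norm_hausdorff _ _)) H Bt.
Qed.

(** Homogeneity reduces to norm 1, unless [L(X) = 0], where nondegeneracy gives [X = 0]. *)
Lemma opnorm_linear_part n (X : mxtuple R g n) : nondegenerate_pencil L ->
  vanishes_at_zero f -> maps_boundary_to_boundary L L' f ->
  opnorm (pencil_eval linear_part X) = opnorm (pencil_eval L X).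
Proof.
move=> L0 f0 bd; set c0 := opnorm (pencil_eval L X).
have [c00|c0N] := eqVneq c0 0.
  have X0 : pencil_eval L X = 0.
    have /(opnorm_le _ (lexx 0)) H : opnorm (pencil_eval L X) <= 0.
      by rewrite -/c0 c00.
    apply: vecm_mul_inj => y; rewrite mul0mx; apply/eqP; rewrite -nsq_eq0 eq_le
      nsq_ge0 andbT.
    by have := H (vecm y); rewrite expr0n mul0r.
  rewrite c00; apply/eqP; rewrite eq_le opnorm_ge0 andbT.
  apply/(opnorm_le _ (lexx 0)) => v; rewrite /pencil_eval big1 => [|j _].
    by rewrite mul0mx nsq0 expr0n mul0r.
  by rewrite (L0 _ _ X0) tensmx0.
have c0p : 0 < c0 by rewrite lt_def c0N opnorm_ge0.
have ci : 0 < c0^-1 by rewrite invr_gt0.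
have : opnorm (pencil_eval linear_part (fun j => (c0^-1)%:C%C *: X j)) = 1.
  by apply: boundary_linear_part => //; rewrite opnorm_pencilZ // mulVf.
rewrite opnorm_pencilZ // => E.
by rewrite -[LHS](mulKf (invr_neq0 c0N)) E invrK mulr1.
Qed.

Lemma same_ball_linear_part : nondegenerate_pencil L ->
  vanishes_at_zero f -> maps_boundary_to_boundary L L' f -> same_ball
    linear_part L.
Proof.
move=> L0 f0 bd n; apply/seteqP.
by split=> X; rewrite /pencil_ball /= opnorm_linear_part.
Qed.

End Boundary.

End LinearPart.

(** * Block decomposition *)

Section Amplification.
Context (R : realType).
Local Notation C := (Cplx R).

Lemma amplM a b c (A : 'M[C]_(a, b)) (B : 'M[C]_(b, c)) n :
  ampl (A *m B) n = ampl A n *m ampl B n.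
Proof. by rewrite /ampl tensmx_mul mulmx1. Qed.

Lemma ampl_dag a b (A : 'M[C]_(a, b)) n : ampl (A^t*) n = (ampl A n)^t*.
Proof.
apply/matrixP => i j; rewrite !mxE rmorphM /= eq_sym; congr (_ * _).
by rewrite rmorph_nat.
Qed.

Lemma ampl1 a n : ampl (1%:M : 'M[C]_a) n = 1%:M.
Proof.
apply/matrixP => i j; case: (mxtens_indexP i) => i1 i2; case: (mxtens_indexP j)
  => j1 j2.
rewrite /ampl tensmxE !mxE (can_eq (@mxtens_indexK _ _)) -pair_eqE /=.
by rewrite -natrM mulnb.
Qed.

Lemma amplD a b (A B : 'M[C]_(a, b)) n : ampl (A + B) n = ampl A n + ampl B n.
Proof. exact: tensmxDl. Qed.

Lemma ampl_row_mx a b c n (A : 'M[C]_(a, b)) (B : 'M[C]_(a, c)) :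
  ampl (row_mx A B) n =
  castmx (erefl, ampl_dim n erefl) (row_mx (ampl A n) (ampl B n)).
Proof.
apply/matrixP => i j; rewrite castmxE cast_ord_id.
case: (mxtens_indexP j) => j1 k.
have [j1' ->|j1' ->] := split_ordP j1.
  rewrite (_ : cast_ord _ _ = lshift _ (mxtens_index (j1', k))); last exact:
    val_inj.
  by rewrite row_mxEl /ampl; case: (mxtens_indexP i) => i1 k1; rewrite !tensmxE
    row_mxEl.
rewrite (_ : cast_ord _ _ = rshift _ (mxtens_index (j1', k))); last first.
  by apply: val_inj; rewrite /= mulnDl addnA.
by rewrite row_mxEr /ampl; case: (mxtens_indexP i) => i1 k1; rewrite !tensmxE
  row_mxEr.
Qed.

Lemma castmx_sandwich m1 m2 c1 c2 k1 k2 (e : c1 = c2) (e' : k1 = k2)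
    (A : 'M[C]_(m1, c1)) (D : 'M[C]_(c1, k1)) (B : 'M[C]_(m2, k1)) :
  castmx (erefl, e) A *m castmx (e, e') D *m (castmx (erefl, e') B)^t* = A *m D
    *m B^t*.
Proof. by case: _ / e; case: _ / e'; rewrite !castmx_id. Qed.

Lemma two_block_expand c d a1 a2 b1 b2 (W1 : 'M[C]_(c, a1)) (A1 : 'M[C]_(a1, c))
    (W2 : 'M[C]_(c, a2)) (A2 : 'M[C]_(a2, c)) (V1 : 'M[C]_(d, b1)) (B1 :
      'M[C]_(b1, d))
    (V2 : 'M[C]_(d, b2)) (B2 : 'M[C]_(b2, d)) (H : 'M[C]_(c, d)) :
  W1 *m A1 + W2 *m A2 = 1%:M -> V1 *m B1 + V2 *m B2 = 1%:M ->
  A1 *m H *m V2 = 0 -> A2 *m H *m V1 = 0 ->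
  H = W1 *m (A1 *m H *m V1) *m B1 + W2 *m (A2 *m H *m V2) *m B2.
Proof.
move=> WA VB H12 H21.
transitivity (W1 *m (A1 *m H *m V1) *m B1 + W1 *m (A1 *m H *m V2) *m B2
  + (W2 *m (A2 *m H *m V1) *m B1 + W2 *m (A2 *m H *m V2) *m B2)); last first.
  by rewrite H12 H21 !mulmx0 !mul0mx addr0 add0r.
rewrite -[LHS]mulmx1 -[X in X *m _]mul1mx -WA -VB !mulmxDr !mulmxDl !mulmxA.
exact: addrACA.
Qed.

(** Factor the projection [1 - W W^*]. The row formed by [W] and the new columns is inverted by its
    adjoint on both sides, which forces the sizes to add up. *)
Lemma complete_isometry a b (W : 'M[C]_(b, a)) : W^t* *m W = 1%:M ->
  exists m (E : (a + m = b)%N) (W' : 'M[C]_(b, m)),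
    [/\ W^t* *m W' = 0, W'^t* *m W' = 1%:M & W *m W^t* + W' *m W'^t* = 1%:M].
Proof.
move=> WW; pose Q := 1%:M - W *m W^t*.
have QW : Q *m W = 0 by rewrite /Q mulmxBl mul1mx -mulmxA WW mulmx1 subrr.
have Qh : Q^t* = Q by rewrite /Q dagB dag1 dagM trmxCK.
have QQ : Q *m Q = Q by rewrite {2}/Q mulmxBr mulmx1 mulmxA QW mul0mx subr0.
have [Q1 [Q11 Q1Q]] := projection_factor QQ Qh.
have Q1W : Q1 *m W = 0.
  have : Q1 *m (Q1^t* *m Q1) *m W = 0 by rewrite Q1Q -mulmxA QW mulmx0.
  by rewrite mulmxA Q11 mul1mx.
pose V := row_mx W (Q1^t*).
have V1 : V *m V^t* = 1%:M.
  by rewrite tr_row_mx map_col_mx mul_row_col trmxCK Q1Q addrC subrK.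
have V2 : V^t* *m V = 1%:M.
  rewrite tr_row_mx map_col_mx mul_col_row trmxCK WW Q11 Q1W.
  by rewrite -dagM Q1W dag0 -scalar_mx_block.
have E : (a + \rank Q = b)%N.
  by apply/eqP; rewrite eqn_leq (mulmx1_min V1) (mulmx1_min V2).
exists (\rank Q), E, (Q1^t*); rewrite trmxCK; split=> //.
  by rewrite -dagM Q1W dag0.
by rewrite Q1Q addrC subrK.
Qed.

Lemma block_sandwich a b m m' c d n (E' : (a + m' = c)%N) (E : (b + m = d)%N)
    (W : 'M[C]_(c, a)) (W' : 'M[C]_(c, m')) (V : 'M[C]_(d, b)) (V' : 'M[C]_(d,
      m))
    (H : 'M[C]_(c * n, d * n)) :
  W *m W^t* + W' *m W'^t* = 1%:M -> V *m V^t* + V' *m V'^t* = 1%:M ->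
  ampl (W^t*) n *m H *m ampl V' n = 0 -> ampl (W'^t*) n *m H *m ampl V n = 0 ->
  H = ampl (castmx (erefl, E') (row_mx W W')) n *m
      diag_block E' E (ampl (W^t*) n *m H *m ampl V n)
        (ampl (W'^t*) n *m H *m ampl V' n) *m
      (ampl (castmx (erefl, E) (row_mx V V')) n)^t*.
Proof.
case: _ / E' in W W' H *; case: _ / E in V V' H *.
rewrite !castmx_id !ampl_row_mx /diag_block castmx_sandwich => W1 V1 H12 H21.
rewrite tr_row_mx map_col_mx mul_row_block !mulmx0 addr0 add0r mul_row_col.
have W1n : ampl W n *m ampl (W^t*) n + ampl W' n *m ampl (W'^t*) n = 1%:M.
  by rewrite -!amplM -amplD W1 ampl1.
have V1n : ampl V n *m (ampl V n)^t* + ampl V' n *m (ampl V' n)^t* = 1%:M.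
  by rewrite -!ampl_dag -!amplM -amplD V1 ampl1.
exact: two_block_expand.
Qed.

Section Evaluation.
Context (g g' c d : nat) (L' : pencil R g' c d) (f : nc_map R g g').
Context (n : nat) (X : mxtuple R g n).
Context (cvf : forall i, cvgn (series (nc_scalar_term (f i) X))).

Definition compress a b (A : 'M[C]_(a, c)) (B : 'M[C]_(d, b)) : nc_series R g a
  b :=
  fun w => A *m hcoef L' f w *m B.

Lemma compress_cvg a b (A : 'M[C]_(a, c)) (B : 'M[C]_(d, b)) :
  series (nc_term (compress A B) X) @ \oo -->
  ampl A n *m comp_eval L' f X *m ampl B n.
Proof.
rewrite (_ : series _ = fun N =>
    ampl A n *m series (nc_term (hcoef L' f) X) N *m ampl B n).
  by apply: cvg_mulmx; apply: hcoef_cvg.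
apply: funext => N; rewrite !seriesE mulmx_sumr mulmx_suml; apply: eq_bigr => m
  _.
rewrite /nc_term mulmx_sumr mulmx_suml; apply: eq_bigr => w _.
by rewrite /ampl !tensmx_mul mul1mx mulmx1.
Qed.

Lemma compress_eval a b (A : 'M[C]_(a, c)) (B : 'M[C]_(d, b)) :
  nc_eval (compress A B) X = ampl A n *m comp_eval L' f X *m ampl B n.
Proof. by apply: cvg_lim; [exact: norm_hausdorff | exact: compress_cvg]. Qed.

Lemma compress_linear a b (A : 'M[C]_(a, c)) (B : 'M[C]_(d, b)) (P : pencil R g
  a b) :
  (forall j, compress A B [:: j] = P j) ->
  (forall w, size w != 1%N -> compress A B w = 0) ->
  ampl A n *m comp_eval L' f X *m ampl B n = pencil_eval P X.
Proof.
move=> AP A0; rewrite -compress_eval; apply: norm_lim_near_cst.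
have term m : m != 1%N -> nc_term (compress A B) X m = 0.
  move=> m1; rewrite /nc_term big1 // => w _.
  by rewrite A0 ?size_tuple // tens0mx.
exists 2%N => // N /= N2; rewrite seriesE -(subnKC N2) big_split_ord /=.
rewrite [X in _ + X]big1 ?addr0 => [|i _]; last by rewrite term.
rewrite big_ord_recl big_ord1 /= term // add0r /nc_term.
rewrite (sum_tuple_cons _ (fun w => compress A B w *t word_eval X w)).
rewrite (big_pred1 [tuple]) => [|v]; last first.
  by apply/esym/eqP/val_inj/size0nil/size_tuple.
apply: eq_bigr => j _; rewrite /= AP; congr (_ *t _).
by rewrite /word_eval big_seq1.
Qed.

End Evaluation.

Lemma nsq_coisometry m n p (A : 'M[C]_(m, n)) (v : 'M[C]_(n, p)) :
  A *m A^t* = 1%:M -> nsq (A *m v) <= nsq v.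
Proof.
move=> A1; have := hip_le (A^t* *m (A *m v)) v.
have -> : hip (A^t* *m (A *m v)) v = nsq (A *m v) by rewrite hip_mull trmxCK.
have -> : hip v (A^t* *m (A *m v)) = nsq (A *m v) by rewrite hip_mull' trmxCK.
have -> : nsq (A^t* *m (A *m v)) = nsq (A *m v) by rewrite nsq_unitl ?trmxCK.
by rewrite lerD2l.
Qed.

Lemma opnorm_compress a b c d (A : 'M[C]_(a, c)) (H : 'M[C]_(c, d)) (B :
  'M[C]_(d, b)) :
  A *m A^t* = 1%:M -> B^t* *m B = 1%:M -> opnorm H <= 1 -> opnorm (A *m H *m B)
    <= 1.
Proof.
move=> A1 B1 /(opnorm_le _ ler01) H1; apply/(opnorm_le _ ler01) => v.
rewrite -!mulmxA; apply: le_trans (nsq_coisometry _ A1) _.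
by apply: le_trans (H1 _) _; rewrite nsq_unitl.
Qed.

End Amplification.

Section Compressions.
Context (C : numClosedFieldType) (g : nat).

Lemma dom_compress_col a b c d e (K : 'I_g -> 'M[C]_(a, b)) (M : 'I_g ->
  'M[C]_(c, d))
    (T : 'I_g -> 'M[C]_(e, d)) W V : W^t* *m W = 1%:M -> V^t* *m V = 1%:M ->
  (forall j, W^t* *m M j *m V = K j) ->
  dom (fun j => col_mx (K j) (T j *m V)) (fun j => col_mx (M j) (T j)).
Proof.
move=> W1 V1 MK; pose A : 'M[C]_(a + e, c + e) := block_mx (W^t*) 0 0 1%:M.
have -> : (fun j => col_mx (K j) (T j *m V)) =
    (fun j => A *m (col_mx (M j) (T j) *m V)).
  apply: funext => j; rewrite [col_mx (M j) (T j) *m V]mul_col_mx mul_block_col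
    !mul0mx addr0 add0r mul1mx.
  by rewrite mulmxA MK.
have D1 := dom_mulr (K := fun j => col_mx (M j) (T j)) V1.
apply: (dom_trans _ D1); apply: dom_mull.
rewrite /A tr_block_mx map_block_mx trmxCK !trmx0 !map_mx0 dag1 mulmx_block.
by rewrite !(mulmx0, mul0mx, addr0, add0r) mulmx1 W1 -scalar_mx_block.
Qed.

Lemma dom_compress_row a b c d e (K : 'I_g -> 'M[C]_(a, b)) (M : 'I_g ->
  'M[C]_(c, d))
    (T : 'I_g -> 'M[C]_(c, e)) W V : W^t* *m W = 1%:M -> V^t* *m V = 1%:M ->
  (forall j, W^t* *m M j *m V = K j) ->
  dom (fun j => row_mx (K j) (W^t* *m T j)) (fun j => row_mx (M j) (T j)).
Proof.
move=> W1 V1 MK; pose B : 'M[C]_(d + e, b + e) := block_mx V 0 0 1%:M.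
have -> : (fun j => row_mx (K j) (W^t* *m T j)) =
    (fun j => W^t* *m (row_mx (M j) (T j) *m B)).
  apply: funext => j; rewrite /B mul_row_block !mulmx0 addr0 add0r mulmx1.
  by rewrite mul_mx_row mulmxA MK.
have B1 : B^t* *m B = 1%:M.
  rewrite /B tr_block_mx map_block_mx !trmx0 !map_mx0 dag1 mulmx_block.
  by rewrite !(mulmx0, mul0mx, addr0, add0r) mulmx1 V1 -scalar_mx_block.
have D1 := dom_mulr (K := fun j => row_mx (M j) (T j)) B1.
by apply: (dom_trans _ D1); apply: dom_mull; rewrite trmxCK.
Qed.

Lemma nilcontr_dom a b a' b' c d (L : 'I_g -> 'M[C]_(a, b))
    (K : 'I_g -> 'M[C]_(a', b')) (h : seq 'I_g -> 'M[C]_(c, d)) :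
  dom L K -> nilcontr L h -> nilcontr K h.
Proof.
move=> LK Lh n Z N rho r0 r1 Z0 KZ.
(* The rescaling below divides by the radius, which may be 0; [2^-1] serves in that case. *)
have [s [s0 s1 KZs]] : exists s, [/\ 0 < s, s < 1 & scontr K Z s].
  have [E|rN] := eqVneq rho 0; last by exists rho; split=> //; rewrite lt_def
    rN.
  exists 2^-1; split; [by rewrite invr_gt0 | by rewrite invf_lt1 ?ltr1n |].
  move=> y; apply: le_trans (KZ y) _; rewrite E expr0n /= mul0r.
  by rewrite mulr_ge0 ?nsq_ge0 ?exprn_ge0 ?invr_ge0 ?ler0n.
apply: Lh (ltW s0) s1 Z0 _ => y.
have si : 0 <= s^-1 by rewrite invr_ge0 ltW.
have : contr L (fun j => s^-1 *: Z j).
  apply: LK => z; rewrite pvZX nsqZ (ger0_norm si) exprVn mulrC.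
  by rewrite ler_pdivrMr ?exprn_gt0 // mulrC.
move=> /(_ y); rewrite pvZX nsqZ (ger0_norm si) exprVn mulrC.
by rewrite ler_pdivrMr ?exprn_gt0 // mulrC.
Qed.

Lemma castmx_row_unitary a m c (E : (a + m = c)%N) (W : 'M[C]_(c, a)) (W' :
  'M[C]_(c, m)) :
  W *m W^t* + W' *m W'^t* = 1%:M -> castmx (erefl, E) (row_mx W W') \is
    unitarymx.
Proof.
case: _ / E in W W' * => W1; apply/unitarymxP.
by rewrite castmx_id tr_row_mx map_col_mx mul_row_col.
Qed.

End Compressions.

(** Compression by [W] and [V] turns the linear part of [h] into [K] and leaves [delta h_uj V] below
    it, or [delta W^* h_ju] beside it; [minp_col] and [minp_row] make these vanish. *)
Lemma higher_coef_eq0 (R : realType) (g a b c d : nat)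
    (K : 'I_g -> 'M[Cplx R]_(a, b)) (h : seq 'I_g -> 'M[Cplx R]_(c, d)) W V :
  (0 < g)%N -> minp K -> nilcontr K h -> itw K (fun j => h [:: j]) W V ->
  W^t* *m W = 1%:M -> V^t* *m V = 1%:M ->
  forall w, (1 < size w)%N -> h w *m V = 0 /\ W^t* *m h w = 0.
Proof.
move=> g0 Kmin hK WV W1 V1 w w1.
have arch := @Cplx_archimedean R.
have WM j : W^t* *m h [:: j] = K j *m V^t*.
  by have [] := itw_dag WV j.
split.
  case/lastP: w w1 => // u j; rewrite size_rcons ltnS => u0.
  have [de de0 D] := nilcontr_dom_col hK arch u0.
  have D1 : dom (fun k => col_mx (K k) (de *: h (rcons u k) *m V)) K.
    apply: (dom_trans _ D).
    apply: (dom_compress_col (W := W) (V := V)) => // k.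
    by have [h1 _] := WV k; rewrite -mulmxA h1 mulmxA W1 mul1mx.
  have /eqP := minp_col g0 Kmin D1 j.
  by rewrite -scalemxAl scaler_eq0 (negbTE de0) => /eqP.
case: w w1 => // j u; rewrite /= ltnS => u0.
have [de de0 D] := nilcontr_dom_row hK arch u0.
have D1 : dom (fun k => row_mx (K k) (W^t* *m (de *: h (k :: u)))) K.
  apply: (dom_trans _ D).
  apply: (dom_compress_row (W := W) (V := V)) => // k.
  by rewrite WM -mulmxA V1 mulmx1.
have /eqP := minp_row g0 Kmin D1 j.
by rewrite -scalemxAr scaler_eq0 (negbTE de0) => /eqP.
Qed.

Theorem corollary6p3 (R : realType) (g : nat) (g_gt0 : (0 < g)%N)
    (d' d : nat) (L : pencil R g d' d) (p' p : nat) (Lt : pencil R g p' p)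
    (g' l' l : nat) (L' : pencil R g' l' l) (f : nc_map R g g') :
  nondegenerate_pencil L ->
  minimal_defining_pencil_for L Lt ->
  ball_to_ball_map L L' f ->
  vanishes_at_zero f ->
  exists (m m' : nat) (El' : (p' + m' = l')%N) (El : (p + m = l)%N)
         (U : 'M[Cplx R]_l') (V : 'M[Cplx R]_l) (ft : nc_series R g m' m),
    [/\ U \is unitarymx,
        V \is unitarymx,
        analytic_on L ft,
        contraction_valued L ft
      & forall (n : nat) (X : mxtuple R g n), pencil_ball L n X ->
          comp_eval L' f X =
          ampl U n *m diag_block El' El (pencil_eval Lt X) (nc_eval ft X)
            *m (ampl V n)^t*].
Proof.
move=> L0 [/minimal_minp Ltmin LtL] [fL fbd] f0.
pose M := linear_part L' f; pose h := hcoef L' f.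
have /same_ball_dom[ML LM] : same_ball M L by apply: same_ball_linear_part.
have /same_ball_dom[LtL1 LLt] := LtL.
have [W [D [WD W1 D1]]] := minp_summand g_gt0 Ltmin (dom_trans LtL1 LM)
  (dom_trans ML LLt).
have hLt : nilcontr Lt h.
  by apply: nilcontr_dom LLt (ball_map_nilcontr fL).
have higher := higher_coef_eq0 g_gt0 Ltmin hLt WD W1 D1.
have [m' [El' [W' [WW' W'1 Wc]]]] := complete_isometry W1.
have [m [El [D' [DD' D'1 Dc]]]] := complete_isometry D1.
have cvf n (X : mxtuple R g n) : pencil_ball L n X ->
    forall i, cvgn (series (nc_scalar_term (f i) X)).
  by move=> XL i; apply: fL.1.
(* The unitaries complete the isometries [W] and [D], and [ft] is the compression of [L' o f] to
   their complements, hence contraction-valued. *)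
exists m, m', El', El, (castmx (erefl, El') (row_mx W W')),
  (castmx (erefl, El) (row_mx D D')), (compress L' f (W'^t*) D').
split.
- exact: castmx_row_unitary.
- exact: castmx_row_unitary.
- by move=> n X /cvf cX; apply/cvg_ex; eexists; apply: compress_cvg cX _ _ _ _.
- move=> n X XL; rewrite compress_eval; last exact: cvf.
  apply: opnorm_compress.
  + by rewrite -ampl_dag trmxCK -amplM W'1 ampl1.
  + by rewrite -ampl_dag -amplM D'1 ampl1.
  + by apply: ltW; apply: fL.2 XL.
move=> n X XL.
have dual j : W^t* *m M j = Lt j *m D^t* by have [] := itw_dag WD j.
have h0 : hcoef L' f [::] = 0 by apply: coef_nil.
rewrite compress_eval; last exact: cvf.
have E11 : ampl (W^t*) n *m comp_eval L' f X *m ampl D n = pencil_eval Lt X.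
  apply: (compress_linear (cvf n X XL)) => [j|[|j [|k w]] // _]; rewrite
    /compress.
  - by rewrite -[hcoef _ _ _]/(M j) dual -mulmxA D1 mulmx1.
  - by rewrite h0 mulmx0 mul0mx.
  - by rewrite (higher _ _).2 // mul0mx.
have pencil0 a b : pencil_eval (fun=> 0 : 'M[Cplx R]_(a, b)) X = 0.
  by rewrite /pencil_eval big1 // => j _; rewrite tens0mx.
(* All coefficients of this corner vanish; in degree one because [W^* M_j = Lt_j D^*] and [D'] is
   orthogonal to [D]. For [E21] the relation is [M_j D = W Lt_j]. *)
have E12 : ampl (W^t*) n *m comp_eval L' f X *m ampl D' n = 0.
  rewrite -(pencil0 p' m); apply: (compress_linear (cvf n X XL)) => [j|[|j [|k
    w]] // _]; rewrite /compress.
  - by rewrite -[hcoef _ _ _]/(M j) dual -mulmxA DD' mulmx0.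
  - by rewrite h0 mulmx0 mul0mx.
  - by rewrite (higher _ _).2 // mul0mx.
have E21 : ampl (W'^t*) n *m comp_eval L' f X *m ampl D n = 0.
  rewrite -(pencil0 m' p); apply: (compress_linear (cvf n X XL)) => [j|[|j [|k
    w]] // _]; rewrite /compress.
  - have [MD _] := WD j; rewrite -[hcoef _ _ _]/(M j) -mulmxA MD mulmxA.
    by rewrite -[W'^t* *m W]trmxCK dagM trmxCK WW' dag0 mul0mx.
  - by rewrite h0 mulmx0 mul0mx.
  - by rewrite -mulmxA (higher _ _).1 // mulmx0.
by rewrite -{1}E11; apply: block_sandwich.
Qed.
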